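(* Let $\tau\in\mathfrak M_{1,c}(\mathrm{Rat})$ with $J_{\ker}(G_\tau)=\emptyset$, $J(G_\tau)\ne\emptyset$ and $S_\tau\subset F(G_\tau)$. Let $r=\prod_{L\in\mathrm{Min}(G_\tau,\hat{\mathbb C})}\dim_{\mathbb C}\mathrm{LS}(\mathcal U_{f,\tau}(L))$. Then there are constants $\alpha\in(0,1)$, $\lambda\in(0,1)$ and $C>0$ such that for every $\varphi\in C^\alpha(\hat{\mathbb C})$ and every $n\in\mathbb N$: (1) $\|M_\tau^{nr}(\varphi)-\pi_\tau(\varphi)\|_\alpha\le C\lambda^n\|\varphi-\pi_\tau(\varphi)\|_\alpha$; (2) $\|M_\tau^{n}(\varphi-\pi_\tau(\varphi))\|_\alpha\le C\lambda^n\|\varphi-\pi_\tau(\varphi)\|_\alpha$; (3) $\|M_\tau^{n}(\varphi-\pi_\tau(\varphi))\|_\alpha\le C\lambda^n\|\varphi\|_\alpha$; (4) $\|\pi_\tau(\varphi)\|_\alpha\le C\|\varphi\|_\alpha$.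
   Context: $\hat{\mathbb C}$, spherical distance $d$; $\mathrm{Rat}$ with $\kappa(f,g)=\sup_zd(f(z),g(z))$; $\langle\Gamma\rangle$, $F(G)$ (equicontinuity set), $J(G)$, $J_{\ker}(G)=\bigcap_{g\in G}g^{-1}(J(G))$, $\mathrm{Min}(G,\hat{\mathbb C})$ (inclusion-minimal non-empty compact $G$-forward-invariant sets). $\Gamma_\tau=\mathrm{supp}\,\tau$, $G_\tau=\langle\Gamma_\tau\rangle$, $S_\tau=\bigcup_{L\in\mathrm{Min}(G_\tau,\hat{\mathbb C})}L$, $M_\tau\varphi(z)=\int\varphi(g(z))d\tau(g)$ acting on $C(K)$ for compact $K$ with $G_\tau(K)\subset K$; $\mathcal U_{f,\tau}(K)$ = non-zero $\varphi\in C(K)$ with $M_\tau\varphi=a\varphi$, $|a|=1$; LS = linear span. Known: under $J_{\ker}(G_\tau)=\emptyset$, $J(G_\tau)\neq\emptyset$, $C(\hat{\mathbb C})=\mathrm{LS}(\mathcal U_{f,\tau}(\hat{\mathbb C}))\oplus\{\varphi:\|M^n_\tau\varphi\|_\infty\to0\}$, first summand finite-dimensional; $\pi_\tau$ = projection onto it. $C^\alpha(\hat{\mathbb C})$ = $\alpha$-Hölder functions with $\|\varphi\|_\alpha=\sup|\varphi|+\sup_{x\ne y}|\varphi(x)-\varphi(y)|/d(x,y)^\alpha$. *)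

(* Defs.v *)
From HB Require Import structures.
From mathcomp Require Import all_boot all_order all_algebra.
From mathcomp Require Import all_classical all_reals all_analysis.
From mathcomp Require Import complex.
From Stdlib Require Import ClassicalEpsilon.

Set Implicit Arguments.
Unset Strict Implicit.
Unset Printing Implicit Defensive.
Import Order.TTheory GRing.Theory Num.Theory.
Import numFieldNormedType.Exports.

Local Open Scope classical_set_scope.
Local Open Scope ring_scope.

Section RandomDynamics.
Context {R : realType}.

(** Complex numbers and the Riemann sphere  Ĉ = C ∪ {∞}  (None = ∞). *)
Definition Cx := R[i].
Definition Chat := option Cx.

Definition cabs (z : Cx) : R := Num.sqrt (complex.Re z ^+ 2 + complex.Im z ^+ 2).

(** Chordal (spherical) distance on Ĉ (the round unit sphere). *)
Definition sdist (x y : Chat) : R :=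
  match x, y with
  | Some z, Some w =>
      2 * cabs (z - w) / (Num.sqrt (1 + cabs z ^+ 2) * Num.sqrt (1 + cabs w ^+ 2))
  | Some z, None | None, Some z => 2 / Num.sqrt (1 + cabs z ^+ 2)
  | None, None => 0
  end.

(** Rational maps: f = [P : Q] with P, Q homogeneous of degree d >= 1 in (z,w),
    P(z,w) = sum_k a_k z^k w^(d-k), Q(z,w) = sum_k b_k z^k w^(d-k),
    without common zero in C^2 \ {0}. *)
Definition hpoly (a : nat -> Cx) (d : nat) (z : Cx) : Cx :=
  \sum_(k < d.+1) a k * z ^+ k.

Definition rat_eval (d : nat) (a b : nat -> Cx) (x : Chat) : Chat :=
  match x with
  | Some z => if hpoly b d z == 0 then None else Some (hpoly a d z / hpoly b d z)
  | None => if b d == 0 then None else Some (a d / b d)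
  end.

Definition is_rational (f : Chat -> Chat) : Prop :=
  exists (d : nat) (a b : nat -> Cx),
    (1 <= d)%N /\ (a d != 0 \/ b d != 0) /\
    (forall z, hpoly a d z != 0 \/ hpoly b d z != 0) /\
    f = rat_eval d a b.

(** The space of maps Ĉ -> Ĉ with the sup distance kappa (a metric since sdist <= 2). *)
Definition kappa (f g : Chat -> Chat) : R := sup [set sdist (f z) (g z) | z in setT].

Definition dball {T} (dist : T -> T -> R) (x : T) (r : R) : set T :=
  [set y | dist x y < r].

Definition dopen {T} (dist : T -> T -> R) (U : set T) : Prop :=
  forall x, U x -> exists2 r : R, 0 < r & dball dist x r `<=` U.

Definition dcompact {T} (dist : T -> T -> R) (K : set T) : Prop :=
  forall (I : Type) (U : I -> set T), (forall i, dopen dist (U i)) ->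
    K `<=` \bigcup_i U i ->
    exists2 F : set I, finite_set F & K `<=` \bigcup_(i in F) U i.

(** The Borel sigma-algebra of (Ĉ^Ĉ, kappa); Rat sits inside it. *)
Definition RatSpace := g_sigma_algebraType (dopen kappa).

Definition compactly_supported_on_Rat (tau : probability RatSpace R) : Prop :=
  exists K : set (Chat -> Chat), dcompact kappa K /\ K `<=` is_rational /\
    tau (~` K) = 0%E.

Definition Gamma (tau : probability RatSpace R) : set (Chat -> Chat) :=
  [set g | forall e : R, 0 < e -> (0 < tau (dball kappa g e))%E].

Inductive gen_semigroup (Gam : set (Chat -> Chat)) : (Chat -> Chat) -> Prop :=
  | sg_gen g : Gam g -> gen_semigroup Gam g
  | sg_comp f g : gen_semigroup Gam f -> gen_semigroup Gam g -> gen_semigroup Gam (f \o g).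

Definition Gtau (tau : probability RatSpace R) := gen_semigroup (Gamma tau).

Definition equicont_on (G : set (Chat -> Chat)) (U : set Chat) : Prop :=
  forall x, U x -> forall e : R, 0 < e -> exists2 del : R, 0 < del &
    forall y, U y -> sdist x y < del -> forall g, G g -> sdist (g x) (g y) < e.

Definition Fatou (G : set (Chat -> Chat)) : set Chat :=
  [set z | exists2 r : R, 0 < r & equicont_on G (dball sdist z r)].

Definition Julia (G : set (Chat -> Chat)) : set Chat := ~` Fatou G.

Definition Jker (G : set (Chat -> Chat)) : set Chat :=
  [set z | forall g, G g -> Julia G (g z)].

Definition fwd_inv (G : set (Chat -> Chat)) (K : set Chat) : Prop :=
  forall g, G g -> forall x, K x -> K (g x).

Definition minimal_set (G : set (Chat -> Chat)) (L : set Chat) : Prop :=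
  L !=set0 /\ dcompact sdist L /\ fwd_inv G L /\
  (forall K, K !=set0 -> dcompact sdist K -> fwd_inv G K -> K `<=` L -> K = L).

Definition cint (tau : probability RatSpace R) (F : (Chat -> Chat) -> Cx) : Cx :=
  (Rintegral tau setT (fun g => complex.Re (F g)) +i* Rintegral tau setT (fun g => complex.Im (F g)))%C.

Definition Mtau (tau : probability RatSpace R) (phi : Chat -> Cx) : Chat -> Cx :=
  fun z => cint tau (fun g : Chat -> Chat => phi (g z)).

(** Continuity on a subset K of Ĉ (i.e. membership of phi|_K in C(K)). *)
Definition cont_on (K : set Chat) (phi : Chat -> Cx) : Prop :=
  forall x, K x -> forall e : R, 0 < e -> exists2 del : R, 0 < del &
    forall y, K y -> sdist x y < del -> cabs (phi x - phi y) < e.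

Definition Uft (tau : probability RatSpace R) (K : set Chat) (phi : Chat -> Cx) : Prop :=
  cont_on K phi /\ (exists2 x, K x & phi x != 0) /\
  exists a : Cx, cabs a = 1 /\ forall z, K z -> Mtau tau phi z = a * phi z.

Definition lin_indep_on (K : set Chat) (n : nat) (u : 'I_n -> Chat -> Cx) : Prop :=
  forall c : 'I_n -> Cx, (forall x, K x -> \sum_(i < n) c i * u i x = 0) ->
    forall i, c i = 0.

Definition dimLS (tau : probability RatSpace R) (K : set Chat) (n : nat) : Prop :=
  (exists u : 'I_n -> Chat -> Cx, (forall i, Uft tau K (u i)) /\ lin_indep_on K u) /\
  (forall u : 'I_n.+1 -> Chat -> Cx, (forall i, Uft tau K (u i)) -> ~ lin_indep_on K u).

(** r = prod_{L in Min(G_tau, Ĉ)} dim_C LS(U_{f,tau}(L)) (Min is finite). *)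
Definition prod_dims (tau : probability RatSpace R) (r : nat) : Prop :=
  exists (m : nat) (Ls : 'I_m -> set Chat) (ds : 'I_m -> nat),
    injective Ls /\
    (forall i, minimal_set (Gtau tau) (Ls i)) /\
    (forall L, minimal_set (Gtau tau) L -> exists i, Ls i = L) /\
    (forall i, dimLS tau (Ls i) (ds i)) /\
    r = (\prod_(i < m) ds i)%N.

Definition LSU (tau : probability RatSpace R) (psi : Chat -> Cx) : Prop :=
  exists (n : nat) (u : 'I_n -> Chat -> Cx) (c : 'I_n -> Cx),
    (forall i, Uft tau setT (u i)) /\ psi = (fun z => \sum_(i < n) c i * u i z).

Definition B0 (tau : probability RatSpace R) (phi : Chat -> Cx) : Prop :=
  cont_on setT phi /\
  forall e : R, 0 < e -> exists N : nat, forall n, (N <= n)%N ->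
    forall z, cabs (iter n (Mtau tau) phi z) <= e.

(** pi_tau: projection onto LS(U_{f,tau}(Ĉ)) along B_{0,tau}
    (well defined by the known direct sum decomposition). *)
Definition pi_tau (tau : probability RatSpace R) (phi : Chat -> Cx) : Chat -> Cx :=
  epsilon (inhabits (fun _ => 0))
    (fun psi => LSU tau psi /\ B0 tau (fun z => phi z - psi z)).

(** Hölder norm ||phi||_alpha (possibly +oo; phi in C^alpha iff finite). *)
Definition holder_norm (alpha : R) (phi : Chat -> Cx) : \bar R :=
  (ereal_sup [set (cabs (phi x))%:E | x in setT] +
   ereal_sup [set ((cabs (phi xy.1 - phi xy.2)) / (sdist xy.1 xy.2) `^ alpha)%:E
             | xy in [set xy : Chat * Chat | xy.1 <> xy.2]])%E.

End RandomDynamics.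

(* Main.v *)
Require Import Defs.
From HB Require Import structures.
From mathcomp Require Import all_boot all_order all_algebra.
From mathcomp Require Import all_classical all_reals all_analysis.
From mathcomp Require Import complex cyclic separable cyclotomic.
From mathcomp Require Import ring lra measurable_realfun.

Set Implicit Arguments.
Unset Strict Implicit.
Unset Printing Implicit Defensive.
Import Order.TTheory GRing.Theory Num.Theory.
Import numFieldNormedType.Exports.
Local Open Scope classical_set_scope.
Local Open Scope ring_scope.

(** The argument avoids the known direct sum decomposition and proves it on Hölder functions.

    Near the minimal sets, which lie in the Fatou set, the metric
    rho(x,y) = sup_g d(g x, g y) over g in G or g = id is not expanded by G. Some element
    contracts near each minimal set: otherwise every h in G would have approximate left inverses
    in G near a point of a minimal set, and following them along a path to the Julia set gives a
    point of the kernel Julia set. Every orbit closure contains a minimal set, so by compactness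
    a random word takes any two close points near a minimal set with probability bounded below.
    Together these yield a Lasota-Yorke inequality for M^N on C^alpha, alpha small.

    By the Lasota-Yorke inequality, orbits of Hölder functions are precompact for the sup norm,
    and each Hölder function is a recurrent function plus one whose orbit tends to 0. A
    recurrent function is determined, with linear control, by its values on a finite net, so it
    generates a finite-dimensional M-invariant space and is a combination of unitary
    eigenfunctions. On a minimal set L the unitary eigenvalues form a finite cyclic group of
    order dim LS(U(L)), and every eigenfunction of M on the sphere is nonzero on some minimal set;
    hence M^r is the identity on the recurrent part. Finally, compactness makes the decay on the
    complement uniform, and the Lasota-Yorke inequality makes it exponential for the Hölder
    norm. *)

(** * The Riemann sphere *)

(** Two effects compete in the Lasota-Yorke inequality: a word of n letters may stretch distances by
    a factor X, while absorption near the minimal sets is only known to have probability at least p.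
    Hence alpha is taken so small that (1 - p) X^alpha < 1. The metric rho is there because G may
    expand the spherical distance near a minimal set by a constant K, which would otherwise be paid
    again in every block of letters.

    Complex analysis enters through uniform approximation by polynomials on discs ([papprox]).
    Coefficient bounds that do not involve the degree give Cauchy estimates, an identity theorem and
    a Vitali principle, and all of them survive limits. Limits are taken pointwise along a free
    ultrafilter on [nat], which always exist; uniformity is recovered afterwards from
    equicontinuity. The only probabilistic input is that balls around points of the support have
    positive measure: words are treated by iterating the one-step estimate. *)

Section ComplexModulus.
Context {R : realType}.
Implicit Types (z w : @Cx R) (x y : R).

Lemma cabsE z : (cabs z)%:C%C = `|z|.
Proof. by rewrite normc_def. Qed.

Lemma cabs_ge0 z : 0 <= cabs z.
Proof. exact: sqrtr_ge0. Qed.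

Lemma cabs0 : cabs (0 : @Cx R) = 0.
Proof. by apply: (@complexI R); rewrite cabsE normr0. Qed.

Lemma cabs1 : cabs (1 : @Cx R) = 1.
Proof. by apply: (@complexI R); rewrite cabsE normr1. Qed.

Lemma cabs_eq0 z : (cabs z == 0) = (z == 0).
Proof. by rewrite -(inj_eq (@complexI R)) cabsE normr_eq0. Qed.

Lemma cabs_gt0 z : (0 < cabs z) = (z != 0).
Proof. by rewrite lt_neqAle eq_sym cabs_eq0 cabs_ge0 andbT. Qed.

Lemma cabsN z : cabs (- z) = cabs z.
Proof. by apply: (@complexI R); rewrite !cabsE normrN. Qed.

Lemma cabsC z w : cabs (z - w) = cabs (w - z).
Proof. by rewrite -cabsN opprB. Qed.

Lemma cabsM z w : cabs (z * w) = cabs z * cabs w.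
Proof. by apply: (@complexI R); rewrite rmorphM /= !cabsE normrM. Qed.

Lemma cabsX z n : cabs (z ^+ n) = cabs z ^+ n.
Proof. by elim: n => [|n IH]; rewrite ?expr0 ?cabs1 // !exprS cabsM IH. Qed.

Lemma cabsV z : cabs z^-1 = (cabs z)^-1.
Proof. by apply: (@complexI R); rewrite fmorphV /= !cabsE normfV. Qed.

Lemma cabsf z w : cabs (z / w) = cabs z / cabs w.
Proof. by rewrite cabsM cabsV. Qed.

Lemma cabsD z w : cabs (z + w) <= cabs z + cabs w.
Proof. by rewrite -lecR rmorphD /= !cabsE ler_normD. Qed.

Lemma cabsB z w : cabs (z - w) <= cabs z + cabs w.
Proof. by rewrite -(cabsN w) cabsD. Qed.

Lemma cabsBD z1 z2 z3 : cabs (z1 - z3) <= cabs (z1 - z2) + cabs (z2 - z3).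
Proof. by apply: le_trans (cabsD _ _); rewrite addrA subrK. Qed.

Lemma cabs_lerB z w : cabs z - cabs w <= cabs (z - w).
Proof. by rewrite lerBlDr; apply: le_trans (cabsD _ _); rewrite subrK. Qed.

Lemma cabs_real x : cabs (x%:C)%C = `|x|.
Proof. by rewrite /cabs /= expr0n addr0 sqrtr_sqr. Qed.

Lemma cabs_sum (I : Type) (r : seq I) (P : pred I) (F : I -> @Cx R) :
  cabs (\sum_(i <- r | P i) F i) <= \sum_(i <- r | P i) cabs (F i).
Proof.
elim/big_ind2: _ => [|x1 y1 x2 y2 H1 H2|//]; first by rewrite cabs0.
exact: le_trans (cabsD _ _) (lerD H1 H2).
Qed.

Lemma cabs_conj z : cabs (z^*)%C = cabs z.
Proof. by case: z => a b; rewrite /cabs /= sqrrN. Qed.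

Lemma conj_mul z : ((z^*)%C * z = ((cabs z) ^+ 2)%:C%C)%R.
Proof.
rewrite mulrC -sqr_normc -cabsE rmorphXn //.
Qed.

Lemma Re_le_cabs z : complex.Re z <= cabs z.
Proof.
apply: le_trans (ler_norm _) _; rewrite -sqrtr_sqr /cabs.
by rewrite ler_wsqrtr// lerDl sqr_ge0.
Qed.

Lemma absRe_le z : `|complex.Re z| <= cabs z.
Proof. by rewrite -sqrtr_sqr /cabs ler_wsqrtr// lerDl sqr_ge0. Qed.

Lemma absIm_le z : `|complex.Im z| <= cabs z.
Proof. by rewrite -sqrtr_sqr /cabs ler_wsqrtr// lerDr sqr_ge0. Qed.

Lemma cabs_ReIm z : cabs z <= `|complex.Re z| + `|complex.Im z|.
Proof.
rewrite -[leRHS]ger0_norm ?addr_ge0// -sqrtr_sqr /cabs ler_wsqrtr//.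
by rewrite sqrrD !real_normK ?num_real// lerD2r lerDl mulrn_wge0// mulr_ge0.
Qed.

End ComplexModulus.

(** * The chordal metric in homogeneous coordinates *)

Section Sphere.
Context {R : realType}.
Local Notation C := (@Cx R).
Local Notation S2 := (@Chat R).

(** [hproj u v] is the point [u : v] of the projective line. Lifting points to C^2 with [lift1] and
    [lift2] treats infinity like any other point. *)
Definition hproj (u v : C) : S2 := if v == 0 then None else Some (u / v).
Definition nz2 (u v : C) := (u != 0) || (v != 0).
Definition nrm2 (u v : C) : R := Num.sqrt (cabs u ^+ 2 + cabs v ^+ 2).
Definition lift1 (x : S2) : C := if x is Some z then z else 1.
Definition lift2 (x : S2) : C := if x is Some _ then 1 else 0.

Lemma nz2_lift x : nz2 (lift1 x) (lift2 x).
Proof. by case: x => [z|]; rewrite /nz2 /= oner_neq0 ?orbT. Qed.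

Lemma hproj_lift x : hproj (lift1 x) (lift2 x) = x.
Proof. by case: x => [z|]; rewrite /hproj /= ?oner_eq0 ?eqxx ?divr1. Qed.

Lemma nrm2_sq u v : nrm2 u v ^+ 2 = cabs u ^+ 2 + cabs v ^+ 2.
Proof. by rewrite sqr_sqrtr// addr_ge0// sqr_ge0. Qed.

Lemma nrm2_gt0 u v : (0 < nrm2 u v) = nz2 u v.
Proof.
rewrite /nrm2 sqrtr_gt0 /nz2 -!cabs_gt0.
have := cabs_ge0 u; have := cabs_ge0 v; rewrite !le_eqVlt.
move=> /predU1P[<-|v0] /predU1P[<-|u0]; rewrite ?ltxx ?expr0n ?addr0 ?add0r ?ltxx//=.
- by rewrite u0 exprn_gt0.
- by rewrite v0 exprn_gt0.
- by rewrite u0 addr_gt0// exprn_gt0.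
Qed.

Lemma nrm2_ge0 u v : 0 <= nrm2 u v. Proof. exact: sqrtr_ge0. Qed.

Lemma nrm2Z k u v : nrm2 (k * u) (k * v) = cabs k * nrm2 u v.
Proof.
rewrite /nrm2 !cabsM !exprMn -mulrDr sqrtrM ?sqr_ge0// sqrtr_sqr.
by rewrite ger0_norm ?cabs_ge0.
Qed.

Lemma hproj_eq u v u' v' : nz2 u v -> nz2 u' v' -> u * v' = v * u' ->
  hproj u v = hproj u' v'.
Proof.
rewrite /hproj /nz2; case: (eqVneq v 0) => [->|v0]; case: (eqVneq v' 0) => [->|v'0];
  rewrite ?mulr0 ?mul0r ?orbF// => h1 h2.
- by move/eqP; rewrite mulf_eq0 (negbTE h1) (negbTE v'0).
- by move/esym/eqP; rewrite mulf_eq0 (negbTE h2) (negbTE v0).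
- by move=> e; congr Some; apply/eqP; rewrite eqr_div// e mulrC.
Qed.

Lemma hprojE u v : nz2 u v -> exists2 k : C, k != 0 &
  u = k * lift1 (hproj u v) /\ v = k * lift2 (hproj u v).
Proof.
rewrite /hproj /nz2; case: (eqVneq v 0) => [->|v0] /=.
  by rewrite orbF => u0; exists u; rewrite // mulr1 mulr0.
by move=> _; exists v; rewrite // mulr1 mulrC divfK.
Qed.

(** The chordal distance is twice the sine of the angle between two complex lines of C^2, so any
    lifts compute it; this removes the case distinction at infinity. *)
Lemma sdist_lift x y : sdist x y =
  2 * cabs (lift1 x * lift2 y - lift2 x * lift1 y) /
    (nrm2 (lift1 x) (lift2 x) * nrm2 (lift1 y) (lift2 y)).
Proof.
case: x => [z|]; case: y => [w|] /=; rewrite /nrm2 ?cabs1 ?cabs0 ?expr1n ?expr0n /=.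
- by rewrite mulr1 mul1r (addrC _ 1) (addrC _ 1).
- by rewrite mulr0 mul1r sub0r cabsN cabs1 mulr1 addr0 sqrtr1 mulr1 addrC.
- by rewrite mulr1 mul0r subr0 cabs1 mulr1 addr0 sqrtr1 mul1r addrC.
- by rewrite mulr0 mul0r subr0 cabs0 mulr0 mul0r.
Qed.

Lemma sdist_hproj u v u' v' : nz2 u v -> nz2 u' v' ->
  sdist (hproj u v) (hproj u' v') = 2 * cabs (u * v' - v * u') / (nrm2 u v * nrm2 u' v').
Proof.
move=> h h'; rewrite sdist_lift.
have [k k0 [eu ev]] := hprojE h; have [k' k'0 [eu' ev']] := hprojE h'.
have := nz2_lift (hproj u v); have := nz2_lift (hproj u' v').
set a := lift1 (hproj u v) in eu ev *; set b := lift2 (hproj u v) in eu ev *.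
set a' := lift1 (hproj u' v') in eu' ev' *; set b' := lift2 (hproj u' v') in eu' ev' *.
rewrite -!nrm2_gt0 => n' n.
rewrite [in RHS]eu [in RHS]ev [in RHS]eu' [in RHS]ev' !nrm2Z.
have -> : k * a * (k' * b') - k * b * (k' * a') = (k * k') * (a * b' - b * a') by ring.
rewrite !cabsM; field.
by rewrite !cabs_eq0 k0 k'0 !gt_eqF.
Qed.

Lemma sdist_ge0 x y : 0 <= sdist x y :> R.
Proof.
by rewrite sdist_lift divr_ge0// mulr_ge0 ?cabs_ge0 ?nrm2_ge0.
Qed.

Lemma sdistC x y : sdist x y = sdist y x :> R.
Proof.
rewrite !sdist_lift cabsC; congr (_ * cabs _ / _); last exact: mulrC.
by congr (_ - _); exact: mulrC.
Qed.

Lemma sdistxx x : sdist x x = 0 :> R.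
Proof. by rewrite sdist_lift mulrC [X in cabs X](_ : _ = 0) ?cabs0 ?mulr0 ?mul0r//; ring. Qed.

Lemma sdist_eq0 x y : sdist x y = 0 :> R -> x = y.
Proof.
rewrite sdist_lift => /eqP; have := nz2_lift x; have := nz2_lift y.
rewrite -!nrm2_gt0 => ny nx.
rewrite mulf_eq0 invr_eq0 !mulf_eq0 (gt_eqF nx) (gt_eqF ny) !orbF pnatr_eq0/=.
rewrite cabs_eq0 subr_eq0 => /eqP e.
by rewrite -[x]hproj_lift -[y]hproj_lift; apply: hproj_eq => //; apply: nz2_lift.
Qed.

Lemma nrm2_add u v u' v' : nrm2 (u + u') (v + v') <= nrm2 u v + nrm2 u' v'.
Proof.
rewrite -[leRHS]ger0_norm ?addr_ge0 ?nrm2_ge0// -sqrtr_sqr /nrm2 -/(nrm2 u v) -/(nrm2 u' v').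
apply: ler_wsqrtr; rewrite sqrrD !nrm2_sq.
set n := nrm2 u v; set n' := nrm2 u' v'.
have le_sq (a b c : R) : 0 <= c -> 0 <= a -> c <= a + b -> 0 <= b -> c ^+ 2 <= a ^+ 2 + b ^+ 2 + 2 * (a * b).
  move=> c0 a0 h b0; have h2 : c ^+ 2 <= (a + b) ^+ 2 by rewrite ler_pXn2r// nnegrE addr_ge0.
  by apply: le_trans h2 _; rewrite sqrrD -mulr_natl; lra.
have h1 := le_sq _ _ _ (cabs_ge0 (u + u')) (cabs_ge0 u) (cabsD u u') (cabs_ge0 u').
have h2 := le_sq _ _ _ (cabs_ge0 (v + v')) (cabs_ge0 v) (cabsD v v') (cabs_ge0 v').
have cs : cabs u * cabs u' + cabs v * cabs v' <= n * n'.
  rewrite -(ler_pXn2r (n:=2))// ?nnegrE ?addr_ge0 ?mulr_ge0 ?cabs_ge0 ?nrm2_ge0//.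
  rewrite exprMn !nrm2_sq -subr_ge0.
  have -> : (cabs u ^+ 2 + cabs v ^+ 2) * (cabs u' ^+ 2 + cabs v' ^+ 2) -
    (cabs u * cabs u' + cabs v * cabs v') ^+ 2 = (cabs u * cabs v' - cabs v * cabs u') ^+ 2 by ring.
  exact: sqr_ge0.
by rewrite -mulr_natl; lra.
Qed.

(* The vector identity (u ∧ w) v = (u ∧ v) w + (v ∧ w) u yields the triangle inequality. *)
Lemma sdist_triangle y x z : sdist x z <= sdist x y + sdist y z :> R.
Proof.
rewrite !sdist_lift.
have := nz2_lift x; have := nz2_lift y; have := nz2_lift z; rewrite -!nrm2_gt0.
set a := lift1 x; set b := lift2 x; set c := lift1 y; set d := lift2 y.
set e := lift1 z; set f := lift2 z => nz ny nx.
have key := nrm2_add ((a * d - b * c) * e) ((a * d - b * c) * f) ((c * f - d * e) * a) ((c * f - d * e) * b).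
rewrite [X in nrm2 X _](_ : _ = (a * f - b * e) * c) in key; last by ring.
rewrite [X in nrm2 _ X](_ : _ = (a * f - b * e) * d) in key; last by ring.
rewrite !nrm2Z in key.
rewrite ler_pdivrMr ?mulr_gt0//.
have -> : (2 * cabs (a * d - b * c) / (nrm2 a b * nrm2 c d) +
   2 * cabs (c * f - d * e) / (nrm2 c d * nrm2 e f)) * (nrm2 a b * nrm2 e f) =
   2 * (cabs (a * d - b * c) * nrm2 e f + cabs (c * f - d * e) * nrm2 a b) / nrm2 c d.
  by field; rewrite !gt_eqF.
by rewrite ler_pdivlMr// -!mulrA ler_pM2l.
Qed.

Lemma sdist_le2 x y : sdist x y <= 2 :> R.
Proof.
rewrite sdist_lift.
have := nz2_lift x; have := nz2_lift y; rewrite -!nrm2_gt0.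
set a := lift1 x; set b := lift2 x; set c := lift1 y; set d := lift2 y => ny nx.
rewrite ler_pdivrMr ?mulr_gt0// ler_pM2l//.
apply: le_trans (cabsB _ _) _; rewrite !cabsM.
rewrite -(ler_pXn2r (n:=2))// ?nnegrE ?addr_ge0 ?mulr_ge0 ?cabs_ge0 ?nrm2_ge0//.
rewrite exprMn !nrm2_sq -subr_ge0.
have -> : (cabs a ^+ 2 + cabs b ^+ 2) * (cabs c ^+ 2 + cabs d ^+ 2) -
    (cabs a * cabs d + cabs b * cabs c) ^+ 2 = (cabs a * cabs c - cabs b * cabs d) ^+ 2 by ring.
exact: sqr_ge0.
Qed.

Definition origin : S2 := Some 0.

(** On the unit disc the product of the two square roots lies between 1 and 2. This factor 2 between
    chart and sphere is behind most numerical constants below. *)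
Lemma sdist_disc (z w : C) : cabs z <= 1 -> cabs w <= 1 ->
  cabs (z - w) <= sdist (Some z) (Some w) <= 2 * cabs (z - w).
Proof.
move=> z1 w1 /=.
have h1 (t : R) : 0 <= t <= 1 -> 1 <= Num.sqrt (1 + t ^+ 2) /\ Num.sqrt (1 + t ^+ 2) ^+ 2 <= 2.
  move=> /andP[t0 t1]; have t2 : t ^+ 2 <= 1 by rewrite expr_le1.
  rewrite sqr_sqrtr ?addr_ge0 ?sqr_ge0//; split; last by lra.
  by rewrite -{1}sqrtr1 ler_wsqrtr// lerDl sqr_ge0.
have [|a1 a2] := h1 (cabs z); first by rewrite cabs_ge0.
have [|b1 b2] := h1 (cabs w); first by rewrite cabs_ge0.
set a := Num.sqrt _ in a1 a2 *; set b := Num.sqrt _ in b1 b2 *.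
have ab0 : 0 < a * b by rewrite mulr_gt0//; lra.
have c0 := cabs_ge0 (z - w).
rewrite ler_pdivlMr// ler_pdivrMr//; apply/andP; split.
  rewrite mulrC ler_wpM2r//.
  by have := sqr_ge0 (a - b); nra.
by rewrite ler_peMr ?mulr_ge0//; nra.
Qed.

Lemma sdist_origin_le1 x : sdist origin x <= 1 -> exists2 z, x = Some z & cabs z <= 1.
Proof.
case: x => [z|] /=; last by rewrite cabs0 expr0n addr0 sqrtr1 divr1 lern1.
rewrite sub0r cabsN cabs0 expr0n addr0 sqrtr1 mul1r => h; exists z => //.
have c0 := cabs_ge0 z.
have s0 : 0 < Num.sqrt (1 + cabs z ^+ 2) by rewrite sqrtr_gt0; have := sqr_ge0 (cabs z); lra.
move: h; rewrite ler_pdivrMr// mul1r => h.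
have : (2 * cabs z) ^+ 2 <= Num.sqrt (1 + cabs z ^+ 2) ^+ 2.
  by rewrite (ler_pXn2r (n:=2))// ?nnegrE ?mulr_ge0// ltW.
rewrite sqr_sqrtr; last by rewrite addr_ge0 ?sqr_ge0.
by rewrite exprMn => {}h; rewrite -(ler_pXn2r (n:=2))// ?nnegrE// expr1n; lra.
Qed.

Lemma sdist_origin_le z : sdist origin (Some z) <= 2 * cabs z.
Proof.
rewrite /= sub0r cabsN cabs0 expr0n addr0 sqrtr1 mul1r.
have h : 1 <= Num.sqrt (1 + cabs z ^+ 2) by rewrite -{1}sqrtr1 ler_wsqrtr// lerDl sqr_ge0.
by rewrite ler_pdivrMr ?(lt_le_trans _ h)// ler_peMr ?mulr_ge0 ?cabs_ge0.
Qed.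

End Sphere.

(** * Rational maps in charts *)

Section Charts.
Context {R : realType}.
Local Notation C := (@Cx R).
Local Notation S2 := (@Chat R).

Implicit Types (p x y : S2) (u v : C) (f g : S2 -> S2).

Lemma cabs_sq (z : C) : cabs z ^+ 2 = complex.Re z ^+ 2 + complex.Im z ^+ 2.
Proof. by rewrite sqr_sqrtr// addr_ge0// sqr_ge0. Qed.

(** With (a, b) the lift of p, this is a multiple of a unitary matrix sending (0, 1) to (a, b): an
    isometry that carries the chart at 0 to a chart at p. [sunrot] is given by the adjoint
    matrix. *)
Definition srot (p x : S2) : S2 :=
  hproj (((lift2 p)^*)%C * lift1 x + lift1 p * lift2 x) (- ((lift1 p)^*)%C * lift1 x + lift2 p * lift2 x).
Definition sunrot (p x : S2) : S2 :=
  hproj (lift2 p * lift1 x - lift1 p * lift2 x) (((lift1 p)^*)%C * lift1 x + ((lift2 p)^*)%C * lift2 x).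

Lemma nrm2_unitary (a b u v : C) :
  nrm2 ((b^*)%C * u + a * v) (- (a^*)%C * u + b * v) = nrm2 a b * nrm2 u v.
Proof.
rewrite /nrm2 -sqrtrM ?addr_ge0 ?sqr_ge0//; congr Num.sqrt.
rewrite !cabs_sq.
case: a b u v => [a1 a2] [b1 b2] [u1 u2] [v1 v2] /=; ring.
Qed.

Lemma nrm2_unitary' (a b u v : C) :
  nrm2 (b * u - a * v) ((a^*)%C * u + (b^*)%C * v) = nrm2 a b * nrm2 u v.
Proof.
rewrite /nrm2 -sqrtrM ?addr_ge0 ?sqr_ge0//; congr Num.sqrt.
rewrite !cabs_sq.
case: a b u v => [a1 a2] [b1 b2] [u1 u2] [v1 v2] /=; ring.
Qed.

Lemma conj_wedge (a b : C) : (b^*)%C * b + a * (a^*)%C = ((nrm2 a b) ^+ 2)%:C%C.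
Proof.
rewrite nrm2_sq rmorphD /= conj_mul -conj_mul [a * _]mulrC conj_mul.
by rewrite conj_mul addrC.
Qed.

Lemma rot_nz p u v : nz2 u v ->
  nz2 (((lift2 p)^*)%C * u + lift1 p * v) (- ((lift1 p)^*)%C * u + lift2 p * v).
Proof. by move=> h; rewrite -nrm2_gt0 nrm2_unitary mulr_gt0 ?nrm2_gt0 ?nz2_lift. Qed.

Lemma unrot_nz p u v : nz2 u v ->
  nz2 (lift2 p * u - lift1 p * v) (((lift1 p)^*)%C * u + ((lift2 p)^*)%C * v).
Proof. by move=> h; rewrite -nrm2_gt0 nrm2_unitary' mulr_gt0 ?nrm2_gt0 ?nz2_lift. Qed.

Lemma rot_hproj p u v : nz2 u v -> srot p (hproj u v) =
  hproj (((lift2 p)^*)%C * u + lift1 p * v) (- ((lift1 p)^*)%C * u + lift2 p * v).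
Proof.
move=> h; apply: hproj_eq; [exact/rot_nz/nz2_lift|exact: rot_nz|].
have [k k0] := hprojE h; move: (lift1 _) (lift2 (hproj _ _)) => a b [-> ->]; ring.
Qed.

Lemma unrot_hproj p u v : nz2 u v -> sunrot p (hproj u v) =
  hproj (lift2 p * u - lift1 p * v) (((lift1 p)^*)%C * u + ((lift2 p)^*)%C * v).
Proof.
move=> h; apply: hproj_eq; [exact/unrot_nz/nz2_lift|exact: unrot_nz|].
have [k k0] := hprojE h; move: (lift1 _) (lift2 (hproj _ _)) => a b [-> ->]; ring.
Qed.

Lemma srotK p : cancel (srot p) (sunrot p).
Proof.
move=> x; rewrite /srot unrot_hproj ?rot_nz ?nz2_lift// -[RHS]hproj_lift.
apply: hproj_eq; rewrite ?unrot_nz ?rot_nz ?nz2_lift//; ring.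
Qed.

Lemma unrotK p : cancel (sunrot p) (srot p).
Proof.
move=> x; rewrite /sunrot rot_hproj; last by rewrite unrot_nz ?nz2_lift.
rewrite -[RHS]hproj_lift.
apply: hproj_eq; [by apply: rot_nz; rewrite unrot_nz ?nz2_lift|exact: nz2_lift|ring].
Qed.

Lemma sdist_rot p x y : sdist (srot p x) (srot p y) = sdist x y.
Proof.
rewrite /srot sdist_hproj ?rot_nz ?nz2_lift// !nrm2_unitary sdist_lift.
set a := lift1 p; set b := lift2 p; set u := lift1 x; set v := lift2 x.
set u' := lift1 y; set v' := lift2 y.
have n0 : 0 < nrm2 a b by rewrite nrm2_gt0 nz2_lift.
have [nx ny] : 0 < nrm2 u v /\ 0 < nrm2 u' v' by rewrite !nrm2_gt0 !nz2_lift.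
rewrite [X in cabs X](_ : _ = ((b^*)%C * b + a * (a^*)%C) * (u * v' - v * u')); last by ring.
rewrite conj_wedge cabsM cabs_real ger0_norm ?sqr_ge0//; field.
by rewrite !gt_eqF.
Qed.

Lemma sdist_unrot p x y : sdist (sunrot p x) (sunrot p y) = sdist x y.
Proof. by rewrite -(sdist_rot p) !unrotK. Qed.

Lemma srot_origin p : srot p origin = p.
Proof.
rewrite /srot /origin /= !mulr0 !mulr1 !add0r; exact: hproj_lift.
Qed.

Lemma unrot_self p : sunrot p p = origin.
Proof. by rewrite -{2}(srot_origin p) srotK. Qed.

Lemma unrot_chart p y : sdist p y <= 1 ->
  exists z, [/\ y = srot p (Some z), cabs z <= 1 & cabs z <= sdist p y <= 2 * cabs z].
Proof.
move=> h; have := h; rewrite -(sdist_unrot p) unrot_self => h'.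
have [z ez z1] := sdist_origin_le1 h'; exists z; split => //; first by rewrite -ez unrotK.
have := @sdist_disc R 0 z; rewrite cabs0 sub0r cabsN => /(_ ler01 z1).
by rewrite -/origin -ez -(unrot_self p) sdist_unrot.
Qed.

Lemma sdist_rot_disc p (z w : C) : cabs z <= 1 -> cabs w <= 1 ->
  cabs (z - w) <= sdist (srot p (Some z)) (srot p (Some w)) <= 2 * cabs (z - w).
Proof. by move=> z1 w1; rewrite sdist_rot; apply: sdist_disc. Qed.

Definition poly_rep (g : S2 -> S2) := exists p q : {poly C},
  forall z, nz2 p.[z] q.[z] /\ g (Some z) = hproj p.[z] q.[z].

(* Closure under postcomposition: this lets compositions of rational maps be described
   by polynomials on the affine chart only, with no condition at infinity. *)
Definition rational_like (f : S2 -> S2) := forall g, poly_rep g -> poly_rep (f \o g).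

Lemma poly_rep_id : poly_rep id.
Proof.
by exists 'X, 1 => z; rewrite hornerX hornerC /nz2 oner_neq0 orbT /hproj oner_eq0 divr1.
Qed.

Lemma rational_like_comp f g : rational_like f -> rational_like g -> rational_like (f \o g).
Proof. by move=> hf hg h hh; apply: (hf (g \o h)); apply: hg. Qed.

Lemma rational_like_rep f : rational_like f -> poly_rep f.
Proof. by move=> h; exact: (h _ poly_rep_id). Qed.

Lemma rational_like_rot p : rational_like (srot p).
Proof.
move=> g [P [Q h]].
exists (((lift2 p)^*)%C%:P * P + (lift1 p)%:P * Q), ((- ((lift1 p)^*)%C)%:P * P + (lift2 p)%:P * Q) => z.
have [nz gz] := h z; rewrite !hornerE /= gz rot_hproj//; split => //.
exact: rot_nz.
Qed.

Lemma rational_like_unrot p : rational_like (sunrot p).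
Proof.
move=> g [P [Q h]].
exists ((lift2 p)%:P * P - (lift1 p)%:P * Q), (((lift1 p)^*)%C%:P * P + ((lift2 p)^*)%C%:P * Q) => z.
have [nz gz] := h z; rewrite !hornerE /= gz unrot_hproj//; split => //.
exact: unrot_nz.
Qed.

Definition homog (a : nat -> C) d (u v : C) := \sum_(k < d.+1) a k * u ^+ k * v ^+ (d - k).

Lemma homog_v0 a d u : homog a d u 0 = a d * u ^+ d.
Proof.
rewrite /homog big_ord_recr /= subnn expr0 mulr1 big1 ?add0r// => k _.
by rewrite expr0n subn_eq0 leqNgt ltn_ord /= mulr0.
Qed.

Lemma homog_hpoly a d u v : v != 0 -> homog a d u v = v ^+ d * hpoly a d (u / v).
Proof.
move=> v0; rewrite /homog /hpoly mulr_sumr; apply: eq_bigr => k _.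
have -> : v ^+ d = v ^+ (d - k) * v ^+ k by rewrite -exprD subnK // -ltnS.
by rewrite expr_div_n; field; rewrite expf_neq0.
Qed.

Lemma rational_homog f : is_rational f -> exists d a b,
  forall u v, nz2 u v -> nz2 (homog a d u v) (homog b d u v) /\
    f (hproj u v) = hproj (homog a d u v) (homog b d u v).
Proof.
move=> [d [a [b [_ [h1 [h2 ->]]]]]]; exists d, a, b => u v.
case: (eqVneq v 0) => [->|v0]; rewrite /nz2.
  rewrite eqxx orbF => u0; rewrite !homog_v0.
  have n : nz2 (a d) (b d) by rewrite /nz2; case: h1 => ->; rewrite ?orbT.
  have n' : nz2 (a d * u ^+ d) (b d * u ^+ d).
    by rewrite /nz2 !mulf_eq0 !(negbTE (expf_neq0 _ u0)) !orbF.
  split => //; rewrite /hproj eqxx /=.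
  by apply: hproj_eq => //; ring.
move=> _; rewrite !homog_hpoly//.
have n : nz2 (hpoly a d (u/v)) (hpoly b d (u/v)) by rewrite /nz2; case: (h2 (u/v)) => ->; rewrite ?orbT.
have n' : nz2 (v ^+ d * hpoly a d (u/v)) (v ^+ d * hpoly b d (u/v)).
  by rewrite /nz2 !mulf_eq0 !(negbTE (expf_neq0 _ v0)).
split => //; rewrite {1}/hproj (negbTE v0) /=.
by apply: hproj_eq => //; ring.
Qed.

Lemma is_rational_like f : is_rational f -> rational_like f.
Proof.
move=> /rational_homog[d [a [b h]]] g [P [Q hg]].
exists (\sum_(k < d.+1) (a k)%:P * P ^+ k * Q ^+ (d - k)), (\sum_(k < d.+1) (b k)%:P * P ^+ k * Q ^+ (d - k)) => z.
have [nz gz] := hg z; have [n' e] := h _ _ nz.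
rewrite !horner_sum /= gz e.
under eq_bigr do rewrite !hornerE.
by under [X in nz2 _ X]eq_bigr do rewrite !hornerE; under [X in _ = hproj _ X]eq_bigr do rewrite !hornerE.
Qed.

Lemma horner_cont (P : {poly C}) z0 (e : R) : 0 < e ->
  exists2 del : R, 0 < del & forall z, cabs (z - z0) < del -> cabs (P.[z] - P.[z0]) < e.
Proof.
elim/poly_ind: P e => [|P c IH] e e0.
  by exists 1 => // z _; rewrite !horner0 subrr cabs0.
set M := cabs z0 + 1; set N := cabs P.[z0] + 1.
have M0 : 0 < M by rewrite ltr_wpDl// cabs_ge0.
have N0 : 0 < N by rewrite ltr_wpDl// cabs_ge0.
have [|del d0 h] := IH (e / 2 / M); first by rewrite !divr_gt0.
exists (Num.min del (Num.min 1 (e / 2 / N))).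
  by rewrite !lt_min d0 ltr01 !divr_gt0.
move=> z; rewrite !lt_min => /and3P[/h{}h z1 z2].
rewrite !hornerE [X in cabs X](_ : _ = (P.[z] - P.[z0]) * z + P.[z0] * (z - z0)); last by ring.
apply: le_lt_trans (cabsD _ _) _; rewrite !cabsM.
have zM : cabs z < M.
  by rewrite -[z](subrK z0) addrC; apply: le_lt_trans (cabsD _ _) _; rewrite ltrD2l.
have c0 := cabs_ge0 (P.[z] - P.[z0]); have c1 := cabs_ge0 z; have c2 := cabs_ge0 P.[z0].
have c3 := cabs_ge0 (z - z0).
have t1 : cabs (P.[z] - P.[z0]) * cabs z <= e / 2.
  rewrite -(divfK (lt0r_neq0 M0) (e / 2)); apply: ler_pM => //; exact: ltW.
have t2 : cabs P.[z0] * cabs (z - z0) < e / 2.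
  rewrite -(divfK (lt0r_neq0 N0) (e / 2)) mulrC.
  by apply: ltr_pM => //; rewrite /N ltrDl.
by rewrite [e]splitr; apply: ler_ltD.
Qed.

(** Rotating x and f x to the origin reduces the claim to the continuity at 0 of P / Q with P.[0] =
    0 and Q.[0] nonzero. *)
Lemma rational_like_cont f x (e : R) : rational_like f -> 0 < e ->
  exists2 del : R, 0 < del & forall y, sdist x y < del -> sdist (f x) (f y) < e.
Proof.
move=> hf e0.
have [P [Q h]] : poly_rep (sunrot (f x) \o (f \o srot x)).
  apply/rational_like_unrot/hf/rational_like_rep; exact: rational_like_rot.
have [_ /=] := h 0; rewrite -/origin srot_origin unrot_self /hproj.
case: (eqVneq Q.[0] 0) => // Q0 [/esym/eqP]; rewrite mulf_eq0 invr_eq0 (negbTE Q0) orbF => /eqP P0.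
have q0 : 0 < cabs Q.[0] by rewrite cabs_gt0.
have [|d1 d10 h1] := @horner_cont P 0 (e * cabs Q.[0] / 8); first by rewrite divr_gt0 ?mulr_gt0.
have [|d2 d20 h2] := @horner_cont Q 0 (cabs Q.[0] / 2); first by rewrite divr_gt0.
exists (Num.min 1 (Num.min d1 d2)); first by rewrite !lt_min ltr01 d10 d20.
move=> y; rewrite !lt_min => /and3P[y1 yd1 yd2].
have [z [ez z1 /andP[zd _]]] := unrot_chart (ltW y1).
have [hz1 hz2] : cabs z < d1 /\ cabs z < d2 by split; apply: le_lt_trans zd _.
have [_ /=] := h z; rewrite -ez => e1.
rewrite -(sdist_unrot (f x)) unrot_self e1.
have := h1 z; rewrite subr0 P0 subr0 => /(_ hz1) pz.
have := h2 z; rewrite subr0 => /(_ hz2) qz.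
have qz' : cabs Q.[0] / 2 < cabs Q.[z].
  by have := cabs_lerB Q.[0] Q.[z]; rewrite cabsC; lra.
have qz0 : 0 < cabs Q.[z] by apply: lt_trans qz'; rewrite divr_gt0.
rewrite /hproj -cabs_eq0 gt_eqF//; apply: le_lt_trans (sdist_origin_le _) _.
rewrite cabsf mulrA ltr_pdivrMr//; nra.
Qed.

End Charts.

(** * Degree-free estimates for polynomials on a disc *)

Section PolynomialDisc.
Context {R : realType}.
Local Notation C := (@Cx R).
Implicit Types (P Q : {poly C}) (z w : C) (r M e : R).

Lemma pow_small (x e : R) : 0 <= x < 1 -> 0 < e -> exists n, x ^+ n < e.
Proof.
move=> /andP[x0 x1] e0.
have /cvgrPdist_lt/(_ e e0)[N _ /(_ N (leqnn N))] : (GRing.exp x : R ^nat) @ \oo --> (0 : R).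
  by apply: cvg_expr; rewrite ger0_norm.
by rewrite /= sub0r normrN ger0_norm ?exprn_ge0// => h; exists N.
Qed.

Lemma prim_root_exists n : (0 < n)%N -> exists z : C, n.-primitive_root z.
Proof.
move=> n0; pose p : {poly C} := 'X^n - 1; have [rs Dp] := closed_field_poly_normal p.
rewrite (monicP _) ?monicXnsubC // scale1r in Dp.
have rn1 : all n.-unity_root rs by apply/allP=> z; rewrite -root_prod_XsubC -Dp.
have sz : (n < (size rs).+1)%N by rewrite -(size_prod_XsubC rs id) -Dp size_XnsubC.
have [|z] := hasP (has_prim_root n0 rn1 _ sz); last by exists z.
by rewrite -separable_prod_XsubC -Dp separable_Xn_sub_1 // pnatr_eq0 -lt0n.
Qed.

Lemma cabs_prim_root n z : (0 < n)%N -> z ^+ n = 1 -> cabs z = 1.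
Proof.
move=> n0 /(congr1 (@cabs R)); rewrite cabsX cabs1 => /eqP.
by rewrite pexpr_eq1 ?cabs_ge0 // => /eqP.
Qed.

Definition poly_bound P r M := forall z, cabs z <= r -> cabs P.[z] <= M.

(* Discrete Fourier averaging over roots of unity replaces the Cauchy integral. *)
Lemma cauchy_coef P r M k : 0 < r -> poly_bound P r M -> cabs P`_k <= M / r ^+ k.
Proof.
(* N is at least the size of P and larger than k, so among the exponents i < N only i = k survives
   the averaging modulo N. *)
move=> r0 hM; set N := (size P + k.+1)%N.
have N0 : (0 < N)%N by rewrite /N addnS.
have kN : (k < N)%N by rewrite /N leq_addl.
have [om om_prim] := prim_root_exists N0.
have omN := prim_expr_order om_prim.
have om1 := cabs_prim_root N0 omN.
have orth m : \sum_(j < N) (om ^+ m) ^+ j = if (N %| m)%N then N%:R else 0.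
  rewrite (prim_order_dvd om_prim); case: eqP => [->|/eqP h].
    by under eq_bigr do rewrite expr1n; rewrite sumr_const card_ord.
  have := subrX1 (om ^+ m) N; rewrite exprAC omN expr1n subrr => /esym/eqP.
  by rewrite mulf_eq0 subr_eq0 (negbTE h) => /eqP.
have key : \sum_(j < N) P.[r%:C%C * om ^+ j] * om ^+ (j * (N - k)) = N%:R * (P`_k * (r%:C%C) ^+ k).
  transitivity (\sum_(j < N) \sum_(i < N) P`_i * (r%:C%C) ^+ i * (om ^+ (i + (N - k))) ^+ j).
    apply: eq_bigr => j _; rewrite (@horner_coef_wide _ N); last by rewrite /N leq_addr.
    rewrite mulr_suml; apply: eq_bigr => i _.
    rewrite exprMn -!exprM mulrA -mulrA -exprD; congr (_ * om ^+ _).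
    by rewrite -mulnDr mulnC.
  rewrite exchange_big /= (bigD1 (Ordinal kN)) //= [X in _ + X]big1 ?addr0.
    by rewrite -mulr_sumr orth subnKC ?(ltnW kN)// dvdnn mulrC.
  move=> i ik; rewrite -mulr_sumr orth; case: ifP => [|_]; last by rewrite mulr0.
  move=> /dvdnP[q hq]; exfalso; move: ik => /eqP; apply; apply: val_inj => /=.
  have iN := ltn_ord i.
  have hq' : (i + N = q * N + k)%N by rewrite -hq -addnA subnK// ltnW.
  have : (i + N = k %[mod N])%N by rewrite hq' modnMDl.
  by rewrite modnDr !modn_small.
have := congr1 (@cabs R) key; rewrite !cabsM cabsX cabs_real (gtr0_norm r0) => key'.
have NR : (0 : R) < N%:R by rewrite ltr0n.
have cN : cabs (N%:R : C) = N%:R.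
  by rewrite -[N%:R in LHS](rmorph_nat (real_complex R)) cabs_real normr_nat.
rewrite ler_pdivlMr ?exprn_gt0// -(ler_pM2l NR) -cN -key' cN.
apply: le_trans (cabs_sum _ _ _) _.
have -> : N%:R * M = \sum_(j < N) M by rewrite sumr_const card_ord mulr_natl.
apply: ler_sum => j _; rewrite cabsM cabsX om1 expr1n mulr1; apply: hM.
by rewrite cabsM cabs_real cabsX om1 expr1n mulr1 gtr0_norm.
Qed.

Lemma cabs_subX (s : R) z w k : cabs z <= s -> cabs w <= s ->
  cabs (z ^+ k.+1 - w ^+ k.+1) <= k.+1%:R * s ^+ k * cabs (z - w).
Proof.
move=> zs ws; have s0 : 0 <= s by apply: le_trans zs; exact: cabs_ge0.
elim: k => [|k IH]; first by rewrite !expr1 expr0 mulr1 mul1r.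
have -> : z ^+ k.+2 - w ^+ k.+2 = z * (z ^+ k.+1 - w ^+ k.+1) + (z - w) * w ^+ k.+1.
  by rewrite !(exprS _ k.+1); ring.
apply: le_trans (cabsD _ _) _; rewrite !cabsM.
have -> : k.+2%:R * s ^+ k.+1 * cabs (z - w) = s * (k.+1%:R * s ^+ k * cabs (z - w)) + cabs (z - w) * s ^+ k.+1.
  by rewrite exprS -natr1; ring.
apply: lerD; first by apply: ler_pM; rewrite ?cabs_ge0.
by rewrite cabsX ler_wpM2l ?cabs_ge0// lerXn2r ?nnegrE ?cabs_ge0.
Qed.

Lemma sum_half n : \sum_(k < n) (2^-1 : R) ^+ k <= 2.
Proof.
suff : \sum_(k < n) (2^-1 : R) ^+ k = 2 - 2 * 2^-1 ^+ n.
  by move=> ->; rewrite gerBl mulr_ge0// exprn_ge0// invr_ge0.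
elim: n => [|n IH]; first by rewrite big_ord0 expr0 mulr1 subrr.
by rewrite big_ord_recr /= IH exprS; field.
Qed.

(** A difference of monomials of degree k + 1 costs a factor k + 1; on the quarter disc (k + 1) /
    4^k <= 2^-k makes the series summable. *)
Lemma poly_lip P r M z w : 0 < r -> 0 <= M -> poly_bound P r M ->
  cabs z <= r / 4 -> cabs w <= r / 4 -> cabs (P.[z] - P.[w]) <= 2 * M / r * cabs (z - w).
Proof.
move=> r0 M0 hM zr wr.
rewrite !(@horner_coef_wide _ (size P).+1 P) // -sumrB big_ord_recl !expr0 subrr add0r.
apply: le_trans (cabs_sum _ _ _) _.
have -> : 2 * M / r * cabs (z - w) = (M / r * cabs (z - w)) * 2 by ring.
apply: (@le_trans _ _ (\sum_(i < size P) (M / r * cabs (z - w)) * 2^-1 ^+ i)).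
  apply: ler_sum => i _; rewrite -mulrBr cabsM /=.
  apply: le_trans (ler_pM _ _ (cauchy_coef i.+1 r0 hM) (cabs_subX i zr wr)) _; rewrite ?cabs_ge0//.
  have r1 : r != 0 by rewrite gt_eqF.
  have -> : M / r ^+ i.+1 * (i.+1%:R * (r / 4) ^+ i * cabs (z - w)) =
     (M / r * cabs (z - w)) * (i.+1%:R / 4 ^+ i).
    by rewrite exprS expr_div_n; field; rewrite r1 expf_neq0// expf_neq0.
  rewrite ler_wpM2l ?mulr_ge0 ?cabs_ge0 ?invr_ge0 ?(ltW r0)//.
  rewrite exprVn ler_pdivrMr ?exprn_gt0// mulrC ler_pdivlMr ?exprn_gt0//.
  rewrite -(natrX _ 2) -(natrX _ 4) -natrM ler_nat (_ : 4 = 2 * 2)%N// expnMn leq_mul2r.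
  by rewrite ltn_expl// orbT.
by rewrite -mulr_sumr ler_wpM2l ?sum_half// mulr_ge0 ?cabs_ge0// divr_ge0// ltW.
Qed.

(** The bound ignores the degree of P, which is what lets it pass to limits of polynomials. *)
Lemma poly_tail P r M K z : 0 < r -> 0 <= M -> poly_bound P r M -> cabs z <= r / 2 ->
  cabs (P.[z] - \sum_(j < K) P`_j * z ^+ j) <= 2 * M * (cabs z / r) ^+ K.
Proof.
move=> r0 M0 hM zr.
rewrite (@horner_coef_wide _ (K + size P)) ?leq_addl// big_split_ord /= addrAC subrr add0r.
apply: le_trans (cabs_sum _ _ _) _.
have z0 : 0 <= cabs z / r by rewrite divr_ge0 ?cabs_ge0// ltW.
have zh : cabs z / r <= 2^-1 by rewrite ler_pdivrMr// mulrC.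
have -> : 2 * M * (cabs z / r) ^+ K = M * (cabs z / r) ^+ K * 2 by ring.
apply: (@le_trans _ _ (\sum_(i < size P) (M * (cabs z / r) ^+ K) * 2^-1 ^+ i)).
  apply: ler_sum => i _; rewrite cabsM cabsX.
  apply: le_trans (ler_wpM2r _ (cauchy_coef (K + i) r0 hM)) _; first by rewrite exprn_ge0// cabs_ge0.
  have -> : M / r ^+ (K + i) * cabs z ^+ (K + i) = M * (cabs z / r) ^+ (K + i).
    by rewrite expr_div_n; ring.
  rewrite exprD mulrA ler_wpM2l ?mulr_ge0 ?exprn_ge0//.
  by rewrite lerXn2r// nnegrE.
by rewrite -mulr_sumr ler_wpM2l ?sum_half// mulr_ge0 ?exprn_ge0.
Qed.

(** A two-disc principle: the bound M on the large disc controls the coefficients from K on,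
    smallness on the small disc controls the first K. As K is fixed before e, the same e serves
    every P. *)
Lemma poly_small (M r eta om : R) : 0 <= M -> 0 < r -> 0 < eta -> 0 < om ->
  exists2 e : R, 0 < e & forall P, poly_bound P r M -> poly_bound P eta e ->
    poly_bound P (r / 2) om.
Proof.
move=> M0 r0 eta0 om0.
have [||K hK] := @pow_small 2^-1 (om / 2 / (2 * M + 1)); first by lra.
  by rewrite !divr_gt0//; lra.
(* A is the loss in passing from radius eta to radius r / 2 in the first K coefficients. *)
set A : R := \sum_(j < K) (r / 2 / eta) ^+ j.
have A0 : 0 <= A by apply: sumr_ge0 => j _; rewrite exprn_ge0// !divr_ge0// ltW.
have A1 : 0 < A + 1 by rewrite ltr_wpDl.
exists (om / 2 / (A + 1)); first by rewrite !divr_gt0.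
move=> P hM he z zr; have t := poly_tail K r0 M0 hM zr.
rewrite -(subrK (\sum_(j < K) P`_j * z ^+ j) P.[z]).
apply: le_trans (cabsD _ _) _; rewrite [om]splitr; apply: lerD.
  apply: le_trans t _.
  apply: (@le_trans _ _ (2 * M * (2^-1) ^+ K)).
    rewrite ler_wpM2l ?mulr_ge0// lerXn2r ?nnegrE ?invr_ge0 ?divr_ge0 ?cabs_ge0 ?(ltW r0)//.
    by rewrite ler_pdivrMr// mulrC.
  have M1 : 0 < 2 * M + 1 by lra.
  move: hK; rewrite ltr_pdivlMr// => hK; apply: le_trans (ltW hK).
  have H0 : 0 <= (2^-1 : R) ^+ K by rewrite exprn_ge0// invr_ge0.
  by rewrite mulrC ler_wpM2l// lerDl.
apply: le_trans (cabs_sum _ _ _) _.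
apply: (@le_trans _ _ (\sum_(j < K) (om / 2 / (A + 1)) * (r / 2 / eta) ^+ j)).
  apply: ler_sum => j _; rewrite cabsM cabsX.
  apply: (@le_trans _ _ ((om / 2 / (A + 1)) / eta ^+ j * (r / 2) ^+ j)).
    apply: ler_pM; rewrite ?cabs_ge0 ?exprn_ge0 ?cabs_ge0//; first exact: cauchy_coef.
    by rewrite lerXn2r// nnegrE ?cabs_ge0// divr_ge0// ltW.
  by rewrite (expr_div_n (r / 2) eta j) [leRHS]mulrA mulrAC.
rewrite -mulr_sumr -/A mulrAC ler_pdivrMr//.
by rewrite ler_wpM2l ?divr_ge0 ?(ltW om0)// lerDl.
Qed.

(** Plays the role of holomorphy on the disc: estimates for polynomials transfer to such F, and the
    class is closed under products and uniform limits. *)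
Definition papprox (r : R) (F : C -> C) := forall e : R, 0 < e ->
  exists P : {poly C}, forall z, cabs z <= r -> cabs (F z - P.[z]) <= e.

Lemma papprox_bound P r e M (F : C -> C) : (forall z, cabs z <= r -> cabs (F z - P.[z]) <= e) ->
  (forall z, cabs z <= r -> cabs (F z) <= M) -> poly_bound P r (M + e).
Proof.
move=> h hM z zr; rewrite -(subrK (F z) P.[z]) addrC.
by apply: le_trans (cabsD _ _) _; rewrite cabsC lerD ?h ?hM.
Qed.

Lemma papprox_lip r M (F : C -> C) z w : 0 < r -> 0 <= M -> papprox r F ->
  (forall z, cabs z <= r -> cabs (F z) <= M) ->
  cabs z <= r / 4 -> cabs w <= r / 4 -> cabs (F z - F w) <= 2 * M / r * cabs (z - w).
Proof.
move=> r0 M0 hF hM zr wr; apply/ler_addgt0Pr => e e0.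
set e' := Num.min (e / 4) (e / 4 / (2 / r * cabs (z - w) + 1)).
have c0 : 0 <= 2 / r * cabs (z - w) by rewrite mulr_ge0 ?cabs_ge0// divr_ge0// ltW.
have c1 : 0 < 2 / r * cabs (z - w) + 1 by lra.
have e'0 : 0 < e' by rewrite lt_min !divr_gt0.
have [P hP] := hF e' e'0.
have := poly_lip r0 _ (papprox_bound hP hM) zr wr => /(_ (addr_ge0 M0 (ltW e'0))) L.
have zr' : cabs z <= r by apply: le_trans zr _; rewrite ler_pdivrMr//; lra.
have wr' : cabs w <= r by apply: le_trans wr _; rewrite ler_pdivrMr//; lra.
have -> : F z - F w = (F z - P.[z]) + ((P.[z] - P.[w]) - (F w - P.[w])) by ring.
apply: le_trans (cabsD _ _) _.
have t2 := cabsB (P.[z] - P.[w]) (F w - P.[w]).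
have h1 := hP z zr'; have h2 := hP w wr'.
have l1 : e' <= e / 4 by rewrite ge_min lexx.
have l2 : e' * (2 / r * cabs (z - w)) <= e / 4.
  have : e' <= e / 4 / (2 / r * cabs (z - w) + 1) by rewrite ge_min lexx orbT.
  rewrite ler_pdivlMr//; nra.
have e1 : 2 * (M + e') / r * cabs (z - w) = 2 * M / r * cabs (z - w) + e' * (2 / r * cabs (z - w)) by ring.
lra.
Qed.

Lemma papprox_small (M r eta om : R) : 0 <= M -> 0 < r -> 0 < eta -> 0 < om ->
  exists2 e : R, 0 < e & forall F, papprox r F ->
   (forall z, cabs z <= r -> cabs (F z) <= M) ->
   (forall z, cabs z <= eta -> cabs (F z) <= e) ->
   (forall z, cabs z <= r / 2 -> cabs (F z) <= om).
Proof.
move=> M0 r0 eta0 om0.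
have eta'0 : 0 < Num.min eta r by rewrite lt_min eta0.
have M1 : 0 <= M + 1 by rewrite addr_ge0.
have om2 : 0 < om / 2 by rewrite divr_gt0.
have [e e0 h] := poly_small M1 r0 eta'0 om2.
exists (e / 2); first by rewrite divr_gt0.
move=> F hF hM he z zr.
have d0 : 0 < Num.min 1 (Num.min (e / 2) (om / 2)) by rewrite !lt_min ltr01 !divr_gt0.
have [P hP] := hF _ d0; have := papprox_bound hP hM.
move=> hPM.
have {}hPM : poly_bound P r (M + 1).
  by move=> x xr; apply: le_trans (hPM _ xr) _; rewrite lerD2l ge_min lexx.
have hPe : poly_bound P (Num.min eta r) e.
  move=> x; rewrite le_min => /andP[x1 x2]; rewrite -(subrK (F x) P.[x]) [e]splitr.
  apply: le_trans (cabsD _ _) _; rewrite lerD ?he// cabsC.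
  by apply: le_trans (hP _ x2) _; rewrite !ge_min lexx !orbT.
have zr' : cabs z <= r by apply: le_trans zr _; rewrite ler_pdivrMr//; lra.
rewrite -(subrK P.[z] (F z)) [om]splitr; apply: le_trans (cabsD _ _) _.
apply: lerD; last exact: h.
by apply: le_trans (hP _ zr') _; rewrite !ge_min lexx !orbT.
Qed.

End PolynomialDisc.

(** * Identity theorem and Cauchy estimates for rational maps *)

Section RationalDisc.
Context {R : realType}.
Local Notation C := (@Cx R).
Local Notation S2 := (@Chat R).
Implicit Types (P Q : {poly C}) (z w : C) (r M e : R).

(** Zeros accumulating at 0 kill the Taylor coefficients one after the other. As F itself comes
    without coefficients, [coef0] speaks of the first k coefficients of every polynomial close
    enough to F. *)
Lemma papprox_ident r M (F : C -> C) : 0 < r -> 0 <= M -> papprox r F ->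
  (forall z, cabs z <= r -> cabs (F z) <= M) ->
  (forall d : R, 0 < d -> exists z, [/\ z != 0, cabs z < d & F z = 0]) ->
  forall z, cabs z <= r / 2 -> F z = 0.
Proof.
move=> r0 M0 hF hM hz.
have coef0 k : forall om : R, 0 < om -> exists2 e : R, 0 < e & forall P,
    (forall z, cabs z <= r -> cabs (F z - P.[z]) <= e) -> \sum_(j < k) cabs P`_j * r ^+ j <= om.
  elim: k => [om om0|k IH om om0].
    by exists 1 => // P _; rewrite big_ord0 ltW.
  have M1 : 0 < M + 1 by rewrite ltr_wpDl.
  (* The zero z is fixed first: this radius makes the tail beyond degree k at most x^k om / 4. Only
     then is the precision x^k om / 8 imposed, so that dividing by x^k still leaves om / 2. *)
  have [|z [z0 zt Fz]] := hz (Num.min (r / 2) (om * r / (8 * (M + 1)))).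
    by rewrite lt_min !divr_gt0 ?mulr_gt0.
  move: zt; rewrite lt_min => /andP[zr zt].
  set x := cabs z / r.
  have x0 : 0 < x by rewrite divr_gt0 // cabs_gt0.
  have xk0 : 0 < x ^+ k by rewrite exprn_gt0.
  have om'0 : 0 < Num.min (om / 2) (x ^+ k * om / 8) by rewrite lt_min !divr_gt0 ?mulr_gt0.
  have [e' e'0 he'] := IH _ om'0.
  exists (Num.min e' (Num.min 1 (x ^+ k * om / 8))).
    by rewrite !lt_min e'0 ltr01 !divr_gt0 ?mulr_gt0.
  move=> P hP.
  have le1 : forall z, cabs z <= r -> cabs (F z - P.[z]) <= e'.
    by move=> y yr; apply: le_trans (hP y yr) _; rewrite ge_min lexx.
  have le2 : forall z, cabs z <= r -> cabs (F z - P.[z]) <= 1.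
    by move=> y yr; apply: le_trans (hP y yr) _; rewrite !ge_min lexx orbT.
  have le3 : forall z, cabs z <= r -> cabs (F z - P.[z]) <= x ^+ k * om / 8.
    by move=> y yr; apply: le_trans (hP y yr) _; rewrite !ge_min lexx !orbT.
  have S := he' _ le1; rewrite big_ord_recr /=.
  have [S1 S2'] : \sum_(j < k) cabs P`_j * r ^+ j <= om / 2 /\
      \sum_(j < k) cabs P`_j * r ^+ j <= x ^+ k * om / 8.
    by split; apply: le_trans S _; rewrite ge_min lexx ?orbT.
  rewrite [om]splitr; apply: lerD => //.
  have PM := papprox_bound le2 hM.
  have t := poly_tail k.+1 r0 (ltW M1) PM (ltW zr).
  have zr' : cabs z <= r by apply: le_trans (ltW zr) _; rewrite ler_pdivrMr//; lra.
  have Pz := le3 z zr'; rewrite Fz sub0r cabsN in Pz.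
  have Sz : cabs (\sum_(j < k) P`_j * z ^+ j) <= x ^+ k * om / 8.
    apply: le_trans S2'; apply: le_trans (cabs_sum _ _ _) _; apply: ler_sum => j _.
    by rewrite cabsM cabsX ler_wpM2l ?cabs_ge0// lerXn2r ?nnegrE ?cabs_ge0// ltW.
  have eP : P`_k * z ^+ k = (P.[z] - \sum_(j < k) P`_j * z ^+ j) - (P.[z] - \sum_(j < k.+1) P`_j * z ^+ j).
    by rewrite big_ord_recr /=; ring.
  have : cabs (P`_k * z ^+ k) <= x ^+ k * (om / 2).
    rewrite eP; apply: le_trans (cabsB _ _) _.
    have := cabsB P.[z] (\sum_(j < k) P`_j * z ^+ j).
    have t2 : 2 * (M + 1) * (cabs z / r) ^+ k.+1 <= x ^+ k * (om / 4).
      rewrite exprS -/x mulrA mulrC ler_pM2l//.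
      move: zt; rewrite ltr_pdivlMr ?mulr_gt0// => zt.
      by rewrite /x mulrA ler_pdivrMr//; lra.
    lra.
  have -> : cabs (P`_k * z ^+ k) = x ^+ k * (cabs P`_k * r ^+ k).
    rewrite cabsM cabsX /x expr_div_n; field.
    by rewrite expf_neq0// gt_eqF.
  by rewrite ler_pM2l.
move=> z zr; apply/eqP; rewrite -cabs_eq0 eq_le cabs_ge0 andbT; apply/ler_addgt0Pr => e e0; rewrite add0r.
have [||K hK] := @pow_small R 2^-1 (e / 4 / (2 * (M + 1))); first by lra.
  by rewrite !divr_gt0// mulr_gt0 ?ltr_wpDl.
have e4 : 0 < e / 4 by rewrite divr_gt0.
have [d d0 hd] := coef0 K _ e4.
have d'0 : 0 < Num.min d (Num.min 1 (e / 4)) by rewrite !lt_min d0 ltr01.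
have [P hP] := hF _ d'0.
have le1 : forall z, cabs z <= r -> cabs (F z - P.[z]) <= d.
  by move=> y yr; apply: le_trans (hP y yr) _; rewrite ge_min lexx.
have le2 : forall z, cabs z <= r -> cabs (F z - P.[z]) <= 1.
  by move=> y yr; apply: le_trans (hP y yr) _; rewrite !ge_min lexx orbT.
have zr' : cabs z <= r by apply: le_trans zr _; rewrite ler_pdivrMr//; lra.
have le3 : cabs (F z - P.[z]) <= e / 4.
  by apply: le_trans (hP z zr') _; rewrite !ge_min lexx !orbT.
have PM := papprox_bound le2 hM.
have M1 : 0 < M + 1 by rewrite ltr_wpDl.
have t := poly_tail K r0 (ltW M1) PM zr.
have Sz : cabs (\sum_(j < K) P`_j * z ^+ j) <= e / 4.
  apply: le_trans (hd _ le1); apply: le_trans (cabs_sum _ _ _) _; apply: ler_sum => j _.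
  by rewrite cabsM cabsX ler_wpM2l ?cabs_ge0// lerXn2r ?nnegrE ?cabs_ge0// ltW.
have t2 : 2 * (M + 1) * (cabs z / r) ^+ K <= e / 4.
  apply: (@le_trans _ _ (2 * (M + 1) * 2^-1 ^+ K)).
    rewrite ler_wpM2l ?mulr_ge0 ?(ltW M1)// lerXn2r ?nnegrE ?invr_ge0 ?divr_ge0 ?cabs_ge0 ?(ltW r0)//.
    by rewrite ler_pdivrMr// mulrC.
  by move: hK; rewrite ltr_pdivlMr ?mulr_gt0// mulrC => /ltW.
have := cabsD (F z - P.[z]) P.[z]; rewrite subrK.
have := cabsD (P.[z] - \sum_(j < K) P`_j * z ^+ j) (\sum_(j < K) P`_j * z ^+ j); rewrite subrK.
lra.
Qed.

Lemma papprox_poly r P : papprox r (horner P).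
Proof. by move=> e e0; exists P => z _; rewrite subrr cabs0 ltW. Qed.

Lemma papprox_ext r (F G : C -> C) : (forall z, cabs z <= r -> F z = G z) -> papprox r F -> papprox r G.
Proof. by move=> h hF e e0; have [P hP] := hF e e0; exists P => z zr; rewrite -h// hP. Qed.

Lemma papprox_uniform r (F : C -> C) :
  (forall e : R, 0 < e -> exists2 G, papprox r G & forall z, cabs z <= r -> cabs (F z - G z) <= e) ->
  papprox r F.
Proof.
move=> h e e0; have e2 : 0 < e / 2 by rewrite divr_gt0.
have [G hG hFG] := h _ e2; have [P hP] := hG _ e2; exists P => z zr.
by rewrite [e]splitr; apply: le_trans (cabsBD _ (G z) _) _; rewrite lerD ?hFG ?hP.
Qed.

Lemma poly_disc_bound r P : 0 <= r -> exists2 M : R, 0 <= M & poly_bound P r M.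
Proof.
move=> r0; exists (\sum_(k < size P) cabs P`_k * r ^+ k).
  by apply: sumr_ge0 => k _; rewrite mulr_ge0 ?cabs_ge0 ?exprn_ge0.
move=> z zr; rewrite horner_coef; apply: le_trans (cabs_sum _ _ _) _; apply: ler_sum => k _.
by rewrite cabsM cabsX ler_wpM2l ?cabs_ge0// lerXn2r ?nnegrE ?cabs_ge0.
Qed.

Lemma papprox_bounded r (F : C -> C) : 0 <= r -> papprox r F ->
  exists2 M : R, 0 <= M & forall z, cabs z <= r -> cabs (F z) <= M.
Proof.
move=> r0 /(_ 1 ltr01)[P hP]; have [M M0 hM] := poly_disc_bound P r0.
exists (1 + M); first by rewrite addr_ge0.
move=> z zr; rewrite -(subrK P.[z] (F z)); apply: le_trans (cabsD _ _) _.
by rewrite lerD ?hP ?hM.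
Qed.

Lemma papproxM r (F G : C -> C) : 0 <= r -> papprox r F -> papprox r G ->
  papprox r (fun z => F z * G z).
Proof.
move=> r0 hF hG e e0.
have [M M0 hM] := papprox_bounded r0 hF; have [N N0 hN] := papprox_bounded r0 hG.
set B := M + N + 1; have B0 : 0 < B by rewrite /B; lra.
set d := Num.min 1 (e / 2 / B).
have d0 : 0 < d by rewrite lt_min ltr01 !divr_gt0.
have [P hP] := hF d d0; have [Q hQ] := hG d d0.
exists (P * Q) => z zr; rewrite hornerM.
have -> : F z * G z - P.[z] * Q.[z] = F z * (G z - Q.[z]) + (F z - P.[z]) * Q.[z] by ring.
apply: le_trans (cabsD _ _) _; rewrite !cabsM.
have a1 := hP z zr; have a2 := hQ z zr; have a3 := hM z zr.
have [d1 d2] : d <= 1 /\ d <= e / 2 / B by rewrite /d !ge_min !lexx orbT.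
have a4 : cabs Q.[z] <= B.
  by have := papprox_bound hQ hN zr; rewrite /B; lra.
have a5 : cabs (F z) <= B by rewrite /B; lra.
have dB : d * B <= e / 2 by rewrite -ler_pdivlMr.
rewrite [e]splitr; apply: lerD; apply: le_trans dB; first rewrite mulrC;
  by apply: ler_pM; rewrite ?cabs_ge0.
Qed.

(** The pole lies outside the disc, so the geometric series in z / w converges uniformly and can be
    truncated. *)
Lemma papprox_inv_lin r w : 0 < r -> r < cabs w -> papprox r (fun z => (z - w)^-1).
Proof.
move=> r0 rw e e0.
have w0 : 0 < cabs w by apply: lt_trans rw.
have wn0 : w != 0 by rewrite -cabs_gt0.
set x := r / cabs w.
have x1 : 0 <= x < 1 by rewrite divr_ge0 ?(ltW r0) ?cabs_ge0//= ltr_pdivrMr// mul1r.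
have /andP[x0 x1'] := x1.
have [|n hn] := pow_small x1 (_ : 0 < e * (cabs w * (1 - x))).
  by rewrite !mulr_gt0// subr_gt0.
exists (- w^-1 *: \sum_(i < n) (w^-1 *: 'X) ^+ i) => z zr.
rewrite hornerZ horner_sum.
under eq_bigr do rewrite horner_exp hornerZ hornerX.
set y := w^-1 * z.
have yx : cabs y <= x by rewrite /y cabsM cabsV mulrC /x ler_wpM2r// invr_ge0 ltW.
have y1 : 1 - x <= cabs (1 - y) by have := cabs_lerB 1 y; rewrite cabs1; lra.
have yn0 : 1 - y != 0 by rewrite -cabs_gt0; lra.
have ezw : z - w = - w * (1 - y) by rewrite /y; field.
have zw0 : z - w != 0 by rewrite ezw mulf_neq0// oppr_eq0.
have -> : (z - w)^-1 - - w^-1 * \sum_(i < n) y ^+ i = - w^-1 * (y ^+ n / (1 - y)).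
  have := subrX1 y n; set S := \sum_(i < n) _ => hS.
  have -> : y ^+ n = 1 + (y - 1) * S by rewrite -hS; ring.
  rewrite /y; field; rewrite wn0 zw0 andbT /=.
  by rewrite -opprB oppr_eq0.
rewrite cabsM cabsN cabsV cabsf cabsX.
have yp : 0 < cabs (1 - y) by rewrite cabs_gt0.
rewrite mulrC ler_pdivrMr// ler_pdivrMr//.
apply: le_trans (_ : x ^+ n <= _).
  by rewrite lerXn2r ?nnegrE ?cabs_ge0.
apply: le_trans (ltW hn) _; rewrite mulrA; apply: ler_pM => //.
- by rewrite mulr_ge0 ?cabs_ge0// ltW.
- by rewrite subr_ge0 ltW.
Qed.

(** Q splits into linear factors with roots outside the disc, and each factor has an approximable
    inverse. *)
Lemma papprox_frac r P Q : 0 < r -> (forall z, cabs z <= r -> Q.[z] != 0) ->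
  papprox r (fun z => P.[z] / Q.[z]).
Proof.
move=> r0 hQ; apply: papproxM; [exact: ltW|exact: papprox_poly|].
have [rs Dq] := closed_field_poly_normal Q.
have Q0 : Q != 0 by apply/eqP => q0; have := hQ 0; rewrite q0 horner0 eqxx cabs0 => /(_ (ltW r0)).
have l0 : lead_coef Q != 0 by rewrite lead_coef_eq0.
have big : forall w, w \in rs -> r < cabs w.
  move=> w wrs; rewrite ltNge; apply/negP => /hQ/negP; apply.
  rewrite Dq hornerZ mulf_eq0 (_ : _.[w] == 0) ?orbT//.
  by rewrite -[_ == 0]/(root _ w) root_prod_XsubC wrs.
have main : papprox r (fun z => (\prod_(w <- rs) (z - w))^-1).
  elim: (rs) big => [_|w s IH h].
    apply: (@papprox_ext _ (horner 1%:P)); last exact: papprox_poly.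
    by move=> z _; rewrite hornerC big_nil invr1.
  apply: (@papprox_ext _ (fun z => (z - w)^-1 * (\prod_(w <- s) (z - w))^-1)).
    by move=> z _; rewrite big_cons invfM.
  apply: papproxM; first exact: ltW.
    by apply: papprox_inv_lin => //; apply: h; rewrite mem_head.
  by apply: IH => v vs; apply: h; rewrite inE vs orbT.
apply: (@papprox_ext _ (fun z => (horner (lead_coef Q)^-1%:P z) * (\prod_(w <- rs) (z - w))^-1)).
  move=> z _; rewrite hornerC [in RHS]Dq hornerZ invfM; congr (_ * _^-1).
  by rewrite horner_prod; apply: eq_bigr => w _; rewrite hornerXsubC.
by apply: papproxM; [exact: ltW|exact: papprox_poly|].
Qed.

(** f read in the rotated charts at c and c'. The value 1 that [lift1] gives to infinity is never
    met where the image stays within distance 1 of c'. *)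
Definition chart_map (c c' : S2) (f : S2 -> S2) (z : C) : C := lift1 (sunrot c' (f (srot c (Some z)))).

Lemma chart_mapP c c' f (s a : R) : rational_like f -> 0 < s -> a <= 1 ->
  (forall z, cabs z <= s -> sdist c' (f (srot c (Some z))) <= a) ->
  [/\ papprox s (chart_map c c' f),
      forall z, cabs z <= s -> cabs (chart_map c c' f z) <= a &
      forall z, cabs z <= s -> f (srot c (Some z)) = srot c' (Some (chart_map c c' f z))].
Proof.
move=> hf s0 a1 h.
have key z : cabs z <= s -> [/\ sunrot c' (f (srot c (Some z))) = Some (chart_map c c' f z),
    cabs (chart_map c c' f z) <= a & f (srot c (Some z)) = srot c' (Some (chart_map c c' f z))].
  move=> zs; have [w [ew w1 /andP[w2 _]]] := unrot_chart (le_trans (h z zs) a1).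
  have e : sunrot c' (f (srot c (Some z))) = Some w by rewrite ew srotK.
  by rewrite /chart_map e /=; split=> //; apply: le_trans w2 (h z zs).
split; [|by move=> z /key[]|by move=> z /key[]].
have [P [Q hPQ]] : poly_rep (sunrot c' \o (f \o srot c)).
  by apply/rational_like_unrot/hf/rational_like_rep/rational_like_rot.
have hQ z : cabs z <= s -> Q.[z] != 0 /\ chart_map c c' f z = P.[z] / Q.[z].
  move=> /key[e _ _]; have [_ /=] := hPQ z; rewrite e /hproj.
  by case: (eqVneq Q.[z] 0) => // _ [].
apply: (@papprox_ext _ (fun z => P.[z] / Q.[z])); first by move=> z /hQ[_ ->].
by apply: papprox_frac => // z /hQ[].
Qed.

(** A Cauchy estimate for the derivative. The factor a in the constant is what later turns a small
    image of a ball into contraction. *)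
Lemma rational_lip f c (s a : R) : rational_like f -> 0 < s -> s <= 1 -> 0 <= a -> a <= 1 ->
  (forall y, sdist c y < s -> sdist (f c) (f y) <= a) ->
  forall y y', sdist c y <= s / 16 -> sdist c y' <= s / 16 ->
    sdist (f y) (f y') <= 16 * a / s * sdist y y'.
Proof.
move=> hf s0 s1 a0 a1 h y y' ys ys'.
(* The chart disc of radius s / 4 lies in the spherical ball of radius s. [papprox_lip] then works
   on radius s / 16 with constant 2 a / (s / 4), and returning to the sphere doubles it. *)
have s4 : 0 < s / 4 by rewrite divr_gt0.
have h' z : cabs z <= s / 4 -> sdist (f c) (f (srot c (Some z))) <= a.
  move=> zs; apply: h; rewrite -{1}(srot_origin c).
  have := @sdist_rot_disc R c 0 z; rewrite cabs0 sub0r cabsN ler01 -/origin.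
  by case/(_ isT _)/andP => [|_ ?]; lra.
have [ap b e] := chart_mapP hf s4 a1 h'.
have y1 : sdist c y <= 1 by lra.
have y1' : sdist c y' <= 1 by lra.
have [z [ez z1 /andP[zd _]]] := unrot_chart y1.
have [z' [ez' z1' /andP[zd' _]]] := unrot_chart y1'.
have zs : cabs z <= s / 4 / 4 by lra.
have zs' : cabs z' <= s / 4 / 4 by lra.
have L := papprox_lip s4 a0 ap b zs zs'.
have zz : cabs z <= s / 4 by lra.
have zz' : cabs z' <= s / 4 by lra.
rewrite ez ez' (e z zz) (e z' zz').
have b1 : cabs (chart_map c (f c) f z) <= 1 by apply: le_trans (b z zz) a1.
have b1' : cabs (chart_map c (f c) f z') <= 1 by apply: le_trans (b z' zz') a1.
have /andP[_ t1] := @sdist_rot_disc R (f c) _ _ b1 b1'.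
have /andP[t2 _] := @sdist_rot_disc R c _ _ z1 z1'.
apply: le_trans t1 _.
have -> : 16 * a / s * sdist (srot c (Some z)) (srot c (Some z')) =
   2 * ((2 * a / (s / 4)) * sdist (srot c (Some z)) (srot c (Some z'))) by field; rewrite gt_eqF.
rewrite ler_pM2l//; apply: le_trans L _; rewrite ler_wpM2l//.
by rewrite divr_ge0 ?mulr_ge0// ltW.
Qed.

End RationalDisc.

(** * Compactness *)

Section MetricCompactness.
Context {R : realType} {T : Type} (dist : T -> T -> R).
Hypothesis dist_tri : forall y x z, dist x z <= dist x y + dist y z.
Hypothesis dist_sym : forall x y, dist x y = dist y x.
Hypothesis dist_eq0 : forall x y, dist x y = 0 -> x = y.
Hypothesis dist_ge0 : forall x y, 0 <= dist x y.
Hypothesis dist_xx : forall x, dist x x = 0.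

Lemma inv_natS_small (e : R) : 0 < e -> exists N, forall n, (N <= n)%N -> n.+1%:R^-1 < e.
Proof.
move=> e0; exists (Num.bound e^-1) => n hn.
rewrite -[e]invrK ltf_pV2 ?posrE ?invr_gt0 ?ltr0n//.
have := @archi_boundP R e^-1; rewrite invr_ge0 => /(_ (ltW e0)) h.
by apply: lt_trans h _; rewrite ltr_nat ltnS.
Qed.

Lemma finite_nat_bounded (F : set nat) : finite_set F -> exists N, forall n, F n -> (n <= N)%N.
Proof.
move=> /finite_seqP[s ->]; exists (\max_(i <- s) i)%N => n /= ns.
by rewrite (big_rem n) //= leq_maxl.
Qed.

Lemma dopen_dball x (s : R) : dopen dist (dball dist x s).
Proof.
move=> y; rewrite /dball /= => h; exists (s - dist x y); first by rewrite subr_gt0.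
by move=> z; rewrite /dball /= ltrBrDl; apply: le_lt_trans (dist_tri _ _ _).
Qed.

Lemma dcompact_sep (K : set T) x : dcompact dist K -> ~ K x ->
  exists2 e : R, 0 < e & forall y, K y -> e <= dist x y.
Proof.
move=> cK nKx.
have [||F fF hF] := cK nat (fun n => [set y | n.+1%:R^-1 < dist x y]).
- move=> n y /= h; exists (dist x y - n.+1%:R^-1); first by rewrite subr_gt0.
  move=> y'; rewrite /dball /=.
  rewrite ltrBrDr -ltrBrDl => h'; apply: lt_le_trans h' _.
  by rewrite lerBlDr (dist_sym y y') dist_tri.
- move=> y Ky.
  have d0 : 0 < dist x y.
    rewrite lt_neqAle dist_ge0 andbT eq_sym; apply/eqP => /dist_eq0 e.
    by apply: nKx; rewrite e.
  by have [N hN] := inv_natS_small d0; exists N => //=; apply: hN.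
have [N hN] := finite_nat_bounded fF.
exists (N.+1%:R^-1); first by rewrite invr_gt0 ltr0n.
move=> y Ky; have [n Fn /= hn] := hF y Ky.
apply: le_trans (ltW hn); rewrite lef_pV2 ?posrE ?ltr0n// ler_nat ltnS.
exact: hN.
Qed.

Lemma dcompact_net (K : set T) (e : R) : 0 < e -> dcompact dist K ->
  exists2 F : set T, finite_set F & F `<=` K /\ forall x, K x -> exists2 y, F y & dist y x < e.
Proof.
move=> e0 cK.
(* The clause K x empties the sets with centre outside K, so the chosen centres can be restricted to
   K. *)
have [||F fF hF] := cK T (fun x => [set y | K x /\ dist x y < e]).
- move=> x y /= [Kx h]; exists (e - dist x y); first by rewrite subr_gt0.
  move=> y'; rewrite /dball /= ltrBrDl => h'; split=> //.
  by apply: le_lt_trans h'.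
- move=> x Kx; exists x => //=; split => //.
  by rewrite dist_xx.
exists (F `&` K); first exact: finite_setIl.
split; first by move=> x [].
by move=> x /hF[y Fy [Ky h]]; exists y.
Qed.

End MetricCompactness.

(** * Ultrafilter limits and compactness of the sphere *)

Section SphereCompactness.
Context {R : realType}.
Local Notation C := (@Cx R).
Local Notation S2 := (@Chat R).

Section UltraLimits.
Context {I : Type} (U : set_system I) {UU : UltraFilter U}.

Lemma ultra_ex (A : set I) : U A -> exists i, A i.
Proof. exact: (@filter_ex _ U _). Qed.

Lemma ultra_real_lim (u : I -> R) (B : R) : (forall i, `|u i| <= B) ->
  exists l : R, forall e : R, 0 < e -> U [set i | `|u i - l| < e].
Proof.
move=> hB.
have [l [_ cl]] : `[- B, B] `&` cluster (u @ U) !=set0.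
  apply: segment_compact; apply: (@filterS _ U) (@filterT _ U _) => i _ /=.
  by rewrite in_itv /= -ler_norml hB.
exists l => e e0; case: (in_ultra_setVsetC [set i | `|u i - l| < e] UU) => // h.
have [|] := cl [set x | ~ (`|x - l| < e)] (ball l e) _ (nbhsx_ballx _ _ e0).
  by apply: (@filterS _ U) h.
by move=> x [/= h1]; rewrite /ball /= distrC.
Qed.

Lemma ultra_cx_lim (u : I -> C) (B : R) : (forall i, cabs (u i) <= B) ->
  exists l : C, forall e : R, 0 < e -> U [set i | cabs (u i - l) < e].
Proof.
move=> hB.
have [|a ha] := @ultra_real_lim (fun i => complex.Re (u i)) B.
  by move=> i; apply: le_trans (absRe_le _) (hB i).
have [|b hb] := @ultra_real_lim (fun i => complex.Im (u i)) B.
  by move=> i; apply: le_trans (absIm_le _) (hB i).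
exists (a +i* b)%C => e e0; have e2 : 0 < e / 2 by rewrite divr_gt0.
apply: (@filterS2 _ U) (ha _ e2) (hb _ e2) => i /= h1 h2.
apply: le_lt_trans (cabs_ReIm _) _; rewrite [e]splitr.
by move: (u i) h1 h2 => [x y] /= h1 h2; rewrite ltrD.
Qed.

Definition ulim (u : I -> S2) (x : S2) := forall e : R, 0 < e -> U [set i | sdist (u i) x < e].

(** The lifts are normalized to unit vectors of C^2, whose coordinates have limits; the unit norm
    keeps the limit vector away from 0. *)
Lemma ulim_ex (u : I -> S2) : exists x, ulim u x.
Proof.
pose k i := ((nrm2 (lift1 (u i)) (lift2 (u i)))^-1)%:C%C : C.
pose a i := k i * lift1 (u i); pose b i := k i * lift2 (u i).
have n0 i : 0 < nrm2 (lift1 (u i)) (lift2 (u i)) by rewrite nrm2_gt0 nz2_lift.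
have n1 i : nrm2 (a i) (b i) = 1.
  by rewrite /a /b nrm2Z cabs_real ger0_norm ?invr_ge0 ?ltW// mulVf// gt_eqF.
have nz i : nz2 (a i) (b i) by rewrite -nrm2_gt0 n1.
have eu i : u i = hproj (a i) (b i).
  by rewrite -[LHS]hproj_lift; apply: hproj_eq; rewrite ?nz2_lift// /a /b; ring.
have sq i : cabs (a i) ^+ 2 + cabs (b i) ^+ 2 = 1 by rewrite -nrm2_sq n1 expr1n.
have [|l hl] := @ultra_cx_lim a 1.
  by move=> i; rewrite -(expr_le1 (n := 2))// ?cabs_ge0// -(sq i) lerDl sqr_ge0.
have [|m hm] := @ultra_cx_lim b 1.
  by move=> i; rewrite -(expr_le1 (n := 2))// ?cabs_ge0// -(sq i) lerDr sqr_ge0.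
have nlm : nz2 l m.
  apply/negP => /negP; rewrite negb_or !negbK => /andP[/eqP l0 /eqP m0].
  have h0 : 0 < 2^-1 :> R by rewrite invr_gt0.
  have [i [/=]] := ultra_ex (@filterI _ U _ _ _ (hl _ h0) (hm _ h0)).
  rewrite l0 m0 !subr0 => h1 h2.
  by have := sq i; have := cabs_ge0 (a i); have := cabs_ge0 (b i); nra.
have nlm0 : 0 < nrm2 l m by rewrite nrm2_gt0.
exists (hproj l m) => e e0.
set B := cabs l + cabs m + 1.
have B0 : 0 < B by rewrite /B ltr_wpDl// addr_ge0 ?cabs_ge0.
set d := e * nrm2 l m / 2 / B.
have d0 : 0 < d by rewrite !divr_gt0// mulr_gt0.
apply: (@filterS2 _ U) (hl _ d0) (hm _ d0) => i /= h1 h2.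
rewrite eu sdist_hproj// n1 mul1r ltr_pdivrMr// mulrC -ltr_pdivlMr//.
have -> : a i * m - b i * l = (a i - l) * m - (b i - m) * l by ring.
apply: le_lt_trans (cabsB _ _) _; rewrite !cabsM.
have <- : d * B = e * nrm2 l m / 2 by rewrite /d divfK// gt_eqF.
rewrite /B; have := cabs_ge0 l; have := cabs_ge0 m.
have := cabs_ge0 (a i - l); have := cabs_ge0 (b i - m); nra.
Qed.

Lemma ultra_fun_lim (v : I -> S2 -> S2) : exists w, forall z, ulim (v^~ z) (w z).
Proof.
by have [w hw] := choice (fun z => ulim_ex (v^~ z)); exists w.
Qed.

Lemma ulim_le (u : I -> S2) x c (s : R) : ulim u x -> U [set i | sdist c (u i) <= s] ->
  sdist c x <= s.
Proof.
move=> h hs; apply/ler_addgt0Pr => e e0.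
have [i [/= h1 h2]] := ultra_ex (filterI hs (h e e0)).
by apply: le_trans (sdist_triangle (u i) _ _) _; rewrite lerD// ltW.
Qed.

End UltraLimits.

Lemma nat_ultra : exists U : set_system nat, UltraFilter U /\ forall N, U [set n | (N <= n)%N].
Proof.
have [U [UU h]] := @ultraFilterLemma nat \oo _; exists U; split => // N.
by apply: h; exists N.
Qed.

Definition sclosed (K : set S2) := forall x, (forall e : R, 0 < e -> exists2 y, K y & sdist x y < e) -> K x.

Lemma sclosed_ulim (I : Type) (U : set_system I) (UU : UltraFilter U) (u : I -> S2) x K :
  sclosed K -> U [set i | K (u i)] -> ulim U u x -> K x.
Proof.
move=> cK hK h; apply: cK => e e0.
have [i [/= h1 h2]] := ultra_ex (filterI hK (h e e0)).
by exists (u i) => //; rewrite sdistC.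
Qed.

Lemma sclosed_ball c (s : R) : sclosed [set y | sdist c y <= s].
Proof.
move=> x h /=; apply/ler_addgt0Pr => e /h[y /= h1 h2].
apply: le_trans (sdist_triangle y _ _) _; rewrite lerD//.
by rewrite sdistC ltW.
Qed.

Lemma sclosedT : sclosed setT. Proof. by []. Qed.

(** If no finite subfamily covers K, the complements of finite unions generate a filter; a limit
    point in K of a finer ultrafilter lies in no member of the cover. *)
Lemma sclosed_dcompact K : sclosed K -> dcompact sdist K.
Proof.
move=> cK I V oV cov; apply: contrapT => nF.
pose FF : set_system S2 := [set A | exists2 F : set I, finite_set F & K `\` (\bigcup_(i in F) V i) `<=` A].
have PF : ProperFilter FF.
  split; first by move=> [F fF sF]; apply: nF; exists F => // x Kx;
    apply: contrapT => nx; apply: (sF x).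
  split; first by exists set0 => //; exact: finite_set0.
    move=> A B [F fF sF] [F' fF' sF']; exists (F `|` F'); first by rewrite finite_setU.
    move=> x [Kx nx]; split; [apply: sF|apply: sF']; split => // -[i Fi Vi]; apply: nx;
      exists i => //; [by left|by right].
  by move=> A B AB [F fF sF]; exists F => // x /sF/AB.
have [G [UG hG]] := ultraFilterLemma PF.
have [x hx] := ulim_ex (U := G) id.
have Kx : K x.
  apply: (@sclosed_ulim _ G UG id) => //; apply: hG; exists set0; first exact: finite_set0.
  by move=> y [Ky _].
have [i _ Vix] := cov x Kx.
have [s s0 hs] := oV i x Vix.
have Gi : G (K `\` V i).
  apply: hG; exists [set i]; first exact: finite_set1.
  by move=> y [Ky ny]; split => // Vy; apply: ny; exists i.
have [y [[_ ny] hy]] := ultra_ex (filterI Gi (hx s s0)).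
by apply: ny; apply: hs; rewrite /dball /= sdistC.
Qed.

Lemma dcompact_sclosed K : dcompact sdist K -> sclosed K.
Proof.
move=> cK x hx; apply: contrapT => nKx.
have [e e0 he] := dcompact_sep (@sdist_triangle R) sdistC (fun a b h => sdist_eq0 h) (@sdist_ge0 R) cK nKx.
by have [y Ky] := hx e e0; rewrite ltNge he.
Qed.

(** Turns constants found near each point into one constant for K: points violating [Pr] at every
    scale 1 / (n + 1) have a limit in K, where the local constant contradicts them. *)
Lemma compact_uniform (K : set S2) (Pr : S2 -> R -> Prop) : sclosed K ->
  (forall x e e', 0 < e' -> e' <= e -> Pr x e -> Pr x e') ->
  (forall x, K x -> exists2 e : R, 0 < e & forall y, K y -> sdist x y < e -> Pr y e) ->
  exists2 e : R, 0 < e & forall x, K x -> Pr x e.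
Proof.
move=> cK mono loc; apply: contrapT => nP.
have ex n : exists x, K x /\ ~ Pr x n.+1%:R^-1.
  apply: contrapT => /forallNP h; apply: nP; exists n.+1%:R^-1; first by rewrite invr_gt0.
  by move=> x Kx; apply: contrapT => nx; apply: (h x).
have [u hu] := choice ex.
have [U [UU hU]] := nat_ultra.
have [x hx] := ulim_ex (U := U) u.
have Kx : K x.
  by apply: (@sclosed_ulim _ U UU u) => //; apply: filterS (hU 0%N) => n _; have [] := hu n.
have [e e0 he] := loc x Kx.
have [N hN] := inv_natS_small e0.
have [n [/= h1 h2]] := ultra_ex (filterI (hx e e0) (hU N)).
have [Kn nn] := hu n; apply: nn; apply: (mono _ e); rewrite ?invr_gt0 ?ltr0n//.
  by apply/ltW/hN.
by apply: he => //; rewrite sdistC.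
Qed.

(** Pointwise convergence plus equicontinuity gives uniform convergence: points where the bound
    fails would have a limit, at which both hypotheses contradict the failure. *)
Lemma ultra_uniform (I : Type) (U : set_system I) (UU : UltraFilter U) (A : set I)
  (K : set S2) (D : I -> S2 -> R) : sclosed K -> U A ->
  (forall z, K z -> forall e : R, 0 < e -> U [set i | D i z < e]) ->
  (forall z, K z -> forall e : R, 0 < e -> exists2 del : R, 0 < del &
     forall y, K y -> sdist z y < del -> forall i, A i -> D i y < D i z + e) ->
  forall e : R, 0 < e -> U [set i | forall z, K z -> D i z < e].
Proof.
move=> cK UA ptw eqc e e0.
case: (in_ultra_setVsetC [set i | forall z, K z -> D i z < e] UU) => // h.
have ex i : exists z, ~ (forall z, K z -> D i z < e) -> K z /\ ~ (D i z < e).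
  case: (pselect (forall z, K z -> D i z < e)) => [?|/existsNP[z /not_implyP hz]]; last by exists z.
  (* An arbitrary point for the indices at which nothing is violated. *)
  by exists None.
have [u hu] := choice ex.
have [x hx] := ulim_ex (U := U) u.
have Kx : K x.
  by apply: (@sclosed_ulim _ U UU u) => //; apply: filterS h => i /= /hu[].
have e2 : 0 < e / 2 by rewrite divr_gt0.
have [del d0 hd] := eqc x Kx _ e2.
have [i [[/= h1 h2] [/= h3 h4]]] := ultra_ex (filterI (filterI h (ptw x Kx _ e2)) (filterI (hx _ d0) UA)).
have [Ki ni] := hu i h1; exfalso; apply: ni.
have := hd _ Ki _ i h4; rewrite sdistC => /(_ h3) H.
by apply: lt_trans H _; rewrite [e in ltRHS]splitr ltrD2r.
Qed.

End SphereCompactness.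

(** * The transition operator *)

Section MapSpace.
Context {R : realType}.
Local Notation C := (@Cx R).
Local Notation S2 := (@Chat R).
Implicit Types (f g h : S2 -> S2).

Lemma kappa_has_sup f g : has_sup [set sdist (f z) (g z) | z in setT].
Proof.
split; first by exists (sdist (f None) (g None)); exists None.
by exists 2 => _ [z _ <-]; exact: sdist_le2.
Qed.

Lemma kappa_ge f g z : sdist (f z) (g z) <= kappa f g.
Proof. by apply: ub_le_sup; [exact: (kappa_has_sup f g).2|exists z]. Qed.

Lemma kappa_le f g (e : R) : (forall z, sdist (f z) (g z) <= e) -> kappa f g <= e.
Proof.
move=> h; apply: ge_sup; first by exists (sdist (f None) (g None)); exists None.
by move=> _ [z _ <-].
Qed.

Lemma kappa_ge0 f g : 0 <= kappa f g.
Proof. exact: le_trans (sdist_ge0 _ _) (kappa_ge f g None). Qed.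

Lemma kappaxx f : kappa f f = 0.
Proof.
by apply/eqP; rewrite eq_le kappa_ge0 andbT; apply: kappa_le => z; rewrite sdistxx.
Qed.

Lemma kappaC f g : kappa f g = kappa g f.
Proof.
by apply/eqP; rewrite eq_le; apply/andP; split; apply: kappa_le => z;
  rewrite sdistC; apply: kappa_ge.
Qed.

Lemma kappa_triangle g f h : kappa f h <= kappa f g + kappa g h.
Proof.
apply: kappa_le => z; apply: le_trans (sdist_triangle (g z) _ _) _.
by rewrite lerD ?kappa_ge.
Qed.

Lemma kappa_eq0 f g : kappa f g = 0 -> f = g.
Proof.
move=> e; apply/funext => z; apply: sdist_eq0; apply/eqP.
by rewrite eq_le sdist_ge0 andbT -e kappa_ge.
Qed.

End MapSpace.

(** * Integrals of functions that agree off a null set *)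

Section AeIntegral.
Local Open Scope ereal_scope.
Context d (T : measurableType d) (R : realType) (mu : {measure set T -> \bar R}).

Import HBNNSimple.

(** f and g may fail to be measurable, as happens for integrands controlled only on the support of
    tau. So the comparison runs through simple functions below f, cut to 0 on N. *)
Lemma ge0_integral_le_off_null (N : set T) (f g : T -> \bar R) : measurable N -> mu N = 0 ->
  (forall x, 0 <= f x) -> (forall x, 0 <= g x) -> (forall x, ~ N x -> f x = g x) ->
  integral mu setT f <= integral mu setT g.
Proof.
move=> mN N0 f0 g0 fg; rewrite !ge0_integralTE//; apply: ge_ereal_sup => _ /= [h hf <-].
pose h' := proj_nnsfun h (measurableC mN).
have -> : sintegral mu h = sintegral mu h'.
  rewrite -!integralT_nnsfun; apply: ge0_ae_eq_integral => //.
  - by apply/measurable_EFinP.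
  - by apply/measurable_EFinP.
  - by move=> x _; rewrite lee_fin.
  - by move=> x _; rewrite lee_fin.
  - exists N; split => // x /= hx; apply: contrapT => nx; apply: hx => _.
    by rewrite /= /mindic indicE mem_set// mulr1.
apply: ereal_sup_ubound; exists h' => // x.
rewrite /h' /= /mindic indicE; case: (pselect (N x)) => Nx.
  by rewrite memNset ?mulr0//=; apply.
by rewrite mem_set//= mulr1 -fg.
Qed.

Lemma integral_off_null (N : set T) (f g : T -> \bar R) : measurable N -> mu N = 0 ->
  (forall x, ~ N x -> f x = g x) -> integral mu setT f = integral mu setT g.
Proof.
move=> mN N0 fg; rewrite (integralE mu setT f) (integralE mu setT g).
by congr (_ - _); apply/eqP; rewrite eq_le; apply/andP; split;
  apply: (@ge0_integral_le_off_null N) => // x Nx; rewrite ?funeposE ?funenegE fg.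
Qed.

End AeIntegral.

(** * The support of tau and integration over it *)

Section Measure.
Context {R : realType} (tau : probability (@RatSpace R) R).
Local Notation C := (@Cx R).
Local Notation S2 := (@Chat R).
Hypothesis tauK : compactly_supported_on_Rat tau.
Local Notation Gam := (Gamma tau).

Lemma measurable_dopen (O : set (@RatSpace R)) : dopen kappa O -> measurable O.
Proof. by move=> h; apply: sub_sigma_algebra. Qed.

Lemma dopen_kball (f : S2 -> S2) (s : R) : dopen kappa (dball kappa f s).
Proof. by apply: dopen_dball; exact: kappa_triangle. Qed.

Lemma measurable_kball (f : S2 -> S2) (s : R) : measurable (dball kappa f s : set (@RatSpace R)).
Proof. by apply: (@measurable_dopen (dball kappa f s)); exact: dopen_kball. Qed.

Lemma le_kball (f : S2 -> S2) (s : R) (A : set (@RatSpace R)) : measurable A ->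
  dball kappa f s `<=` A -> (tau (dball kappa f s) <= tau A)%E.
Proof. by move=> mA h; apply: le_measure; rewrite ?inE //; exact: measurable_kball. Qed.

Lemma dopen_GamC : dopen kappa (~` Gam).
Proof.
move=> g /existsNP[e /not_implyP[e0 /negP]]; rewrite -leNgt => h.
exists (e / 2); first by rewrite divr_gt0.
move=> f; rewrite /dball /= => hf hG.
have := hG (e / 2); rewrite divr_gt0// => /(_ isT); apply/negP; rewrite -leNgt.
apply: le_trans h; apply: le_kball; first exact: measurable_kball.
move=> k; rewrite /dball /= => hk; apply: le_lt_trans (kappa_triangle f _ _) _.
by rewrite [e]splitr ltrD.
Qed.

Lemma measurable_GamC : measurable (~` Gam : set (@RatSpace R)).
Proof. apply: measurable_dopen; exact: dopen_GamC. Qed.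

Lemma measurable_Gam : measurable (Gam : set (@RatSpace R)).
Proof. by rewrite -[Gam]setCK; apply: measurableC; exact: measurable_GamC. Qed.

Lemma supportK : exists K : set (S2 -> S2), [/\ dcompact kappa K, K `<=` @is_rational R,
  tau (~` K) = 0%E, dopen kappa (~` K) & Gam `<=` K].
Proof.
have [K [cK [Kr K0]]] := tauK.
have oK : dopen kappa (~` K).
  move=> g nKg.
  have [e e0 he] := dcompact_sep kappa_triangle kappaC kappa_eq0 kappa_ge0 cK nKg.
  exists e => // f; rewrite /dball /= => h Kf.
  by have := he f Kf; rewrite leNgt h.
exists K; split => // g Gg; apply: contrapT => nKg.
have [e e0 he] := oK g nKg.
have := Gg e e0; apply/negP; rewrite -leNgt -K0; apply: le_measure => //; rewrite inE.
  exact: measurable_kball.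
exact: measurable_dopen.
Qed.

(** That the support has full measure rests on separability. Finite nets of the compact set K give
    countably many balls, and the null ones among them cover K outside the support. *)
Lemma tau_GamC : tau (~` Gam) = 0%E.
Proof.
have [K [cK Kr K0 oK GK]] := supportK.
apply/negligibleP; first exact: measurable_GamC.
have net n : exists s : seq (@RatSpace R), forall f, K f -> exists2 g, g \in s & kappa g f < n.+1%:R^-1.
  have n0 : 0 < n.+1%:R^-1 :> R by rewrite invr_gt0.
  have [F fF [FK hF]] := dcompact_net kappa_triangle kappaxx n0 cK.
  have /finite_seqP[s es] : finite_set (F : set (@RatSpace R)) by [].
  exists s => f /hF[g Fg h]; exists g => //.
  by have : [set` s] g by rewrite -es.
have [s hs] := choice net.
pose b n i : set (@RatSpace R) := dball kappa (nth (point : RatSpace) (s n) i) n.+1%:R^-1.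
pose B n i := if tau (b n i) == 0%E then b n i else set0.
apply: (@negligibleS _ _ _ tau (~` K `|` \bigcup_n \bigcup_i B n i)).
  move=> f; case: (pselect (K f)) => Kf; last by left.
  move=> /existsNP[e /not_implyP[e0 /negP]]; rewrite -leNgt => h; right.
  have e2 : 0 < e / 2 by rewrite divr_gt0.
  have [n hn] := inv_natS_small e2; exists n => //.
  have [g gs hg] := hs n f Kf.
  exists (index g (s n)) => //.
  have eb : b n (index g (s n)) = dball kappa g n.+1%:R^-1 by rewrite /b nth_index.
  rewrite /B eb ifT//; apply/eqP/eqP; rewrite -measure_le0; apply: le_trans h.
  apply: le_kball; first exact: measurable_kball.
  move=> k; rewrite /dball /= => hk; apply: le_lt_trans (kappa_triangle g _ _) _.
  by move: (hn n (leqnn n)) hg hk; rewrite kappaC; move: (n.+1%:R^-1) => t; lra.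
apply: negligibleU; first by apply/negligibleP => //; apply: measurable_dopen.
apply: negligible_bigcup => n; apply: negligible_bigcup => i; rewrite /B.
case: ifP => [/eqP h|_]; last exact: negligible_set0.
by apply/negligibleP => //; exact: measurable_kball.
Qed.

Lemma Gam_ex : exists g, Gam g.
Proof.
apply: contrapT => /forallNP nG.
have : tau (~` Gam) = 1%E.
  by rewrite (_ : ~` Gam = setT) ?probability_setT//; apply/seteqP; split => // k _; apply: nG.
by rewrite tau_GamC => /eqP; rewrite eqe eq_sym oner_eq0.
Qed.

(** Bounded and continuous on the support only. Off the support h is arbitrary, and [restG] replaces
    it by 0 there without changing the integral. *)
Definition adm (h : (S2 -> S2) -> R) := (exists B : R, forall g, Gam g -> `|h g| <= B) /\
  forall g, Gam g -> forall e : R, 0 < e -> exists2 del : R, 0 < del &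
    forall g', Gam g' -> kappa g g' < del -> `|h g - h g'| < e.

Definition IG (h : (S2 -> S2) -> R) : R := Rintegral tau setT h.

Definition restG (h : (S2 -> S2) -> R) : @RatSpace R -> R := h \_ Gam.

Lemma restGE h g : Gam g -> restG h g = h g.
Proof. by move=> Gg; rewrite /restG patchE mem_set. Qed.

Lemma restGN h g : ~ Gam g -> restG h g = 0.
Proof. by move=> Gg; rewrite /restG patchE memNset. Qed.

Lemma IG_rest h : IG h = Rintegral tau setT (restG h).
Proof.
rewrite /IG /Rintegral; congr fine.
apply: (@integral_off_null _ _ _ tau (~` Gam)); [exact: measurable_GamC|exact: tau_GamC|].
by move=> g /= /contrapT Gg; rewrite restGE.
Qed.

Lemma measurable_restG h : adm h -> measurable_fun setT (restG h).
Proof.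
move=> [_ hc]; apply/(measurable_restrictT _ measurable_Gam).
move=> mG; apply: (measurability _ (RGenOInfty.measurableE R)) => //.
move=> _ [_ [a ->] <-].
(* An open set of maps that meets the support exactly in the preimage of the half-line above a. *)
pose O := [set f : @RatSpace R | exists2 del : R, 0 < del & forall g', Gam g' -> kappa f g' < del -> a < h g'].
rewrite (_ : _ `&` _ = Gam `&` O).
  apply: measurableI; first exact: measurable_Gam.
  apply: measurable_dopen => f [del d0 hd]; exists (del / 2); first by rewrite divr_gt0.
  move=> f'; rewrite /dball /= => hf; exists (del / 2); first by rewrite divr_gt0.
  move=> g' Gg' hg'; apply: hd => //; apply: le_lt_trans (kappa_triangle f' _ _) _.
  by rewrite [del]splitr ltrD.
apply/seteqP; split => g [Gg] /=.
  rewrite in_itv /= andbT => ah; split => //.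
  have [|del d0 hd] := hc g Gg (h g - a); first by rewrite subr_gt0.
  exists del => // g' Gg' hg'; have := hd g' Gg' hg'; rewrite ltr_norml => /andP[_].
  by lra.
move=> [del d0 hd]; split => //=; rewrite in_itv /= andbT; apply: hd => //.
by rewrite kappaxx.
Qed.

Lemma integrable_restG h : adm h -> tau.-integrable setT (EFin \o restG h).
Proof.
move=> ah; have [[B hB] _] := ah.
apply: measurable_bounded_integrable => //.
- by apply: le_lt_trans (probability_le1 tau measurableT) (ltry 1).
- exact: measurable_restG.
- exists B; split; first by rewrite num_real.
  move=> x Bx g _ /=; case: (pselect (Gam g)) => Gg.
    by rewrite restGE//; apply: le_trans (hB g Gg) (ltW Bx).
  rewrite restGN// normr0; apply: le_trans (ltW Bx).
  have [g0 Gg0] := Gam_ex.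
  by apply: le_trans (hB g0 Gg0).
Qed.

Lemma IG_eq h1 h2 : (forall g, Gam g -> h1 g = h2 g) -> IG h1 = IG h2.
Proof.
move=> e; rewrite !IG_rest; congr Rintegral; apply/funext => g.
by case: (pselect (Gam g)) => Gg; [rewrite !restGE ?e|rewrite !restGN].
Qed.

Lemma IG_cst (c : R) : IG (fun=> c) = c.
Proof.
by rewrite /IG /Rintegral integral_cst//= probability_setT mule1.
Qed.

Lemma IG_add h1 h2 : adm h1 -> adm h2 -> IG (fun g => h1 g + h2 g) = IG h1 + IG h2.
Proof.
move=> a1 a2; rewrite !IG_rest -RintegralD//; try exact: integrable_restG.
congr Rintegral; apply/funext => g.
by rewrite /restG patchE; case: ifP => // _; exact/esym/addr0.
Qed.

Lemma IG_scale (c : R) h : adm h -> IG (fun g => c * h g) = c * IG h.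
Proof.
move=> a1; rewrite !IG_rest -RintegralZl//; try exact: integrable_restG.
congr Rintegral; apply/funext => g.
by rewrite /restG patchE; case: ifP => // _; exact/esym/mulr0.
Qed.

Definition pball (g : S2 -> S2) (e : R) : R := fine (tau (dball kappa g e)).

Lemma pball_gt0 g e : Gam g -> 0 < e -> 0 < pball g e.
Proof.
move=> Gg e0; have h := Gg e e0; rewrite /pball fine_gt0// h /=.
by apply: le_lt_trans (probability_le1 _ _) (ltry 1); exact: measurable_kball.
Qed.

Lemma pball_le1 g e : pball g e <= 1.
Proof.
have m : measurable (dball kappa g e : set (@RatSpace R)) by exact: measurable_kball.
rewrite /pball -lee_fin fineK; first exact: probability_le1.
exact: fin_num_measure.
Qed.

(** The source of every probabilistic gain: h is compared with the function equal to B on the ball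
    and to A elsewhere, and the ball has positive measure. *)
Lemma IG_gap h g0 (e A B : R) : adm h -> Gam g0 -> 0 < e -> B <= A ->
  (forall g, Gam g -> h g <= A) -> (forall g, Gam g -> kappa g0 g < e -> h g <= B) ->
  IG h <= A - pball g0 e * (A - B).
Proof.
move=> ah Gg0 e0 BA hA hB.
set b := dball kappa g0 e : set (@RatSpace R).
have mb : measurable b by exact: measurable_kball.
have fb : tau b \is a fin_num by exact: fin_num_measure.
pose k : @RatSpace R -> R := fun g => A + (B - A) * \1_b g.
have ib : tau.-integrable setT (EFin \o (fun g => (B - A) * \1_b g)).
  apply: (@integrableZl _ _ _ tau setT measurableT (B - A) (EFin \o \1_b)).
  exact: integrable_indic.
have ic : tau.-integrable setT (EFin \o (fun g : @RatSpace R => A)).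
  exact: finite_measure_integrable_cst.
have ik : tau.-integrable setT (EFin \o k).
  by apply: eq_integrable (integrableD measurableT ic ib).
have -> : A - pball g0 e * (A - B) = IG k.
  rewrite /IG RintegralD// RintegralZl//; last exact: integrable_indic.
  have -> : Rintegral tau setT (fun=> A) = A by exact: IG_cst.
  by rewrite /Rintegral integral_indic// setIT /pball -/b; ring.
rewrite !IG_rest; apply: le_Rintegral => //; first exact: integrable_restG.
  rewrite /restG -restrict_EFin; apply: (integrable_mkcond _ measurable_Gam).1.
  by apply: (integrableS measurableT measurable_Gam _ ik).
move=> g _; rewrite /restG /patch; case: ifP => // /set_mem Gg; rewrite /k indicE.
case: (pselect (b g)) => bg.
  by rewrite mem_set// mulr1 addrC subrK hB.
by rewrite memNset// mulr0 addr0 hA.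
Qed.

End Measure.

(** * Uniform continuity on closed sets *)

Section UniformContinuity.
Context {R : realType}.
Local Notation C := (@Cx R).
Local Notation S2 := (@Chat R).

(** An abstract D serves complex functions and maps of the sphere alike. *)
Lemma uniform_continuity (K : set S2) (D : S2 -> S2 -> R) : sclosed K ->
  (forall x y z, D y z <= D x y + D x z) ->
  (forall x, K x -> forall e : R, 0 < e -> exists2 del : R, 0 < del &
     forall y, K y -> sdist x y < del -> D x y < e) ->
  forall e : R, 0 < e -> exists2 del : R, 0 < del &
     forall x y, K x -> K y -> sdist x y < del -> D x y < e.
Proof.
move=> cK tri ct e e0.
have [del d0 hd] : exists2 del : R, 0 < del & forall x, K x -> forall y, K y -> sdist x y < del -> D x y < e.
  apply: (@compact_uniform R K (fun x del => forall y, K y -> sdist x y < del -> D x y < e)) => //.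
    by move=> x a b b0 ba h y Ky xy; apply: h => //; apply: lt_le_trans ba.
  move=> x Kx; have e2 : 0 < e / 2 by rewrite divr_gt0.
  have [del d0 hd] := ct x Kx _ e2; exists (del / 2); first by rewrite divr_gt0.
  move=> y Ky xy z Kz yz; apply: le_lt_trans (tri x _ _) _; rewrite [e]splitr.
  apply: ltrD; apply: hd => //; first by apply: lt_trans xy _; lra.
  by apply: le_lt_trans (sdist_triangle y _ _) _; rewrite [del]splitr ltrD.
by exists del => // x y Kx Ky; apply: hd.
Qed.

Lemma cont_bounded (K : set S2) (phi : S2 -> C) : sclosed K -> cont_on K phi ->
  exists2 B : R, 0 < B & forall x, K x -> cabs (phi x) <= B.
Proof.
move=> cK ct.
(* Writing the bound as e^-1 makes the property monotone in e, as [compact_uniform] requires. *)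
have [e e0 he] : exists2 e : R, 0 < e & forall x, K x -> cabs (phi x) <= e^-1.
  apply: (@compact_uniform R K (fun x e => cabs (phi x) <= e^-1)) => //.
    by move=> x a b b0 ba h; apply: le_trans h _; rewrite lef_pV2 ?posrE //; apply: lt_le_trans ba.
  move=> x Kx; have [del d0 hd] := ct x Kx 1 ltr01.
  have c1 : 0 < cabs (phi x) + 1 by rewrite ltr_wpDl ?cabs_ge0.
  exists (Num.min del (cabs (phi x) + 1)^-1); first by rewrite lt_min d0 invr_gt0.
  move=> y Ky; rewrite lt_min => /andP[xy _].
  apply: (@le_trans _ _ (cabs (phi x) + 1)).
    rewrite -(subrK (phi x) (phi y)) addrC; apply: le_trans (cabsD _ _) _.
    by rewrite lerD2l cabsC ltW// hd.
  rewrite -[leLHS]invrK lef_pV2 ?posrE ?lt_min ?d0 ?invr_gt0//.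
  by rewrite ge_min lexx orbT.
by exists e^-1 => //; rewrite invr_gt0.
Qed.

Lemma cont_uniform (K : set S2) (phi : S2 -> C) : sclosed K -> cont_on K phi ->
  forall e : R, 0 < e -> exists2 del : R, 0 < del &
    forall x y, K x -> K y -> sdist x y < del -> cabs (phi x - phi y) < e.
Proof.
move=> cK ct; apply: (@uniform_continuity K (fun x y => cabs (phi x - phi y))) => //.
by move=> x y z; rewrite (cabsC (phi x) (phi y)); apply: cabsBD.
Qed.

Lemma rational_uniform (f : S2 -> S2) : rational_like f ->
  forall e : R, 0 < e -> exists2 del : R, 0 < del &
    forall x y, sdist x y < del -> sdist (f x) (f y) < e.
Proof.
move=> hf e e0.
have [||del d0 hd] := @uniform_continuity setT (fun x y => sdist (f x) (f y)) (@sclosedT R) _ _ e e0.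
- by move=> x y z; rewrite (sdistC (f x) (f y)); apply: sdist_triangle.
- move=> x _ e' e'0; have [del d0 hd] := rational_like_cont x hf e'0.
  by exists del => // y _; apply: hd.
by exists del => // x y; apply: hd.
Qed.

End UniformContinuity.

(** * The operator on continuous functions and random words *)

Section Transition.
Context {R : realType} (tau : probability (@RatSpace R) R).
Local Notation C := (@Cx R).
Local Notation S2 := (@Chat R).
Hypothesis tauK : compactly_supported_on_Rat tau.
Local Notation Gam := (Gamma tau).
Local Notation M := (Mtau tau).
Local Notation cI := (cint tau).

Lemma Gam_rational g : Gam g -> rational_like g.
Proof.
by have [K [_ Kr _ _ GK]] := supportK tauK; move=> /GK/Kr/is_rational_like.
Qed.

Lemma Gtau_rational g : Gtau tau g -> rational_like g.
Proof.
by elim => [h /Gam_rational//|f h _ hf _ hh]; apply: rational_like_comp.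
Qed.

(** The sets [V n] cover the compact set K of maps; the strict inequality e' < e is the room that
    makes them open. *)
Lemma Gam_equicont (e : R) : 0 < e -> exists2 del : R, 0 < del &
  forall g, Gam g -> forall x y, sdist x y < del -> sdist (g x) (g y) < e.
Proof.
move=> e0; have [K [cK Kr _ _ GK]] := supportK tauK.
pose V (n : nat) : set (S2 -> S2) := [set f | exists2 e' : R, e' < e &
  forall x y, sdist x y < n.+1%:R^-1 -> sdist (f x) (f y) <= e'].
have [||F fF hF] := cK nat V.
- move=> n f [e' e'e hf]; exists ((e - e') / 4); first by rewrite divr_gt0// subr_gt0.
  move=> f'; rewrite /dball /= => hff; exists ((e + e') / 2); first by lra.
  move=> x y xy; have h1 := hf x y xy.
  have h2 := kappa_ge f f' x; have h3 := kappa_ge f f' y.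
  have := sdist_triangle (f x) (f' x) (f' y); have := sdist_triangle (f y) (f x) (f' y).
  by rewrite (sdistC (f' x) (f x)); lra.
- move=> f Kf; have e2 : 0 < e / 2 by rewrite divr_gt0.
  have [del d0 hd] := rational_uniform (is_rational_like (Kr f Kf)) e2.
  have [N hN] := inv_natS_small d0; exists N => //; exists (e / 2); first by lra.
  by move=> x y xy; apply/ltW/hd/(lt_trans xy)/hN.
have [N hN] := finite_nat_bounded fF.
exists N.+1%:R^-1; first by rewrite invr_gt0 ltr0n.
move=> g /GK/hF[n Fn [e' e'e hg]] x y xy.
apply: le_lt_trans (hg x y _) e'e; apply: lt_le_trans xy _.
by rewrite lef_pV2 ?posrE ?ltr0n// ler_nat ltnS hN.
Qed.

(** Equicontinuity and Cauchy estimates give one constant at distances up to s / 16; at larger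
    distances the diameter 2 is enough. *)
Lemma Gam_lip : exists2 L : R, 1 <= L &
  forall g, Gam g -> forall x y, sdist (g x) (g y) <= L * sdist x y.
Proof.
have [del d0 hd] := Gam_equicont ltr01.
set s := Num.min del 1.
have s0 : 0 < s by rewrite lt_min d0 ltr01.
have s1 : s <= 1 by rewrite ge_min lexx orbT.
have sd : s <= del by rewrite ge_min lexx.
exists (32 / s); first by rewrite ler_pdivlMr//; lra.
move=> g Gg x y.
have [h|h] := leP (sdist x y) (s / 16).
  have := @rational_lip R g x s 1 (Gam_rational Gg) s0 s1 ler01 (lexx 1) _ x y _ h.
  have h1 : forall z, sdist x z < s -> sdist (g x) (g z) <= 1.
    by move=> z xz; apply/ltW/hd => //; apply: lt_le_trans sd.
  move=> /(_ h1); rewrite sdistxx divr_ge0 ?(ltW s0)// => /(_ isT) h2.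
  apply: le_trans h2 _; rewrite mulr1 ler_wpM2r ?sdist_ge0// ler_wpM2r ?invr_ge0 ?(ltW s0)//.
  by rewrite ler_nat.
apply: le_trans (sdist_le2 _ _) _.
have -> : 2 = 32 / s * (s / 16) by field; rewrite gt_eqF.
by rewrite ler_wpM2l ?(ltW h)// divr_ge0 ?(ltW s0).
Qed.

Lemma adm_add h1 h2 : adm tau h1 -> adm tau h2 -> adm tau (fun g => h1 g + h2 g).
Proof.
move=> [[B1 b1] c1] [[B2 b2] c2]; split.
  by exists (B1 + B2) => g Gg; apply: le_trans (ler_normD _ _) _; rewrite lerD ?b1 ?b2.
move=> g Gg e e0; have e2 : 0 < e / 2 by rewrite divr_gt0.
have [d1 d10 hd1] := c1 g Gg _ e2; have [d2 d20 hd2] := c2 g Gg _ e2.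
exists (Num.min d1 d2); first by rewrite lt_min d10.
move=> g' Gg'; rewrite lt_min => /andP[k1 k2]; rewrite [e]splitr.
have -> : h1 g + h2 g - (h1 g' + h2 g') = (h1 g - h1 g') + (h2 g - h2 g') by ring.
by apply: le_lt_trans (ler_normD _ _) _; rewrite ltrD ?hd1 ?hd2.
Qed.

Lemma adm_scale (c : R) h : adm tau h -> adm tau (fun g => c * h g).
Proof.
move=> [[B b] ct]; split.
  by exists (`|c| * B) => g Gg; rewrite normrM ler_wpM2l// b.
move=> g Gg e e0.
have c1 : 0 < `|c| + 1 by rewrite ltr_wpDl.
have [|d d0 hd] := ct g Gg (e / (`|c| + 1)); first by rewrite divr_gt0.
exists d => // g' Gg' k; rewrite -mulrBr normrM.
have := hd g' Gg' k; rewrite ltr_pdivlMr// => h'; apply: le_lt_trans h'.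
by rewrite mulrC ler_wpM2l// lerDl.
Qed.

Definition admc (F : (S2 -> S2) -> C) := adm tau (fun g => complex.Re (F g)) /\ adm tau (fun g => complex.Im (F g)).

Lemma adm_eq h1 h2 : h1 =1 h2 -> adm tau h1 -> adm tau h2.
Proof. by move=> /funext ->. Qed.

Lemma admc_add F1 F2 : admc F1 -> admc F2 -> admc (fun g => F1 g + F2 g).
Proof.
move=> [a1 b1] [a2 b2]; split; [apply: adm_eq (adm_add a1 a2)|apply: adm_eq (adm_add b1 b2)];
  by move=> g /=; case: (F1 g); case: (F2 g).
Qed.

Lemma admc_scale (c : C) F : admc F -> admc (fun g => c * F g).
Proof.
move=> [a b]; split.
  apply: adm_eq (adm_add (adm_scale (complex.Re c) a) (adm_scale (- complex.Im c) b)).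
  by move=> g; case: c (F g) => c1 c2 [x y] /=; ring.
apply: adm_eq (adm_add (adm_scale (complex.Re c) b) (adm_scale (complex.Im c) a)).
by move=> g; case: c (F g) => c1 c2 [x y] /=; ring.
Qed.

Lemma cI_add F1 F2 : admc F1 -> admc F2 -> cI (fun g => F1 g + F2 g) = cI F1 + cI F2.
Proof.
move=> [a1 b1] [a2 b2]; rewrite /cint; apply/eqP; rewrite eq_complex /=.
rewrite -[Rintegral _ _ _]/(IG tau _) -[X in _ && (X == _)]/(IG tau _).
rewrite -(IG_add tauK a1 a2) -(IG_add tauK b1 b2); apply/andP; split; apply/eqP; congr IG; apply/funext => g;
  by case: (F1 g); case: (F2 g).
Qed.

Lemma cI_scale (c : C) F : admc F -> cI (fun g => c * F g) = c * cI F.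
Proof.
move=> [a b]; rewrite /cint; apply/eqP; rewrite eq_complex /=.
case: c => c1 c2 /=.
have e1 := IG_add tauK (adm_scale c1 a) (adm_scale (- c2) b).
have e2 := IG_add tauK (adm_scale c1 b) (adm_scale c2 a).
rewrite (IG_scale tauK _ a) (IG_scale tauK _ b) in e1.
rewrite (IG_scale tauK _ a) (IG_scale tauK _ b) in e2.
apply/andP; split; apply/eqP.
  rewrite -mulNr -[RHS]e1; congr IG; apply/funext => g; case: (F g) => x y /=; ring.
by rewrite -[RHS]e2; congr IG; apply/funext => g; case: (F g) => x y /=; ring.
Qed.

Lemma cI_eq F1 F2 : (forall g, Gam g -> F1 g = F2 g) -> cI F1 = cI F2.
Proof. by move=> h; rewrite /cint; congr Complex; apply: (IG_eq tauK) => g /h ->. Qed.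

Lemma cI_cst (c : C) : cI (fun=> c) = c.
Proof. by rewrite /cint; case: c => x y /=; congr Complex; apply: IG_cst. Qed.

(** Multiplying F by a constant of modulus 1 makes its integral real and positive, which reduces the
    modulus to the real part and to [IG_gap]. *)
Lemma cI_gap F g0 (e A B : R) : admc F -> Gam g0 -> 0 < e -> 0 <= B -> B <= A ->
  (forall g, Gam g -> cabs (F g) <= A) -> (forall g, Gam g -> kappa g0 g < e -> cabs (F g) <= B) ->
  cabs (cI F) <= A - pball tau g0 e * (A - B).
Proof.
move=> aF Gg0 e0 B0 BA hA hB.
have p1 := @pball_le1 R tau g0 e.
have [e'|n0] := eqVneq (cI F) 0.
  rewrite e' cabs0; nra.
set c : C := ((cI F)^*)%C * ((cabs (cI F))^-1)%:C%C.
have cn : 0 < cabs (cI F) by rewrite cabs_gt0.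
have c1 : cabs c = 1.
  by rewrite cabsM cabs_conj cabs_real ger0_norm ?invr_ge0 ?cabs_ge0// divff// gt_eqF.
have ec : c * cI F = (cabs (cI F))%:C%C.
  by rewrite /c mulrAC conj_mul -rmorphM /= expr2 mulfK// gt_eqF.
have -> : cabs (cI F) = IG tau (fun g => complex.Re (c * F g)).
  by rewrite -[LHS]/(complex.Re ((cabs (cI F))%:C%C)) -ec -cI_scale.
have le g : complex.Re (c * F g) <= cabs (F g).
  by apply: le_trans (Re_le_cabs _) _; rewrite cabsM c1 mul1r.
apply: (IG_gap tauK) => //; first by have [] := admc_scale c aF.
- by move=> g /hA; apply: le_trans.
- by move=> g Gg /(hB g Gg); apply: le_trans.
Qed.

Lemma admc_ev (K : set S2) phi z : sclosed K -> cont_on K phi ->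
  (forall g, Gam g -> K (g z)) -> admc (fun g => phi (g z)).
Proof.
move=> cK ct hK; have [B B0 hB] := cont_bounded cK ct.
split; split.
- by exists B => g Gg; apply: le_trans (absRe_le _) _; apply/hB/hK.
- move=> g Gg e e0; have [d d0 hd] := ct (g z) (hK g Gg) e e0.
  exists d => // g' Gg' k.
  have := hd (g' z) (hK g' Gg') (le_lt_trans (kappa_ge g g' z) k).
  apply: le_lt_trans; rewrite (_ : _ - _ = complex.Re (phi (g z) - phi (g' z))); first exact: absRe_le.
  by case: (phi _); case: (phi _).
- by exists B => g Gg; apply: le_trans (absIm_le _) _; apply/hB/hK.
- move=> g Gg e e0; have [d d0 hd] := ct (g z) (hK g Gg) e e0.
  exists d => // g' Gg' k.
  have := hd (g' z) (hK g' Gg') (le_lt_trans (kappa_ge g g' z) k).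
  apply: le_lt_trans; rewrite (_ : _ - _ = complex.Im (phi (g z) - phi (g' z))); first exact: absIm_le.
  by case: (phi _); case: (phi _).
Qed.

Notation contC := (cont_on setT).

Lemma admc_evT phi z : contC phi -> admc (fun g => phi (g z)).
Proof. by move=> ct; apply: (admc_ev (@sclosedT R) ct). Qed.

Lemma M_gap phi x y g0 (e A B : R) : contC phi -> Gam g0 -> 0 < e -> 0 <= B -> B <= A ->
  (forall g, Gam g -> cabs (phi (g x) - phi (g y)) <= A) ->
  (forall g, Gam g -> kappa g0 g < e -> cabs (phi (g x) - phi (g y)) <= B) ->
  cabs (M phi x - M phi y) <= A - pball tau g0 e * (A - B).
Proof.
move=> ct Gg0 e0 B0 BA hA hB.
have ax := admc_evT x ct; have ay := admc_evT y ct.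
have ay' := admc_scale (-1) ay.
have -> : M phi x - M phi y = cI (fun g => phi (g x) + -1 * phi (g y)).
  by rewrite cI_add// cI_scale// mulN1r.
apply: cI_gap => //; first exact: admc_add.
- by move=> g; rewrite mulN1r; apply: hA.
- by move=> g; rewrite mulN1r; apply: hB.
Qed.

Lemma M_diff_le phi x y A : contC phi -> 
  (forall g, Gam g -> cabs (phi (g x) - phi (g y)) <= A) -> cabs (M phi x - M phi y) <= A.
Proof.
move=> ct h; have [g0 Gg0] := Gam_ex tauK.
have A0 : 0 <= A by apply: le_trans (h g0 Gg0); apply: cabs_ge0.
have := @M_gap phi x y g0 1 A A ct Gg0 ltr01 A0 (lexx A) h (fun g Gg _ => h g Gg).
by rewrite subrr mulr0 subr0.
Qed.

Lemma M_bound phi A : contC phi -> (forall z, cabs (phi z) <= A) -> forall z, cabs (M phi z) <= A.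
Proof.
move=> ct h z; have [g0 Gg0] := Gam_ex tauK.
have A0 : 0 <= A by apply: le_trans (h z); apply: cabs_ge0.
have := @cI_gap (fun g => phi (g z)) g0 1 A A (admc_evT z ct) Gg0 ltr01 A0 (lexx A) (fun g _ => h _) (fun g _ _ => h _).
by rewrite subrr mulr0 subr0.
Qed.

Lemma M_cont phi : contC phi -> contC (M phi).
Proof.
move=> ct x _ e e0.
have e2 : 0 < e / 2 by rewrite divr_gt0.
have [d d0 hd] := cont_uniform (@sclosedT R) ct e2.
have [d' d'0 hd'] := Gam_equicont d0.
exists d' => // y _ xy; apply: (@le_lt_trans _ _ (e / 2)); last by lra.
by apply: M_diff_le => // g Gg; apply/ltW/hd => //; apply: hd'.
Qed.

Lemma M_lin (a b : C) phi psi : contC phi -> contC psi ->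
  M (fun z => a * phi z + b * psi z) = (fun z => a * M phi z + b * M psi z).
Proof.
move=> c1 c2; apply/funext => z; rewrite /Mtau.
have a1 := admc_evT z c1; have a2 := admc_evT z c2.
by rewrite cI_add ?cI_scale//; apply: admc_scale.
Qed.

Lemma contC_lin (a b : C) phi psi : contC phi -> contC psi -> contC (fun z => a * phi z + b * psi z).
Proof.
move=> c1 c2 x _ e e0.
set N := cabs a + cabs b + 1; have N0 : 0 < N by rewrite ltr_wpDl// addr_ge0 ?cabs_ge0.
have e2 : 0 < e / N by rewrite divr_gt0.
have [d1 d10 h1] := c1 x I _ e2; have [d2 d20 h2] := c2 x I _ e2.
exists (Num.min d1 d2); first by rewrite lt_min d10.
move=> y _; rewrite lt_min => /andP[/(h1 y I) k1 /(h2 y I) k2].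
have -> : a * phi x + b * psi x - (a * phi y + b * psi y) = a * (phi x - phi y) + b * (psi x - psi y) by ring.
apply: le_lt_trans (cabsD _ _) _; rewrite !cabsM.
have m1 := ler_wpM2l (cabs_ge0 a) (ltW k1); have m2 := ler_wpM2l (cabs_ge0 b) (ltW k2).
have <- : e / N * N = e by rewrite divfK// gt_eqF.
move: m1 m2 e2; rewrite /N; set t := e / _; lra.
Qed.

Lemma iterM_cont n phi : contC phi -> contC (iter n M phi).
Proof. by move=> ct; elim: n => //= n; apply: M_cont. Qed.

Lemma iterM_bound n phi A : contC phi -> (forall z, cabs (phi z) <= A) -> forall z, cabs (iter n M phi z) <= A.
Proof. by move=> ct h; elim: n => //= n IH; apply: M_bound => //; apply: iterM_cont. Qed.

Lemma iterM_lin n (a b : C) phi psi : contC phi -> contC psi ->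
  iter n M (fun z => a * phi z + b * psi z) = (fun z => a * iter n M phi z + b * iter n M psi z).
Proof.
by move=> c1 c2; elim: n => //= n ->; rewrite M_lin//; apply: iterM_cont.
Qed.

(** Words of length n. The letter g acts first, as the outermost M of [iter n.+1 M] does; the empty
    word is the identity. *)
Fixpoint Gn (n : nat) (v : S2 -> S2) : Prop :=
  if n is n'.+1 then exists g w, [/\ Gam g, Gn n' w & v = w \o g] else v = id.

Lemma Gn_comp n1 n2 v1 v2 : Gn n1 v1 -> Gn n2 v2 -> Gn (n1 + n2) (v2 \o v1).
Proof.
elim: n1 v1 => [v1 -> h2|n1 IH v1 [g [w [Gg hw ->]]] h2]; first exact: h2.
by exists g, (v2 \o w); split => //; apply: IH.
Qed.

Lemma Gn_Gtau n v : Gn n.+1 v -> Gtau tau v.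
Proof.
elim: n v => [v [g [w [Gg /= -> ->]]]|n IH v [g [w [Gg hw ->]]]]; first exact: sg_gen.
by apply: sg_comp; [exact: IH|exact: sg_gen].
Qed.

Lemma iterM_diff_le n phi x y A : contC phi ->
  (forall v, Gn n v -> cabs (phi (v x) - phi (v y)) <= A) -> cabs (iter n M phi x - iter n M phi y) <= A.
Proof.
move=> ct; elim: n x y => [x y h|n IH x y h]; first exact: (h id).
apply: M_diff_le; first exact: iterM_cont.
by move=> g Gg; apply: IH => v hv; apply: (h (v \o g)); exists g, v.
Qed.

(* A functional way of saying that random words of length [n] lead the pair (x, y) into Q
   with probability at least p; no measure on words is needed. *)
Definition word_gap (n : nat) (p : R) (x y : S2) (Q : S2 -> S2 -> Prop) :=
  forall phi A B, contC phi -> 0 <= B -> B <= A ->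
    (forall v, Gn n v -> cabs (phi (v x) - phi (v y)) <= A) ->
    (forall v, Gn n v -> Q (v x) (v y) -> cabs (phi (v x) - phi (v y)) <= B) ->
    cabs (iter n M phi x - iter n M phi y) <= A - p * (A - B).

(** A Markov property: the event aimed at by the first block is that the second block has a gap from
    where the first one ended. *)
Lemma word_gap_comp n1 n2 p1 p2 x y Q : 0 <= p2 <= 1 ->
  word_gap n1 p1 x y (fun x' y' => word_gap n2 p2 x' y' Q) -> word_gap (n1 + n2) (p1 * p2) x y Q.
Proof.
move=> /andP[p20 p21] h phi A B ct B0 BA hA hB; rewrite iterD.
(* The first block is used with B replaced by A - p2 (A - B), the bound guaranteed by the second. *)
have -> : A - p1 * p2 * (A - B) = A - p1 * (A - (A - p2 * (A - B))) by ring.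
apply: h => //; [exact: iterM_cont|nra|nra| |].
- by move=> v hv; apply: iterM_diff_le => // w hw; apply: (hA (w \o v)); apply: Gn_comp.
- move=> v hv; apply => // w hw; first by apply: (hA (w \o v)); apply: Gn_comp.
  by move=> q; apply: (hB (w \o v)) => //; apply: Gn_comp.
Qed.

(** g is a product of letters of the support, and letters near them have positive probability. The
    length n and the probability p depend on g and e, but not on the pair. *)
Lemma word_gap_local g (e : R) : Gtau tau g -> 0 < e -> exists n p, 0 < p <= 1 /\
  forall x y Q, (forall v, Gn n v -> (forall z, sdist (v z) (g z) < e) -> Q (v x) (v y)) ->
    word_gap n p x y Q.
Proof.
move=> hg; elim: hg e => [{}g Gg|f {}g Gf IHf Gg IHg] e e0.
  exists 1%N, (pball tau g e); rewrite pball_gt0// pball_le1; split => // x y Q hQ phi A B ct B0 BA hA hB.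
  have wd k : Gam k -> Gn 1 k by exists k, id.
  apply: M_gap => // k Gk; first by apply: hA; apply: wd.
  move=> hk; apply: hB; first exact: wd.
  apply: hQ; first exact: wd.
  by move=> z; apply: le_lt_trans (kappa_ge k g z) _; rewrite kappaC.
have e2 : 0 < e / 2 by rewrite divr_gt0.
have [d d0 hd] := rational_uniform (Gtau_rational Gf) e2.
have [n2 [p2 [/andP[p20 p21] h2]]] := IHf _ e2.
have [n1 [p1 [/andP[p10 p11] h1]]] := IHg _ d0.
exists (n1 + n2)%N, (p1 * p2); split.
  by rewrite mulr_gt0//= -[leRHS]mulr1 ler_pM// ltW.
move=> x y Q hQ; apply: word_gap_comp; first by rewrite (ltW p20).
apply: h1 => v1 hv1 c1; apply: h2 => v2 hv2 c2.
apply: (hQ (v2 \o v1)); first exact: Gn_comp.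
move=> z /=; apply: le_lt_trans (sdist_triangle (f (v1 z)) _ _) _.
by rewrite [e]splitr ltrD ?c2// hd.
Qed.

(** Further letters preserve Q, so a longer word keeps the gap; this allows one common word length
    for all pairs. *)
Lemma word_gap_ext n p n' p' x y (Q : S2 -> S2 -> Prop) :
  (forall g a b, Gam g -> Q a b -> Q (g a) (g b)) -> 
  word_gap n p x y Q -> (n <= n')%N -> p' <= p -> word_gap n' p' x y Q.
Proof.
move=> Qinv h nn' pp' phi A B ct B0 BA hA hB.
have QG m v a b : Gn m v -> Q a b -> Q (v a) (v b).
  elim: m v a b => [v a b -> //|m IH v a b [g [w [Gg hw ->]]] q] /=.
  exact/IH/Qinv.
rewrite -(subnKC nn') iterD.
apply: (@le_trans _ _ (A - p * (A - B))); last by nra.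
apply: h => //; first exact: iterM_cont.
- move=> v hv; apply: iterM_diff_le => // w hw; apply: (hA (w \o v)).
  by rewrite -(subnKC nn'); apply: Gn_comp.
- move=> v hv q; apply: iterM_diff_le => // w hw; apply: (hB (w \o v)); last exact: (QG _ _ _ _ hw q).
  by rewrite -(subnKC nn'); apply: Gn_comp.
Qed.

End Transition.

(** * Minimal sets and contraction in the Fatou set *)

Section SemigroupBasics.
Context {R : realType}.
Local Notation C := (@Cx R).
Local Notation S2 := (@Chat R).
Variable G : set (S2 -> S2).
Hypothesis Grat : forall g, G g -> rational_like g.
Hypothesis Gcomp : forall f g, G f -> G g -> G (f \o g).

Lemma sclosedI (I : Type) (P : I -> Prop) (F : I -> set S2) : (forall i, P i -> sclosed (F i)) ->
  sclosed [set x | forall i, P i -> F i x].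
Proof.
move=> h x hx i Pi; apply: (h i Pi) => e /hx[y hy xy]; exists y => //; exact: hy.
Qed.

Lemma sclosedU (A B : set S2) : sclosed A -> sclosed B -> sclosed (A `|` B).
Proof.
move=> cA cB x hx; apply: contrapT => /not_orP[nA nB].
have sep (K : set S2) : sclosed K -> ~ K x -> exists2 e : R, 0 < e & forall y, K y -> e <= sdist x y.
  by move=> cK; apply: (dcompact_sep (@sdist_triangle R) (@sdistC R) (@sdist_eq0 R) (@sdist_ge0 R));
    apply: sclosed_dcompact.
have [e1 e10 h1] := sep _ cA nA; have [e2 e20 h2] := sep _ cB nB.
have [|y [Ay|By]] := hx (Num.min e1 e2); first by rewrite lt_min e10.
  by rewrite lt_min ltNge h1.
by rewrite lt_min !ltNge h2// andbF.
Qed.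

Definition orbit_closure (x : S2) : set S2 :=
  [set y | forall e : R, 0 < e -> exists2 g, G g & sdist (g x) y < e].

Lemma orbit_closure_closed x : sclosed (orbit_closure x).
Proof.
move=> y hy e e0; have e2 : 0 < e / 2 by rewrite divr_gt0.
have [z hz yz] := hy _ e2; have [g Gg gz] := hz _ e2.
exists g => //; apply: le_lt_trans (sdist_triangle z _ _) _.
by rewrite [e]splitr ltrD// sdistC.
Qed.

Lemma orbit_closure_inv x : fwd_inv G (orbit_closure x).
Proof.
move=> g Gg y hy e e0; have [d d0 hd] := rational_like_cont y (Grat Gg) e0.
have [k Gk ky] := hy d d0; exists (g \o k); first exact: Gcomp.
by rewrite sdistC; apply: hd; rewrite sdistC.
Qed.

Hypothesis Gex : exists g, G g.

Lemma orbit_closure_nonempty x : orbit_closure x !=set0.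
Proof.
have [g Gg] := Gex; exists (g x) => e e0; exists g => //.
by rewrite sdistxx.
Qed.

(** Zorn's lemma for reverse inclusion; an ultrafilter limit shows that the intersection of a chain
    is not empty. *)
Lemma closed_inv_minimal (E : set S2) : E !=set0 -> sclosed E -> fwd_inv G E ->
  exists2 L, minimal_set G L & L `<=` E.
Proof.
move=> E0 cE iE.
pose T := {K : set S2 | [/\ K !=set0, sclosed K, fwd_inv G K & K `<=` E]}.
pose Rl (K K' : T) : bool := `[< sval K' `<=` sval K >].
have [|||A totA|K hK] := @Zorn T Rl.
- by move=> t; apply/asboolP.
- by move=> r s t /asboolP rs /asboolP st; apply/asboolP; apply: subset_trans rs.
- move=> s t /asboolP st /asboolP ts; apply: eq_sig_hprop => /=; first by move=> ? ? ?; exact: Prop_irrelevance.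
  by apply/seteqP; split.
- have [[K0 AK0]|nA] := pselect (exists K, A K); last first.
    have hE : [/\ E !=set0, sclosed E, fwd_inv G E & E `<=` E] by split.
    exists (exist _ E hE) => s As; exfalso; apply: nA; by exists s.
  pose I := [set x | forall K : T, A K -> sval K x].
  have cI : sclosed I.
    apply: (@sclosedI T A (fun K => sval K)) => K _; by have [] := svalP K.
  have I0 : I !=set0.
    pose FF : set_system S2 := [set B | exists2 K : T, A K & sval K `<=` B].
    have PF : ProperFilter FF.
      split; first by move=> [K AK sK]; have [[x Kx] _ _ _] := svalP K; apply: (sK x).
      split; first by exists K0.
        move=> B B' [K AK sK] [K' AK' sK'].
        case: (totA K K' AK AK') => /asboolP h; [exists K' | exists K] => // x Kx; split;
          [apply/sK/h|apply: sK'|apply: sK|apply/sK'/h] => //.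
      by move=> B B' BB [K AK sK]; exists K => // x /sK/BB.
    have [V [UV hV]] := ultraFilterLemma PF.
    have [x hx] := ulim_ex (U := V) id; exists x => K AK.
    have [_ cK _ _] := svalP K.
    apply: (@sclosed_ulim _ _ V UV id) => //.
    by apply: hV; exists K.
  have hI : [/\ I !=set0, sclosed I, fwd_inv G I & I `<=` E].
    split => //.
      move=> g Gg x Ix K AK; have [_ _ iK _] := svalP K; apply: iK => //; exact: Ix.
    by move=> x /(_ K0 AK0); have [_ _ _] := svalP K0; apply.
  exists (exist _ I hI) => K AK; apply/asboolP => x /=; exact.
case: K hK => K [K0 cK iK KE] hK; exists K => //.
split => //; split; first exact: sclosed_dcompact.
split => // K' K'0 /dcompact_sclosed cK' iK' K'K.
have hK' : [/\ K' !=set0, sclosed K', fwd_inv G K' & K' `<=` E].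
  by split => //; apply: (subset_trans K'K KE).
have := hK (exist _ K' hK') => /(_ _)/(congr1 sval) /=; apply.
exact/asboolP.
Qed.

Lemma minimal_closed L : minimal_set G L -> sclosed L.
Proof. by move=> [_ [/dcompact_sclosed]]. Qed.

Lemma minimal_orbit L x y (e : R) : minimal_set G L -> L x -> L y -> 0 < e ->
  exists2 k, G k & sdist (k x) y < e.
Proof.
move=> mL Lx Ly e0; have [_ [_ [iL minL]]] := mL; have cL := minimal_closed mL.
have oL : orbit_closure x `<=` L.
  move=> z hz; apply: cL => d d0; have [g Gg gz] := hz d d0.
  by exists (g x); [exact: iL|rewrite sdistC].
have := minL _ (orbit_closure_nonempty x) (sclosed_dcompact (@orbit_closure_closed x))
  (@orbit_closure_inv x) oL.
by move=> eL; move: Ly; rewrite -eL => /(_ e e0).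
Qed.

Lemma orbit_near_minimal x (e : R) : 0 < e -> exists L l g,
  [/\ minimal_set G L, L l, G g & sdist (g x) l < e].
Proof.
move=> e0.
have [L mL LO] := closed_inv_minimal (orbit_closure_nonempty x) (@orbit_closure_closed x) (@orbit_closure_inv x).
have [[l Ll] _] := mL; have [g Gg gl] := LO l Ll e e0.
by exists L, l, g.
Qed.

Lemma Fatou_open z : Fatou G z -> exists2 r : R, 0 < r & forall y, sdist z y < r -> Fatou G y.
Proof.
move=> [r r0 hr]; exists r => // y zy; exists (r - sdist z y); first by rewrite subr_gt0.
have sub : dball sdist y (r - sdist z y) `<=` dball sdist z r.
  by move=> x; rewrite /dball /= ltrBrDl; apply: le_lt_trans (sdist_triangle _ _ _).
move=> x /sub Bx e e0; have [d d0 hd] := hr x Bx e e0.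
by exists d => // x' /sub Bx' xx'; apply: hd.
Qed.

Lemma Fatou_equicont z (e : R) : Fatou G z -> 0 < e -> exists2 s : R, 0 < s &
  forall y, sdist z y < s -> forall g, G g -> sdist (g z) (g y) < e.
Proof.
move=> [r r0 hr] e0; have [|d d0 hd] := hr z _ e e0; first by rewrite /dball /= sdistxx.
exists (Num.min d r); first by rewrite lt_min d0.
by move=> y; rewrite lt_min => /andP[zd zr] g Gg; apply: hd.
Qed.

(* The Lipschitz bound comes from Cauchy estimates in charts on a disc of equicontinuity. *)
Lemma Fatou_equilip (K : set S2) : sclosed K -> K `<=` Fatou G ->
  exists C s : R, [/\ 1 <= C, 0 < s, s <= 1 & forall l y y', K l -> sdist l y <= s -> sdist l y' <= s ->
    forall g, G g -> sdist (g y) (g y') <= C * sdist y y'].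
Proof.
move=> cK KF.
have [s s0 hs] : exists2 s : R, 0 < s & forall l, K l -> forall y, sdist l y < s ->
    forall g, G g -> sdist (g l) (g y) <= 1.
  apply: (@compact_uniform R K (fun l s => forall y, sdist l y < s -> forall g, G g -> sdist (g l) (g y) <= 1)) => //.
    by move=> x a b b0 ba h y xy; apply: h; apply: lt_le_trans ba.
  move=> l Kl; have e2 : 0 < 2^-1 :> R by rewrite invr_gt0.
  have [s s0 hs] := Fatou_equicont (KF l Kl) e2; exists (s / 2); first by rewrite divr_gt0.
  move=> l' Kl' ll' y l'y g Gg.
  have h1 : sdist l l' < s by lra.
  have h2 : sdist l y < s by apply: le_lt_trans (sdist_triangle l' _ _) _; lra.
  apply: le_trans (sdist_triangle (g l) _ _) _; rewrite sdistC.
  by have := hs _ h1 g Gg; have := hs _ h2 g Gg; lra.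
set s' := Num.min s 1.
have s'0 : 0 < s' by rewrite lt_min s0 ltr01.
have s'1 : s' <= 1 by rewrite ge_min lexx orbT.
have s's : s' <= s by rewrite ge_min lexx.
exists (16 * 1 / s'), (s' / 16); split.
- by rewrite ler_pdivlMr//; lra.
- by rewrite divr_gt0.
- by lra.
- move=> l y y' Kl ly ly' g Gg; apply: (@rational_lip R g l) => //; first exact: Grat.
  by move=> z lz; apply: hs => //; apply: lt_le_trans s's.
Qed.

End SemigroupBasics.

(** * Approximate left inverses at a point without contraction *)

Section Recurrence.
Context {R : realType}.
Local Notation C := (@Cx R).
Local Notation S2 := (@Chat R).
Variable G : set (S2 -> S2).
Hypothesis Grat : forall g, G g -> rational_like g.
Hypothesis Gcomp : forall f g, G f -> G g -> G (f \o g).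
Hypothesis Gex : exists g, G g.
Variables (L : set S2) (x0 : S2).
Hypothesis mL : minimal_set G L.
Hypothesis Lx0 : L x0.
Variables (K s1 : R).
Hypothesis K1 : 1 <= K.
Hypothesis s10 : 0 < s1.
Hypothesis s11 : s1 <= 1.
Hypothesis GK : forall y y', sdist x0 y <= s1 -> sdist x0 y' <= s1 ->
  forall g, G g -> sdist (g y) (g y') <= K * sdist y y'.

Lemma iter_G p n : G p -> G (iter n.+1 p).
Proof.
move=> Gp; elim: n => [//|n IH].
have -> : iter n.+2 p = p \o iter n.+1 p by [].
exact: Gcomp.
Qed.

Let x0s : sdist x0 x0 <= s1. Proof. by rewrite sdistxx ltW. Qed.

(** Every iterate of p lies in G and so has the same constant K near x0; the drift is therefore
    linear in n. *)
Lemma iter_drift p n : G p -> sdist (p x0) x0 <= s1 ->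
  sdist (iter n p x0) x0 <= n%:R * (K * sdist (p x0) x0).
Proof.
move=> Gp ps; have ps' : sdist x0 (p x0) <= s1 by rewrite sdistC.
elim: n => [|n IH]; first by rewrite sdistxx mul0r.
rewrite iterSr -natr1 mulrDl mul1r addrC; apply: le_trans (sdist_triangle (iter n p x0) _ _) _.
apply: lerD => //; case: n {IH} => [|n] /=.
  by rewrite ler_peMl ?sdist_ge0.
by have := GK ps' x0s (iter_G n Gp).
Qed.

(** By minimality some p n = k n o h almost fix x0. Limits in n and then in the exponent give i < j
    for which the iterates i and j of p n almost agree near x0. Then f is the iterate i, almost
    fixed by the iterate j - i, which has the form k' o h. *)
Lemma almost_return h (e : R) : G h -> 0 < e -> exists f k, [/\ G f, G k,
  forall z, sdist x0 z <= s1 -> sdist (k (h (f z))) (f z) < e & sdist (f x0) x0 < e].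
Proof.
move=> Gh e0; have K0 : 0 < K by apply: lt_le_trans K1.
have [U [UU hU]] := nat_ultra.
have Lh : L (h x0) by have [_ [_ [iL _]]] := mL; apply: iL.
have ex n : exists k, G k /\ sdist (k (h x0)) x0 < n.+1%:R^-1.
  have [|k Gk hk] := minimal_orbit Grat Gcomp Gex mL Lh Lx0 (e := n.+1%:R^-1); first by rewrite invr_gt0.
  by exists k.
have [k hk] := choice ex.
pose p n := k n \o h.
have Gp n : G (p n) by apply: Gcomp => //; have [] := hk n.
have exq i : exists w : S2 -> S2, forall z, ulim U (fun n => iter i (p n) z) (w z).
  exact: (ultra_fun_lim (fun n => iter i (p n))).
have [q hq] := choice exq.
have qlip i y y' : (0 < i)%N -> sdist x0 y <= s1 -> sdist x0 y' <= s1 -> sdist (q i y) (q i y') <= K * sdist y y'.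
  case: i => // i _ ys ys'; apply/ler_addgt0Pr => d d0.
  have d2 : 0 < d / 2 by rewrite divr_gt0.
  have [n [/= h1 h2]] := ultra_ex (filterI (hq i.+1 y _ d2) (hq i.+1 y' _ d2)).
  have := GK ys ys' (iter_G i (Gp n)).
  have := sdist_triangle (iter i.+1 (p n) y) (q i.+1 y) (q i.+1 y').
  have := sdist_triangle (iter i.+1 (p n) y') (iter i.+1 (p n) y) (q i.+1 y').
  by move: h1; rewrite sdistC /=; lra.
have e4 : 0 < e / 4 by rewrite divr_gt0.
have cB := @sclosed_ball R x0 s1.
have [qq hqq] := ultra_fun_lim (U := U) q.
have Uq : U [set i | forall z, [set y | sdist x0 y <= s1] z -> sdist (q i z) (qq z) < e / 4].
  apply: (@ultra_uniform R _ U UU [set i | (1 <= i)%N] _ (fun i z => sdist (q i z) (qq z))) => //.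
    by move=> z _ d d0; exact: hqq.
  move=> z zs d d0; exists (d / 4 / K); first by rewrite !divr_gt0.
  move=> y ys zy i i1; have qi := qlip i y z i1 ys zs.
  have qqy : sdist (qq y) (qq z) <= K * sdist y z.
    apply/ler_addgt0Pr => t t0; have t2 : 0 < t / 2 by rewrite divr_gt0.
    have [j [[/= h1 h2] h3]] := ultra_ex (filterI (filterI (hqq y _ t2) (hqq z _ t2)) (hU 1%N)).
    have := qlip j y z h3 ys zs.
    have := sdist_triangle (q j y) (qq y) (qq z).
    have := sdist_triangle (q j z) (q j y) (qq z).
    by move: h1; rewrite sdistC; lra.
  move: zy; rewrite ltr_pdivlMr// sdistC => zy.
  have := sdist_triangle (q i z) (q i y) (qq y).
  have := sdist_triangle (qq z) (q i z) (qq y).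
  by rewrite (sdistC (qq z) (qq y)); lra.
have [i [hi i1]] := ultra_ex (filterI Uq (hU 1%N)).
have [j [hj ij]] := ultra_ex (filterI Uq (hU i.+1)).
have pt l : (1 <= l)%N -> U [set n | forall z, [set y | sdist x0 y <= s1] z -> sdist (iter l (p n) z) (q l z) < e / 4].
  move=> l1; apply: (@ultra_uniform R _ U UU setT _ (fun n z => sdist (iter l (p n) z) (q l z))) => //.
  - exact: filterT.
  - by move=> z _ d d0; exact: hq.
  - move=> z zs d d0; exists (d / 4 / K); first by rewrite !divr_gt0.
    move=> y ys zy n _; have ql := qlip l y z l1 ys zs.
    case: l l1 ql => // l _ ql.
    have pl := GK ys zs (iter_G l (Gp n)).
    move: zy; rewrite ltr_pdivlMr// sdistC => zy.
    have := sdist_triangle (iter l.+1 (p n) z) (iter l.+1 (p n) y) (q l.+1 y).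
    have := sdist_triangle (q l.+1 z) (iter l.+1 (p n) z) (q l.+1 y).
    by rewrite (sdistC (q l.+1 z) (q l.+1 y)); move: pl => /=; lra.
(* Once i is known, p n must move x0 so little that i steps of drift stay below e / 2. *)
set d := Num.min s1 (e / (2 * (i%:R * K))).
have iK : 0 < i%:R * K by rewrite mulr_gt0// ltr0n.
have d0 : 0 < d by rewrite lt_min s10 divr_gt0// mulr_gt0.
have [N hN] := inv_natS_small d0.
have j1 : (1 <= j)%N by apply: leq_trans ij.
have [n [[h1 h2] h3]] := ultra_ex (filterI (filterI (pt i i1) (pt j j1)) (hU N)).
have pn : sdist (p n x0) x0 < d by apply: lt_trans (hN n h3); have [] := hk n.
exists (iter i (p n)).
have [k' [Gk' hk']] : exists k', G k' /\ iter (j - i) (p n) = k' \o h.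
  have : (0 < j - i)%N by rewrite subn_gt0.
  case: (j - i)%N => // -[|m] _; first by exists (k n); split => //; have [] := hk n.
  exists (iter m.+1 (p n) \o k n); split; first by apply: Gcomp; [exact: iter_G|have [] := hk n].
  by apply/funext => z; rewrite iterSr.
exists k'; split => //.
- by case: (i) i1 => // i' _; apply: iter_G.
- move=> z zs.
  have -> : k' (h (iter i (p n) z)) = iter j (p n) z.
    by rewrite -[LHS]/((k' \o h) _) -hk' -iterD subnK// ltnW.
  have a1 := h1 z zs; have a2 := h2 z zs; have a3 := hi z zs; have a4 := hj z zs.
  have := sdist_triangle (q j z) (iter j (p n) z) (iter i (p n) z).
  have := sdist_triangle (qq z) (q j z) (iter i (p n) z).
  have := sdist_triangle (q i z) (qq z) (iter i (p n) z).
  by rewrite (sdistC (qq z) (q i z)) (sdistC (q i z) (iter i (p n) z)); move: a1 a2 a3 a4 => /=; lra.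
- have [ds de] : d <= s1 /\ d <= e / (2 * (i%:R * K)) by rewrite /d !ge_min !lexx orbT.
  have := iter_drift i (Gp n) (le_trans (ltW pn) ds); rewrite mulrA => H; apply: le_lt_trans H _.
  have H2 : i%:R * K * sdist (p n x0) x0 <= i%:R * K * d by rewrite ler_pM2l// ltW.
  apply: le_lt_trans H2 _; apply: (@le_lt_trans _ _ (e / 2)); last by rewrite ltr_pdivrMr// ltr_pMr// ltr1n.
  have iK2 : 0 < 2 * (i%:R * K) by exact: mulr_gt0.
  move: de; rewrite !ler_pdivlMr// => de'; apply: le_trans de'.
  by rewrite le_eqVlt; apply/orP; left; apply/eqP; ring.
Qed.

Variable c : R.
Hypothesis c0 : 0 < c.
Hypothesis noncontr : forall s, 0 < s -> s <= 1 -> forall g, G g ->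
  exists2 y, sdist x0 y < s & c * s < sdist (g x0) (g y).

(** In the limit, E = lim k o h fixes the values near x0 of F = lim f. Without contraction F is not
    constant near x0, so fixed points of E accumulate at x0 and the identity theorem makes E the
    identity on a disc. *)
Lemma return_id h : G h -> exists2 s : R, 0 < s & forall e : R, 0 < e -> exists2 k, G k &
  forall z, sdist x0 z <= s -> sdist (k (h z)) z < e.
Proof.
move=> Gh; have K0 : 0 < K by apply: lt_le_trans K1.
have [U [UU hU]] := nat_ultra.
have ex m : exists fk : (S2 -> S2) * (S2 -> S2), [/\ G fk.1, G fk.2,
  forall z, sdist x0 z <= s1 -> sdist (fk.2 (h (fk.1 z))) (fk.1 z) < m.+1%:R^-1 & sdist (fk.1 x0) x0 < m.+1%:R^-1].
  have m0 : 0 < m.+1%:R^-1 :> R by rewrite invr_gt0.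
  by have [f [k ?]] := almost_return Gh m0; exists (f, k).
have [fk hfk] := choice ex.
pose f m := (fk m).1; pose k m := (fk m).2; pose ee m := k m \o h.
have Gf m : G (f m) by have [] := hfk m.
have Gk m : G (k m) by have [] := hfk m.
have Ge m : G (ee m) by apply: Gcomp.
have small (d : R) : 0 < d -> U [set m | m.+1%:R^-1 < d].
  move=> d0; have [N hN] := inv_natS_small d0.
  by apply: filterS (hU N) => m; exact: hN.
have [F hF] := ultra_fun_lim (U := U) f.
have [E hE] := ultra_fun_lim (U := U) ee.
have limlip (v : nat -> S2 -> S2) w : (forall m, G (v m)) -> (forall z, ulim U (v^~ z) (w z)) ->
    forall y y', sdist x0 y <= s1 -> sdist x0 y' <= s1 -> sdist (w y) (w y') <= K * sdist y y'.
  move=> Gv hv y y' ys ys'; apply/ler_addgt0Pr => d d0.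
  have d2 : 0 < d / 2 by rewrite divr_gt0.
  have [n [/= h1 h2]] := ultra_ex (filterI (hv y _ d2) (hv y' _ d2)).
  have := GK ys ys' (Gv n).
  have := sdist_triangle (v n y) (w y) (w y').
  have := sdist_triangle (v n y') (v n y) (w y').
  by move: h1; rewrite sdistC; lra.
have Flip := limlip f F Gf hF; have Elip := limlip ee E Ge hE.
have Fx0 : F x0 = x0.
  apply: sdist_eq0; apply/eqP; rewrite eq_le sdist_ge0 andbT; apply/ler_addgt0Pr => d d0; rewrite add0r.
  have d2 : 0 < d / 2 by rewrite divr_gt0.
  have [m [/= h1 h2]] := ultra_ex (filterI (hF x0 _ d2) (small _ d2)).
  have [_ _ _ h3] := hfk m; rewrite -/(f m) in h3.
  have := sdist_triangle (f m x0) (F x0) x0.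
  move: (m.+1%:R^-1) h2 h3 => t; rewrite sdistC in h1; lra.
(* This radius puts F z within s1 / 2 of x0, so that f m z, close to F z, stays in the ball where G
   is K-Lipschitz. *)
have EF z : sdist x0 z <= s1 / (2 * K) -> E (F z) = F z.
  move=> zs; have zs1 : sdist x0 z <= s1.
    by apply: le_trans zs _; rewrite ler_pdivrMr ?mulr_gt0// ler_peMr ?(ltW s10)//; have := K1; lra.
  have Fz : sdist x0 (F z) <= s1 / 2.
    rewrite -{1}Fx0; apply: le_trans (Flip _ _ x0s zs1) _.
    move: zs; rewrite ler_pdivlMr ?mulr_gt0//; lra.
  apply: sdist_eq0; apply/eqP; rewrite eq_le sdist_ge0 andbT; apply/ler_addgt0Pr => d d0; rewrite add0r.
  set t := Num.min (s1 / 2) (d / 4 / K).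
  have t0 : 0 < t by rewrite lt_min !divr_gt0.
  have d4 : 0 < d / 4 by rewrite divr_gt0.
  have [m [[/= h1 h2] h3]] := ultra_ex (filterI (filterI (hF z _ t0) (hE (F z) _ d4)) (small _ d4)).
  have [_ _ h4 _] := hfk m; have {}h4 := h4 z zs1; rewrite -/(f m) -/(k m) -[k m _]/(ee m _) in h4.
  have [ts td] : t <= s1 / 2 /\ t <= d / 4 / K by rewrite /t !ge_min !lexx orbT.
  have Fm : sdist x0 (f m z) <= s1.
    apply: le_trans (sdist_triangle (F z) _ _) _; rewrite (sdistC (F z)); lra.
  have Fz1 : sdist x0 (F z) <= s1 by lra.
  have h5 := GK Fz1 Fm (Ge m).
  have := sdist_triangle (ee m (F z)) (E (F z)) (F z).
  have := sdist_triangle (ee m (f m z)) (ee m (F z)) (F z).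
  have := sdist_triangle (f m z) (ee m (f m z)) (F z).
  rewrite (sdistC (F z)) in h5; rewrite sdistC in h2.
  have : K * sdist (f m z) (F z) <= d / 4.
    by rewrite mulrC -ler_pdivlMr//; apply: ltW; apply: lt_le_trans td.
  have : t <= d / 4 by apply: le_trans td _; rewrite ler_pdivrMr// ler_peMr// ltW.
  have := lt_trans h4 h3; lra.
have Ex0 : E x0 = x0.
  by rewrite -{1}Fx0 EF ?Fx0// sdistxx divr_ge0 ?mulr_ge0 ?(ltW s10) ?(ltW K0).
(* The witnesses of non-contraction depend on m but share the displacement c s, so their limit y'
   has F y' different from x0. *)
have fixpt (d : R) : 0 < d -> exists y, [/\ y <> x0, sdist x0 y < d & E y = y].
  move=> d0; set s := Num.min (s1 / (2 * K)) (d / (2 * K)).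
  have s0 : 0 < s by rewrite lt_min !divr_gt0 ?mulr_gt0.
  have [ss sd] : s <= s1 / (2 * K) /\ s <= d / (2 * K) by rewrite /s !ge_min !lexx orbT.
  have ss1 : s <= s1 by apply: le_trans ss _; rewrite ler_pdivrMr ?mulr_gt0// ler_peMr ?(ltW s10)//; have := K1; lra.
  have exy m : exists y, sdist x0 y < s /\ c * s < sdist (f m x0) (f m y).
    by have [y h1 h2] := noncontr s0 (le_trans ss1 s11) (Gf m); exists y.
  have [y hy] := choice exy; have [y' hy'] := ulim_ex (U := U) y.
  have y's : sdist x0 y' <= s.
    apply: (ulim_le hy'); apply: filterS (filterT : U setT) => m _ /=; apply: ltW.
    by have [] := hy m.
  have y's1 : sdist x0 y' <= s1 by apply: le_trans ss1.
  exists (F y'); split.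
  - move=> Fy.
    have cs4 : 0 < c * s / 4 by rewrite divr_gt0 ?mulr_gt0.
    have cs4K : 0 < c * s / 4 / K by rewrite divr_gt0.
    have [m [[/= h1 h2] h3]] := ultra_ex (filterI (filterI (hF y' _ cs4) (hF x0 _ cs4)) (hy' _ cs4K)).
    have [h4 h5] := hy m.
    have ym : sdist x0 (y m) <= s1 by apply: le_trans (ltW h4) ss1.
    have h6 := GK ym y's1 (Gf m).
    rewrite Fy in h1; rewrite Fx0 in h2.
    move: h3; rewrite ltr_pdivlMr// => h3.
    have := sdist_triangle x0 (f m x0) (f m y').
    have := sdist_triangle (f m y') (f m x0) (f m (y m)).
    rewrite (sdistC (f m y') (f m (y m))) (sdistC x0 (f m y')); lra.
  - rewrite -{1}Fx0; apply: le_lt_trans (Flip _ _ x0s y's1) _.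
    have : s * (2 * K) <= d by rewrite -ler_pdivlMr ?mulr_gt0.
    have : K * sdist x0 y' <= K * s by rewrite ler_pM2l.
    by move=> *; lra.
  - by apply: EF; apply: le_trans y's ss.
have Uunif (e : R) : 0 < e -> U [set m | forall z, [set y | sdist x0 y <= s1] z -> sdist (ee m z) (E z) < e].
  apply: (@ultra_uniform R _ U UU setT _ (fun m z => sdist (ee m z) (E z))).
  - exact: sclosed_ball.
  - exact: filterT.
  - by move=> z _ d d0; exact: hE.
  - move=> z zs d d0; exists (d / 4 / K); first by rewrite !divr_gt0.
    move=> y ys zy m _.
    have pl := GK ys zs (Ge m); have pE := Elip _ _ ys zs.
    move: zy; rewrite ltr_pdivlMr// sdistC => zy.
    have := sdist_triangle (ee m z) (ee m y) (E y).
    have := sdist_triangle (E z) (ee m z) (E y).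
    by rewrite (sdistC (E z) (E y)); lra.
(* On the chart disc of radius s the maps are K-Lipschitz and move points by at most 1 / 2 from the
   image of x0, hence their values stay in the unit chart at x0. *)
set s := Num.min (s1 / 2) (1 / (4 * K)).
have s0 : 0 < s by rewrite lt_min !divr_gt0 ?mulr_gt0.
have [ss sK] : s <= s1 / 2 /\ s <= 1 / (4 * K) by rewrite /s !ge_min !lexx orbT.
have sK' : K * (2 * s) <= 2^-1.
  by move: sK; rewrite ler_pdivlMr ?mulr_gt0//; move: (s) => t; lra.
have s_le1 : s <= 1 by apply: le_trans ss _; have := s11; lra.
have disc z : cabs z <= s -> sdist x0 (srot x0 (Some z)) <= 2 * s.
  move=> zs; rewrite -{1}(srot_origin x0) sdist_rot; apply: le_trans (sdist_origin_le _) _.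
  by rewrite ler_pM2l.
have disc1 z : cabs z <= s -> sdist x0 (srot x0 (Some z)) <= s1.
  by move=> /disc h1; move: ss h1; move: (s) => t; lra.
have UA : U [set m | sdist (ee m x0) x0 < 2^-1].
  by have := hE x0; rewrite Ex0; apply; rewrite invr_gt0.
have hEd z : cabs z <= s -> sdist x0 (E (srot x0 (Some z))) <= 1.
  move=> zs; rewrite -{1}Ex0; apply: le_trans (Elip _ _ x0s (disc1 z zs)) _.
  have : K * sdist x0 (srot x0 (Some z)) <= K * (2 * s) by rewrite ler_pM2l// disc.
  by move: sK'; move: (K * (2 * s)) => t; lra.
have hed m : sdist (ee m x0) x0 < 2^-1 -> forall z, cabs z <= s -> sdist x0 (ee m (srot x0 (Some z))) <= 1.
  move=> hm z zs; apply: le_trans (sdist_triangle (ee m x0) _ _) _; rewrite sdistC.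
  have := GK x0s (disc1 z zs) (Ge m).
  have : K * sdist x0 (srot x0 (Some z)) <= K * (2 * s) by rewrite ler_pM2l// disc.
  by move: sK'; move: (K * (2 * s)) => t; lra.
pose Ez := chart_map x0 x0 E.
have EzE z : cabs z <= s -> E (srot x0 (Some z)) = srot x0 (Some (Ez z)) /\ cabs (Ez z) <= 1.
  move=> /hEd/unrot_chart[w [ew w1 _]].
  by rewrite /Ez /chart_map ew srotK.
have Eapp : papprox s Ez.
  apply: papprox_uniform => e e0.
  have [m [hm hmE]] := ultra_ex (filterI UA (Uunif e e0)).
  have [a1 a2 a3] := chart_mapP (Grat (Ge m)) s0 (lexx 1) (hed m hm).
  exists (chart_map x0 x0 (ee m)) => // z zs.
  have [e1 e2] := EzE z zs.
  have /andP[h1 _] := sdist_rot_disc x0 e2 (a2 z zs).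
  apply: le_trans h1 _; rewrite -e1 -a3// sdistC; apply/ltW/hmE.
  exact: disc1.
have Eid z : cabs z <= s / 2 -> Ez z - z = 0.
  apply: (@papprox_ident R s 2 (fun z => Ez z - z)) => //.
  - move=> e e0; have [P hP] := Eapp e e0; exists (P - 'X) => w ws.
    by rewrite !hornerE (_ : _ - _ = Ez w - P.[w]) ?hP//; ring.
  - move=> w ws; have [_ h1] := EzE w ws; apply: le_trans (cabsB _ _) _.
    by move: s_le1 ws h1; move: (s) => t; lra.
  - move=> d d0; have [|y [y0 yd Ey]] := fixpt (Num.min d 1); first by rewrite lt_min d0 ltr01.
    move: yd; rewrite lt_min => /andP[yd y1].
    have [w [ew w1 /andP[wd _]]] := unrot_chart (ltW y1).
    exists w; split.
    + by apply/eqP => w0; apply: y0; rewrite ew w0 -[RHS](srot_origin x0).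
    + exact: le_lt_trans wd yd.
    + by rewrite /Ez /chart_map -ew Ey ew srotK /= subrr.
exists (s / 2); first by rewrite divr_gt0.
move=> e e0; have [m hm] := ultra_ex (Uunif e e0); exists (k m) => // z zs.
have z1 : sdist x0 z <= 1 by apply: le_trans zs _; move: s_le1 s0; move: (s) => t; lra.
have [w [ew w1 /andP[wd _]]] := unrot_chart z1.
have ws2 : cabs w <= s / 2 by apply: le_trans wd zs.
have ws : cabs w <= s by move: s0 ws2; move: (s) => t; lra.
have Ez' : E z = z.
  by rewrite ew (EzE w ws).1; congr (srot x0 (Some _)); apply/eqP; rewrite -subr_eq0 Eid.
have := hm z; rewrite Ez'; apply => /=.
by rewrite ew; apply: disc1.
Qed.

End Recurrence.

(** * Paths on the sphere and propagation of closeness to the identity *)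

Section Paths.
Context {R : realType}.
Local Notation C := (@Cx R).
Local Notation S2 := (@Chat R).

(** Connectedness of [0, T]: the supremum of the initial segments on which P holds can be passed
    unless it is T. *)
Lemma real_connected (T : R) (P : R -> Prop) : 0 <= T ->
  (forall t, 0 <= t <= T -> exists2 d : R, 0 < d & forall s s', 0 <= s <= T -> 0 <= s' <= T ->
     `|s - t| < d -> `|s' - t| < d -> P s -> P s') -> P 0 -> P T.
Proof.
move=> T0 loc P0.
pose A := [set t : R | 0 <= t <= T /\ forall s, 0 <= s <= t -> P s].
have A0 : A 0.
  split; first by rewrite lexx.
  by move=> s s0; have -> : s = 0 by apply/eqP; rewrite eq_le andbC.
have hA : has_sup A by split; [exists 0|exists T => t [/andP[]]].
have sA t : A t -> t <= sup A by move=> At; apply: ub_le_sup => //; exact: hA.2.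
have s0 : 0 <= sup A by exact: sA.
have sT : sup A <= T by apply: ge_sup; [exists 0|move=> t [/andP[]]].
have [d d0 hd] := loc (sup A) (introT andP (conj s0 sT)).
have [a Aa ha] := sup_adherent d0 hA.
have a_le := sA a Aa; have [/andP[a0 aT] Pa] := Aa.
have Paa : P a by apply: Pa; rewrite a0 lexx.
have ad : `|a - sup A| < d by rewrite ler0_norm ?subr_le0//; lra.
have near s : 0 <= s <= T -> `|s - sup A| < d -> P s.
  by move=> sT' sd; apply: (hd a) => //; rewrite a0.
set u := Num.min T (sup A + d / 2).
have u0 : 0 <= u by rewrite le_min T0 addr_ge0// divr_ge0// ltW.
have uT : u <= T by rewrite ge_min lexx.
have Au : A u.
  split; first by rewrite u0.
  move=> s /andP[s_0 su]; have [sa|sa] := leP s a; first by apply: Pa; rewrite s_0.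
  have ud : u <= sup A + d / 2 by rewrite ge_min lexx orbT.
  apply: near; first by rewrite s_0 (le_trans su uT).
  by rewrite ltr_norml; apply/andP; split; lra.
have := sA u Au; rewrite /u ge_min => /orP[h|]; last by move: d0; move: (sup A) => z; lra.
have e : u = T by rewrite /u min_l//; apply: le_trans h _; rewrite lerDl divr_ge0// ltW.
by have [_] := Au; apply; rewrite e T0 lexx.
Qed.

(* The path is the complex line segment between lifts to C^2 of the two endpoints. *)
Lemma sphere_path (x y : S2) : x <> y -> exists (gam : R -> S2) (K : R),
  [/\ gam 0 = x, gam 1 = y, 0 < K &
    forall t t', 0 <= t <= 1 -> 0 <= t' <= 1 -> sdist (gam t) (gam t') <= K * `|t - t'|].
Proof.
move=> xy.
pose a := lift1 x; pose b := lift2 x; pose c := lift1 y; pose d := lift2 y.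
pose w := cabs (a * d - b * c).
have w0 : 0 < w.
  rewrite /w cabs_gt0; apply/eqP => /eqP; rewrite subr_eq0 => /eqP e; apply: xy.
  by rewrite -[x]hproj_lift -[y]hproj_lift; apply: hproj_eq => //; exact: nz2_lift.
pose u (t : R) : C := (1 - t)%:C%C * a + t%:C%C * c.
pose v (t : R) : C := (1 - t)%:C%C * b + t%:C%C * d.
have CS (p q p' q' : C) : cabs (p * q' - q * p') <= nrm2 p q * nrm2 p' q'.
  apply: le_trans (cabsB _ _) _; rewrite !cabsM.
  rewrite -(ler_pXn2r (n:=2))// ?nnegrE ?addr_ge0 ?mulr_ge0 ?cabs_ge0 ?nrm2_ge0//.
  rewrite exprMn !nrm2_sq -subr_ge0.
  have -> : (cabs p ^+ 2 + cabs q ^+ 2) * (cabs p' ^+ 2 + cabs q' ^+ 2) -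
      (cabs p * cabs q' + cabs q * cabs p') ^+ 2 = (cabs p * cabs p' - cabs q * cabs q') ^+ 2 by ring.
  exact: sqr_ge0.
pose N := nrm2 a b + nrm2 c d.
have Na : nrm2 a b <= N by rewrite lerDl nrm2_ge0.
have Nc : nrm2 c d <= N by rewrite lerDr nrm2_ge0.
have N0 : 0 < N by apply: lt_le_trans Na; rewrite nrm2_gt0 nz2_lift.
(* At each t the wedge of the lift with one of the two endpoints has modulus at least w / 2, so the
   lift stays away from 0. *)
pose mu := w / 2 / N.
have mu0 : 0 < mu by rewrite !divr_gt0.
have lowN t : 0 <= t <= 1 -> mu <= nrm2 (u t) (v t).
  move=> /andP[t0 t1]; rewrite /mu ler_pdivrMr//.
  have h1 := CS (u t) (v t) a b; have h2 := CS (u t) (v t) c d.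
  have e1 : cabs (u t * b - v t * a) = t * w.
    rewrite (_ : _ - _ = - (t%:C%C * (a * d - b * c))); last by rewrite /u /v; ring.
    by rewrite cabsN cabsM cabs_real ger0_norm.
  have e2 : cabs (u t * d - v t * c) = (1 - t) * w.
    rewrite (_ : _ - _ = ((1 - t)%:C%C * (a * d - b * c))); last by rewrite /u /v; ring.
    by rewrite cabsM cabs_real ger0_norm// subr_ge0.
  have h3 : nrm2 (u t) (v t) * nrm2 a b <= nrm2 (u t) (v t) * N by rewrite ler_wpM2l ?nrm2_ge0.
  have h4 : nrm2 (u t) (v t) * nrm2 c d <= nrm2 (u t) (v t) * N by rewrite ler_wpM2l ?nrm2_ge0.
  rewrite e1 in h1; rewrite e2 in h2.
  have [th|th] := leP t (2^-1).
    by apply: le_trans (le_trans h2 h4); rewrite mulrC ler_pM2r//; lra.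
  by apply: le_trans (le_trans h1 h3); rewrite mulrC ler_pM2r//; lra.
have nz t : 0 <= t <= 1 -> nz2 (u t) (v t).
  by move=> /lowN h; rewrite -nrm2_gt0; apply: lt_le_trans h.
exists (fun t => hproj (u t) (v t)), (2 * w / (mu * mu)); split.
- by rewrite /u /v subr0 !mul1r !mul0r !addr0 hproj_lift.
- by rewrite /u /v subrr !mul1r !mul0r !add0r hproj_lift.
- by apply: divr_gt0; apply: mulr_gt0.
move=> t t' ht ht'; rewrite sdist_hproj ?nz//.
have -> : cabs (u t * v t' - v t * u t') = `|t - t'| * w.
  rewrite (_ : _ - _ = (t' - t)%:C%C * (a * d - b * c)); last first.
    by rewrite /u /v !rmorphB /= rmorph1; ring.
  by rewrite cabsM cabs_real distrC.
have n1 := lowN t ht; have n2 := lowN t' ht'.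
rewrite ler_pdivrMr ?mulr_gt0 ?(lt_le_trans mu0)//.
have : mu * mu <= nrm2 (u t) (v t) * nrm2 (u t') (v t') by apply: ler_pM => //; exact: ltW.
move=> h.
have -> : 2 * w / (mu * mu) * `|t - t'| * (nrm2 (u t) (v t) * nrm2 (u t') (v t')) =
  2 * (`|t - t'| * w) * ((nrm2 (u t) (v t) * nrm2 (u t') (v t')) / (mu * mu)).
  by field; rewrite gt_eqF.
apply: ler_peMr; first by rewrite !mulr_ge0 ?(ltW w0).
by rewrite ler_pdivlMr ?mul1r//; apply: mulr_gt0.
Qed.

Definition near_id (v : nat -> S2 -> S2) (z : S2) := exists2 s : R, 0 < s &
  forall e : R, 0 < e -> exists N, forall n, (N <= n)%N -> forall y, sdist z y <= s -> sdist (v n y) y < e.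

(* Vitali's principle: on a disc of equicontinuity, a polynomially approximable map that is small
   on a small disc is small on a larger one. *)
Lemma near_id_spread v c (s : R) : (forall n, rational_like (v n)) -> 0 < s -> s <= 1 ->
  (forall y, sdist c y < s -> forall n, sdist (v n c) (v n y) <= 8^-1) ->
  forall z z', sdist c z < s / 32 -> sdist c z' < s / 32 -> near_id v z -> near_id v z'.
Proof.
move=> vrat s0 s1 eq z z' cz cz' [sz sz0 hz].
have s4 : 0 < s / 4 by rewrite divr_gt0.
exists (s / 16); first by rewrite divr_gt0.
move=> e e0.
(* The chart at most doubles distances, so radius sz / 2 stays where [near_id] at z applies; s / 4
   is the domain of the chart map. *)
have eta0 : 0 < Num.min (sz / 2) (s / 4) by rewrite lt_min !divr_gt0.
have om0 : 0 < e / 4 by rewrite divr_gt0.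
have [e' e'0 he'] := papprox_small (M := 2) (ler0n _ 2) s4 eta0 om0.
have [|N1 hN1] := hz (8^-1); first by rewrite invr_gt0.
have [N2 hN2] := hz _ e'0.
exists (maxn N1 N2) => n; rewrite geq_max => /andP[n1 n2] y z'y.
have zz : sdist z z <= sz by rewrite sdistxx ltW.
have vz := hN1 n n1 z zz.
have disc w : cabs w <= s / 4 -> sdist z (srot z (Some w)) <= 2 * cabs w.
  by move=> _; rewrite -{1}(srot_origin z) sdist_rot; apply: sdist_origin_le.
have cw w : cabs w <= s / 4 -> sdist c (srot z (Some w)) < s.
  move=> ws; have := disc w ws; have := sdist_triangle z c (srot z (Some w)); lra.
have h1 w : cabs w <= s / 4 -> sdist z (v n (srot z (Some w))) <= 1.
  move=> ws; have a1 := eq _ (cw w ws) n.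
  have a2 := eq z _ n; have {}a2 := a2 (_ : sdist c z < s).
  have {}a2 : sdist (v n c) (v n z) <= 8^-1 by apply: a2; lra.
  have := sdist_triangle (v n z) z (v n (srot z (Some w))).
  have := sdist_triangle (v n c) (v n z) (v n (srot z (Some w))).
  by rewrite (sdistC z (v n z)) (sdistC (v n z) (v n c)); lra.
have [ap bd ev] := chart_mapP (vrat n) s4 (lexx 1) h1.
have small := he' (fun w => chart_map z z (v n) w - w).
have ap' : papprox (s / 4) (fun w => chart_map z z (v n) w - w).
  move=> d d0; have [P hP] := ap d d0; exists (P - 'X) => w ws.
  by rewrite !hornerE (_ : _ - _ = chart_map z z (v n) w - P.[w]) ?hP//; ring.
have bd' w : cabs w <= s / 4 -> cabs (chart_map z z (v n) w - w) <= 2.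
  by move=> ws; apply: le_trans (cabsB _ _) _; have := bd w ws; lra.
have sm w : cabs w <= Num.min (sz / 2) (s / 4) -> cabs (chart_map z z (v n) w - w) <= e'.
  rewrite le_min => /andP[w1 w2].
  have c1 : cabs (chart_map z z (v n) w) <= 1 by apply: bd.
  have c2 : cabs w <= 1 by lra.
  have /andP[t1 _] := sdist_rot_disc z c1 c2.
  apply: le_trans t1 _; rewrite -ev//; apply/ltW/hN2 => //.
  by have := disc w w2; lra.
have {small} fin := small ap' bd' sm.
have zy : sdist z y <= s / 8.
  have := sdist_triangle c z z'; have := sdist_triangle z' z y; rewrite (sdistC z c); lra.
have zy1 : sdist z y <= 1 by lra.
have [w [ew w1 /andP[wd _]]] := unrot_chart zy1.
have ws8 : cabs w <= s / 4 / 2 by lra.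
have ws4 : cabs w <= s / 4 by lra.
rewrite ew ev//.
have /andP[_ t2] := sdist_rot_disc z (bd w ws4) w1.
apply: le_lt_trans t2 _; have := fin w ws8; lra.
Qed.

End Paths.

(** * Contraction from an empty kernel Julia set *)

Section Contraction.
Context {R : realType}.
Local Notation C := (@Cx R).
Local Notation S2 := (@Chat R).
Variable G : set (S2 -> S2).
Hypothesis Grat : forall g, G g -> rational_like g.
Hypothesis Gcomp : forall f g, G f -> G g -> G (f \o g).
Hypothesis Gex : exists g, G g.

(** Near b the map q is the limit of (q o k n) o h with q o k n in G, so equicontinuity at h b pulls
    back to b. The index N depends on q, the modulus of continuity does not. *)
Lemma Fatou_of_near_id (k : nat -> S2 -> S2) h b : (forall n, G (k n)) -> G h ->
  near_id (fun n => k n \o h) b -> Fatou G (h b) -> Fatou G b.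
Proof.
move=> Gk Gh [sb sb0 hsb] [r r0 hr].
have [d d0 hd] := rational_like_cont b (Grat Gh) r0.
exists (Num.min d sb); first by rewrite lt_min d0.
move=> x; rewrite /dball /= lt_min => /andP[xd xs] e e0.
have e3 : 0 < e / 3 by rewrite divr_gt0.
have [d' d'0 hd'] := hr (h x) (hd x xd) _ e3.
have [d2 d20 hd2] := rational_like_cont x (Grat Gh) d'0.
exists d2 => // y; rewrite lt_min => /andP[yd ys] xy q Gq.
have [d3 d30 hd3] := rational_uniform (Grat Gq) e3.
have [N hN] := hsb _ d30.
have a1 := hd3 _ _ (hN N (leqnn N) x (ltW xs)).
have a2 := hd3 _ _ (hN N (leqnn N) y (ltW ys)).
have a3 := hd' (h y) (hd y yd) (hd2 y xy) (q \o k N) (Gcomp Gq (Gk N)).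
have := sdist_triangle (q (k N (h x))) (q x) (q y).
have := sdist_triangle (q (k N (h y))) (q (k N (h x))) (q y).
by move: a1 a2 a3 => /=; rewrite (sdistC (q x) (q (k N (h x)))); lra.
Qed.

(* If no element contracts near a point of a minimal set in the Fatou set, every h in G has
   approximate left inverses there; following them along a path to the Julia set
   produces a point of the kernel Julia set. *)
Lemma contraction_at L x0 (c : R) : Jker G = set0 -> Julia G !=set0 ->
  minimal_set G L -> L `<=` Fatou G -> L x0 -> 0 < c ->
  exists s g, [/\ 0 < s, s <= 1, G g & forall y, sdist x0 y < s -> sdist (g x0) (g y) <= c * s].
Proof.
move=> Jk [b0 Jb0] mL LF Lx0 c0; apply: contrapT => nex.
have noncontr s : 0 < s -> s <= 1 -> forall g, G g -> exists2 y, sdist x0 y < s & c * s < sdist (g x0) (g y).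
  move=> s0 s1 g Gg; apply: contrapT => /forall2NP h; apply: nex.
  exists s, g; split => // y xy; rewrite leNgt; apply/negP => h'.
  by case: (h y).
have [K [s1 [K1 s10 s11 GK]]] := Fatou_equilip Grat (minimal_closed mL) LF.
have ret := return_id Grat Gcomp Gex mL Lx0 K1 s10 s11 (fun y y' => GK x0 y y' Lx0) c0 noncontr.
have xb : x0 <> b0 by move=> e; apply: Jb0; rewrite -e; apply: LF.
have [gam [Kg [g0 g1 Kg0 Kglip]]] := sphere_path xb.
(* The infimum of T is the first time the path meets the Julia set; its image will be the point of
   the kernel Julia set. *)
pose T := [set t : R | 0 <= t <= 1 /\ Julia G (gam t)].
have T1 : T 1 by split; [rewrite ler01 lexx|rewrite g1].
have hT : has_inf T by split; [exists 1|exists 0 => t [/andP[]]].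
have tlb t : T t -> inf T <= t by move=> Tt; apply: ge_inf => //; exact: hT.2.
have t0 : 0 <= inf T by apply: lb_le_inf; [exists 1|move=> t [/andP[]]].
have t1 : inf T <= 1 by exact: tlb.
set ts := inf T in t0 t1 tlb.
have before t : 0 <= t -> t < ts -> Fatou G (gam t).
  move=> t_0 tts; apply: contrapT => nF; have := tlb t; rewrite leNgt tts => h.
  have /h// : T t by split => //; rewrite t_0 (le_trans (ltW tts) t1).
have Jb : Julia G (gam ts).
  move=> Fb; have [r r0 hr] := Fatou_open Fb.
  have rK : 0 < r / Kg by rewrite divr_gt0.
  have [t Tt tlt] := inf_adherent rK hT.
  have [tin Jt] := Tt; apply: Jt; apply: hr.
  have tts := tlb t Tt.
  apply: le_lt_trans (Kglip _ _ _ tin) _; first by rewrite t0.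
  rewrite distrC ger0_norm ?subr_ge0// -ltr_pdivlMl// mulrC.
  by move: tlt; rewrite -/ts; lra.
have : Jker G (gam ts); last by rewrite Jk.
move=> h Gh Fhb; apply: Jb.
have [s2 s20 hs2] := ret h Gh.
have exk n : exists k, G k /\ forall z, sdist x0 z <= s2 -> sdist (k (h z)) z < n.+1%:R^-1.
  have [|k Gk hk] := hs2 n.+1%:R^-1; first by rewrite invr_gt0.
  by exists k.
have [k hk] := choice exk.
have Gk n : G (k n) by have [] := hk n.
pose v n := k n \o h.
have Gv n : G (v n) by apply: Gcomp.
apply: (@Fatou_of_near_id k h) => //; rewrite -/v.
have e8 : 0 < 8^-1 :> R by rewrite invr_gt0.
apply: (@real_connected R ts (fun t => near_id v (gam t))) => //; last first.
  exists s2 => // e e0; have [N hN] := inv_natS_small e0.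
  exists N => n Nn y; rewrite g0 => xy; apply: lt_trans (hN n Nn).
  by have [_] := hk n; apply.
move=> t /andP[t_0 tts].
have [s s0 [s_1 hs]] : exists2 s : R, 0 < s & s <= 1 /\
    forall y, sdist (gam t) y < s -> forall n, sdist (v n (gam t)) (v n y) <= 8^-1.
  suff [s s0 hs] : exists2 s : R, 0 < s &
      forall y, sdist (gam t) y < s -> forall n, sdist (v n (gam t)) (v n y) <= 8^-1.
    exists (Num.min s 1); first by rewrite lt_min s0 ltr01.
    split; first by rewrite ge_min lexx orbT.
    by move=> y; rewrite lt_min => /andP[ys _]; apply: hs.
  (* At the endpoint, equicontinuity of v n = k n o h comes from the assumption that h (gam ts) is a
     Fatou point; before it, gam t itself is one. *)
  move: tts; rewrite le_eqVlt => /predU1P[->|tts].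
    have [s s0 hs] := Fatou_equicont Fhb e8.
    have [d d0 hd] := rational_like_cont (gam ts) (Grat Gh) s0.
    by exists d => // y /hd hy n; apply/ltW/hs.
  have [s s0 hs] := Fatou_equicont (before t t_0 tts) e8.
  by exists s => // y ys n; apply/ltW/hs.
exists (s / 32 / Kg); first by rewrite !divr_gt0.
have ht : 0 <= t <= 1 by rewrite t_0 (le_trans tts t1).
have clo r : 0 <= r <= ts -> `|r - t| < s / 32 / Kg -> sdist (gam t) (gam r) < s / 32.
  move=> /andP[r0 r1] rt; apply: le_lt_trans (Kglip _ _ ht _) _; first by rewrite r0 (le_trans r1 t1).
  by rewrite distrC mulrC -ltr_pdivlMr.
move=> r r' hr hr' rt rt'; apply: (near_id_spread _ s0 s_1 hs).
- by move=> n; apply: Grat.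
- exact: clo.
- exact: clo.
Qed.

End Contraction.

(** * The Lasota-Yorke inequality *)

Section LasotaYorke.
Context {R : realType} (tau : probability (@RatSpace R) R).
Local Notation C := (@Cx R).
Local Notation S2 := (@Chat R).
Hypothesis tauK : compactly_supported_on_Rat tau.
Local Notation Gam := (Gamma tau).
Local Notation G := (Gtau tau).
Local Notation M := (Mtau tau).
Local Notation contC := (cont_on setT).

Definition min_union : set S2 := [set x | exists2 L, minimal_set G L & L x].

Let Grat g : G g -> rational_like g. Proof. exact: Gtau_rational. Qed.
Let Gcomp f g : G f -> G g -> G (f \o g). Proof. exact: sg_comp. Qed.
Let Gex : exists g, G g. Proof. by have [g Gg] := Gam_ex tauK; exists g; exact: sg_gen. Qed.

Lemma min_union_closed r : prod_dims tau r -> sclosed min_union.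
Proof.
move=> [m [Ls [ds [_ [hm [hM _]]]]]].
suff H (s : seq 'I_m) : sclosed [set x | exists2 i, i \in s & Ls i x].
  have -> : min_union = [set x | exists2 i, i \in enum 'I_m & Ls i x]; last exact: H.
  apply/seteqP; split => x /=.
    by move=> [L /hM[i <-] Lx]; exists i => //; rewrite mem_enum.
  by move=> [i _ Lx]; exists (Ls i).
elim: s => [|i s IH].
  by move=> x /(_ 1 ltr01)[y [j] ].
have -> : [set x | exists2 j, j \in i :: s & Ls j x] = Ls i `|` [set x | exists2 j, j \in s & Ls j x].
  apply/seteqP; split => x /=.
    by move=> [j]; rewrite inE => /predU1P[->|js] h; [left|right; exists j].
  by move=> [h|[j js h]]; [exists i; rewrite // mem_head|exists j; rewrite // inE js orbT].
by apply: sclosedU => //; apply: minimal_closed (hm i).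
Qed.

Lemma min_union_inv g x : G g -> min_union x -> min_union (g x).
Proof. by move=> Gg [L mL Lx]; exists L => //; have [_ [_ [iL _]]] := mL; apply: iL. Qed.

(** The identity is adjoined so that rho dominates the spherical distance and the empty word is
    covered. *)
Definition Gid (g : S2 -> S2) := g = id \/ G g.

Lemma Gn_Gid n v : Gn tau n v -> Gid v.
Proof. by case: n => [->|n /Gn_Gtau]; [left|right]. Qed.

Definition rho (x y : S2) : R := sup [set sdist (g x) (g y) | g in Gid].

Lemma rho_ge g x y : Gid g -> sdist (g x) (g y) <= rho x y.
Proof.
move=> Gg; apply: ub_le_sup; last by exists g.
by exists 2 => _ [h _ <-]; exact: sdist_le2.
Qed.

Lemma rho_le x y (e : R) : (forall g, Gid g -> sdist (g x) (g y) <= e) -> rho x y <= e.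
Proof.
move=> h; apply: ge_sup; first by exists (sdist x y); exists id => //; left.
by move=> _ [g Gg <-]; exact: h.
Qed.

Lemma sdist_le_rho x y : sdist x y <= rho x y.
Proof. by apply: (@rho_ge id); left. Qed.

Lemma rho_ge0 x y : 0 <= rho x y.
Proof. exact: le_trans (sdist_ge0 _ _) (sdist_le_rho x y). Qed.

Lemma rho_inv g x y : Gid g -> rho (g x) (g y) <= rho x y.
Proof.
move=> Gg; apply: rho_le => h Gh; apply: (@rho_ge (h \o g)).
case: Gg Gh => [->|Gg] [->|Gh]; [by left|by right|by right|by right; apply: Gcomp].
Qed.

(** Both points are close to the same l. Measuring with rho makes the relation invariant under G. *)
Definition near_min (eta : R) (x y : S2) := exists2 l, min_union l & rho l x < eta /\ rho l y < eta.

Lemma near_min_inv eta g x y : Gid g -> near_min eta x y -> near_min eta (g x) (g y).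
Proof.
move=> Gg [l Sl [lx ly]]; exists (g l).
  by case: Gg => [-> //|Gg]; apply: min_union_inv.
by split; [apply: le_lt_trans lx|apply: le_lt_trans ly]; apply: rho_inv.
Qed.

Hypothesis Jk : Jker G = set0.
Hypothesis Jne : Julia G !=set0.
Hypothesis minF : forall L, minimal_set G L -> L `<=` Fatou G.
Variable r : nat.
Hypothesis hr : prod_dims tau r.

Lemma rho_lip_near : exists K s : R, [/\ 1 <= K, 0 < s, s <= 1 &
  forall l x y, min_union l -> sdist l x <= s -> sdist l y <= s -> rho x y <= K * sdist x y].
Proof.
have [||K [s [K1 s0 s1 h]]] := @Fatou_equilip R G Grat min_union.
- exact: min_union_closed hr.
- by move=> x [L mL Lx]; apply: (minF mL).
exists K, s; split => // l x y Sl lx ly; apply: rho_le => g [->|Gg]; last exact: (h l).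
by rewrite ler_peMl ?sdist_ge0.
Qed.

Lemma word_gap_weaken n p p' x y Q : p' <= p -> word_gap tau n p x y Q -> word_gap tau n p' x y Q.
Proof.
move=> pp h phi A B ct B0 BA hA hB; apply: le_trans (h phi A B ct B0 BA hA hB) _.
by nra.
Qed.

(** A single parameter e bounds the radius, the probability and, through e^-1, the word length,
    which brings the claim into the form of [compact_uniform]. *)
Lemma uniform_word_gap (S : set S2) (Q : S2 -> S2 -> S2 -> S2 -> Prop) : sclosed S ->
  (forall x y g a b, Gam g -> Q x y a b -> Q x y (g a) (g b)) ->
  (forall l, S l -> exists (e : R) n p, [/\ 0 < e, 0 < p & forall x y, sdist l x < e -> sdist l y < e ->
     word_gap tau n p x y (Q x y)]) ->
  exists (e : R) n p, [/\ 0 < e, 0 < p <= 1 & forall l x y, S l -> sdist l x < e -> sdist l y < e ->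
     forall n', (n <= n')%N -> word_gap tau n' p x y (Q x y)].
Proof.
move=> cS Qinv loc.
have [e e0 he] : exists2 e : R, 0 < e & forall l, S l -> forall x y, sdist l x < e -> sdist l y < e ->
    forall n, e^-1 <= n%:R -> word_gap tau n e x y (Q x y).
  apply: (@compact_uniform R S (fun l e => forall x y, sdist l x < e -> sdist l y < e ->
    forall n, e^-1 <= n%:R -> word_gap tau n e x y (Q x y))) => //.
    move=> l a b b0 ba h x y lx ly n hn; apply: (word_gap_weaken ba); apply: h.
    - exact: lt_le_trans ba.
    - exact: lt_le_trans ba.
    - by apply: le_trans hn; rewrite lef_pV2 ?posrE//; apply: lt_le_trans ba.
  move=> l Sl; have [e [n [p [e0 p0 h]]]] := loc l Sl.
  have n0 : 0 < n.+1%:R^-1 :> R by rewrite invr_gt0.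
  exists (Num.min (e / 2) (Num.min p n.+1%:R^-1)); first by rewrite !lt_min divr_gt0// p0 n0.
  set a := Num.min (e / 2) _.
  have [a1 [a2 a3]] : a <= e / 2 /\ a <= p /\ a <= n.+1%:R^-1 by rewrite /a !ge_min !lexx !orbT.
  have a0 : 0 < a by rewrite !lt_min divr_gt0// p0 n0.
  move=> l' Sl' ll' x y l'x l'y m hm.
  have hx : sdist l x < e.
    by apply: le_lt_trans (sdist_triangle l' _ _) _; move: a1 ll' l'x; move: (a) => t; lra.
  have hy : sdist l y < e.
    by apply: le_lt_trans (sdist_triangle l' _ _) _; move: a1 ll' l'y; move: (a) => t; lra.
  apply: (word_gap_ext tauK (Qinv x y) (h x y hx hy)) => //.
  have : n.+1%:R <= m%:R :> R.
    by apply: le_trans hm; rewrite -[leLHS]invrK lef_pV2 ?posrE.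
  by rewrite ler_nat => /ltnW.
exists e, (Num.bound e^-1), (Num.min e 1); split => //.
  by rewrite lt_min e0 ltr01 ge_min lexx orbT.
move=> l x y Sl lx ly n hn; apply: (@word_gap_weaken n e); first by rewrite ge_min lexx.
apply: (he l Sl) => //.
have := @archi_boundP R e^-1; rewrite invr_ge0 => /(_ (ltW e0)) h.
by apply: ltW; apply: lt_le_trans h _; rewrite ler_nat.
Qed.

Lemma Gam_Gid g : Gam g -> Gid g. Proof. by move=> Gg; right; exact: sg_gen. Qed.

Lemma contraction_gap : exists (e : R) n p, [/\ 0 < e, 0 < p <= 1 & forall l x y, min_union l ->
  sdist l x < e -> sdist l y < e -> forall n', (n <= n')%N ->
  word_gap tau n' p x y (fun a b => rho a b <= rho x y / 2)].
Proof.
apply: (@uniform_word_gap min_union (fun x y a b => rho a b <= rho x y / 2)).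
- exact: min_union_closed hr.
- by move=> x y g a b /Gam_Gid Gg; apply: le_trans; apply: rho_inv.
move=> l Sl; have [K [s1 [K1 s10 s11 hK]]] := rho_lip_near.
have [L mL Ll] := Sl; have K0 : 0 < K by apply: lt_le_trans K1.
(* A word v within c s of g maps the s-ball into radius 3 c s, so [rational_lip] gives the constant
   48 c. Returning to rho costs K, and 48 c K = 1 / 2. *)
have c0 : 0 < 1 / (96 * K) by rewrite divr_gt0// mulr_gt0.
have [s [g [s0 s_1 Gg hg]]] := contraction_at Grat Gcomp Gex Jk Jne mL (minF mL) Ll c0.
set c := 1 / (96 * K) in c0 hg.
have cs0 : 0 < c * s by rewrite mulr_gt0.
have cK : c * K = 96^-1 by rewrite /c; field; rewrite gt_eqF.
have c1 : c <= 96^-1 by rewrite -cK ler_peMr// ltW.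
have [n [p [/andP[p0 p1] hp]]] := word_gap_local tauK Gg cs0.
exists (Num.min (s / 16) (s1 / K)), n, p; split => //; first by rewrite lt_min !divr_gt0.
move=> x y; rewrite !lt_min => /andP[lx lx'] /andP[ly ly'].
apply: hp => v hv close.
have Gv := Gn_Gid hv.
have vrat : rational_like v by case: Gv => [->|/Grat//]; move=> h.
have a0 : 0 <= 3 * (c * s) by rewrite mulr_ge0// ltW.
have a1 : 3 * (c * s) <= 1.
  have : c * s <= 96^-1 * 1 by apply: ler_pM => //; exact: ltW.
  lra.
have hv1 z : sdist l z < s -> sdist (v l) (v z) <= 3 * (c * s).
  move=> lz; have h1 := hg z lz; have h2 := close l; have h3 := close z.
  have := sdist_triangle (g l) (v l) (v z); have := sdist_triangle (g z) (g l) (v z).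
  by rewrite (sdistC (g z) (v z)); lra.
have lip := rational_lip vrat s0 s_1 a0 a1 hv1 (ltW lx) (ltW ly).
have lx1 : sdist l x <= s1.
  by apply: ltW; apply: lt_le_trans lx' _; rewrite ler_pdivrMr// ler_peMr// ltW.
have ly1 : sdist l y <= s1.
  by apply: ltW; apply: lt_le_trans ly' _; rewrite ler_pdivrMr// ler_peMr// ltW.
have ll : sdist l l <= s1 by rewrite sdistxx ltW.
have vclose z : sdist l z <= s1 -> sdist l z < s1 / K -> sdist (v l) (v z) <= s1.
  move=> lz1 lz; apply: le_trans (rho_ge l z Gv) _; apply: le_trans (hK l l z Sl ll lz1) _.
  by move: lz; rewrite ltr_pdivlMr// mulrC => /ltW.
have Svl : min_union (v l) by case: Gv => [-> //|Gv]; apply: min_union_inv.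
apply: le_trans (hK (v l) (v x) (v y) Svl (vclose x lx1 lx') (vclose y ly1 ly')) _.
have e48 : 16 * (3 * (c * s)) / s = 48 * c by field; rewrite gt_eqF.
rewrite e48 in lip.
have : K * sdist (v x) (v y) <= K * (48 * c * sdist x y) by rewrite ler_pM2l.
have -> : K * (48 * c * sdist x y) = (c * K) * (48 * sdist x y) by ring.
rewrite cK; have := sdist_le_rho x y; lra.
Qed.

Lemma absorption_gap (eta : R) : 0 < eta -> exists (e : R) n p, [/\ 0 < e, 0 < p <= 1 & forall l x y,
  sdist l x < e -> sdist l y < e -> forall n', (n <= n')%N ->
  word_gap tau n' p x y (near_min eta)].
Proof.
move=> eta0.
have [|||e [n [p [e0 p0 h]]]] := @uniform_word_gap setT (fun _ _ => near_min eta).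
- exact: sclosedT.
- by move=> _ _ g a b /Gam_Gid Gg; apply: near_min_inv.
- move=> z _; have [K [s1 [K1 s10 s11 hK]]] := rho_lip_near.
  have K0 : 0 < K by apply: lt_le_trans K1.
  (* Three errors of size e0 separate v w from l; they must fit in the ball s1 and, after
     multiplication by K, below eta. *)
  set e0 := Num.min (s1 / 4) (eta / (4 * K)).
  have e00 : 0 < e0 by rewrite lt_min !divr_gt0// mulr_gt0.
  have [e01 e02] : e0 <= s1 / 4 /\ e0 <= eta / (4 * K) by rewrite /e0 !ge_min !lexx orbT.
  have [L [l [g [mL Ll Gg gz]]]] := orbit_near_minimal Grat Gcomp Gex z e00.
  have [d d0 hd] := rational_like_cont z (Grat Gg) e00.
  have [n [p [/andP[p0 p1] hp]]] := word_gap_local tauK Gg e00.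
  exists d, n, p; split => // x y zx zy; apply: hp => v hv close.
  have Sl : min_union l by exists L.
  have ll : sdist l l <= s1 by rewrite sdistxx ltW.
  have key w : sdist z w < d -> rho l (v w) < eta.
    move=> zw; have h1 := hd w zw; have h2 := close w.
    have h3 : sdist l (v w) < 3 * e0.
      have := sdist_triangle (g z) l (v w); have := sdist_triangle (g w) (g z) (v w).
      rewrite (sdistC (g w) (v w)) (sdistC l (g z)).
      by move: gz h1 h2; move: (e0) => t; lra.
    have h4 : sdist l (v w) <= s1 by move: h3 e01; move: (e0) => t; have := s10; lra.
    apply: le_lt_trans (hK l l (v w) Sl ll h4) _.
    move: e02; rewrite ler_pdivlMr ?mulr_gt0// => e02.
    have : K * sdist l (v w) < K * (3 * e0) by rewrite ltr_pM2l.
    have : 0 < e0 * K by rewrite mulr_gt0.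
    by move: e02; move: (e0) => t; lra.
  by exists l => //; split; apply: key.
by exists e, n, p; split => // l x y; apply: h.
Qed.

(** Absorption and contraction with the same length and probability, so that words can be cut into
    blocks of n letters. *)
Lemma gap_constants : exists (K eta del p : R) n, (0 < n)%N /\ [/\ 1 <= K, 0 < eta, 0 < del, 0 < p <= 1 & [/\
  forall x y, near_min eta x y -> rho x y <= K * sdist x y,
  forall x y, near_min eta x y -> word_gap tau n p x y (fun a b => rho a b <= rho x y / 2) &
  forall x y, sdist x y < del -> word_gap tau n p x y (near_min eta)]].
Proof.
have [K [s1 [K1 s10 s11 hK]]] := rho_lip_near.
have [e [n1 [p1 [e0 /andP[p10 p11] h1]]]] := contraction_gap.
set eta := Num.min e s1.
have eta0 : 0 < eta by rewrite lt_min e0.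
have [ee es] : eta <= e /\ eta <= s1 by rewrite /eta !ge_min !lexx orbT.
have [d [n2 [p2 [d0 /andP[p20 p21] h2]]]] := absorption_gap eta0.
exists K, eta, d, (Num.min p1 p2), (maxn n1 n2).+1; split => //; split => //.
  by rewrite lt_min p10 p20 ge_min p11.
split.
- move=> x y [l Sl [lx ly]]; apply: (hK l) => //.
    by apply: le_trans (sdist_le_rho l x) _; apply: ltW; apply: lt_le_trans es.
  by apply: le_trans (sdist_le_rho l y) _; apply: ltW; apply: lt_le_trans es.
- move=> x y [l Sl [lx ly]]; apply: (@word_gap_weaken _ p1); first by rewrite ge_min lexx.
  apply: (h1 l) => //; last exact: leqW (leq_maxl _ _).
    by apply: le_lt_trans (sdist_le_rho l x) _; apply: lt_le_trans ee.
  by apply: le_lt_trans (sdist_le_rho l y) _; apply: lt_le_trans ee.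
- move=> x y xy; apply: (@word_gap_weaken _ p2); first by rewrite ge_min lexx orbT.
  by apply: (h2 x) => //; [rewrite sdistxx|exact: leqW (leq_maxr _ _)].
Qed.

Lemma Gn_lip (La : R) : 1 <= La -> (forall g, Gam g -> forall x y, sdist (g x) (g y) <= La * sdist x y) ->
  forall n v, Gn tau n v -> forall x y, sdist (v x) (v y) <= La ^+ n * sdist x y.
Proof.
move=> La1 h; elim => [v -> x y|n IH v [g [w [Gg hw ->]]] x y]; first by rewrite expr0 mul1r.
apply: le_trans (IH w hw _ _) _; rewrite exprSr -mulrA ler_wpM2l ?h// exprn_ge0//.
by apply: le_trans La1.
Qed.

Definition holder (al A : R) (phi : S2 -> C) := forall x y, cabs (phi x - phi y) <= A * sdist x y `^ al.

Lemma pow_modulus (al A e : R) : 0 < al -> 0 < e -> exists2 d : R, 0 < d &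
  forall x y : S2, sdist x y < d -> A * sdist x y `^ al < e.
Proof.
move=> al0 e0.
have A1 : 0 < `|A| + 1 by rewrite ltr_wpDl.
exists ((e / (`|A| + 1)) `^ (al^-1)); first by apply: powR_gt0; apply: divr_gt0.
move=> x y xy.
have e1 : e / (`|A| + 1) = ((e / (`|A| + 1)) `^ al^-1) `^ al.
  by rewrite -powRrM mulVf ?gt_eqF// powRr1// divr_ge0 ?ltW.
have : sdist x y `^ al < e / (`|A| + 1).
  rewrite e1; apply: gt0_ltr_powR => //; rewrite nnegrE; first exact: sdist_ge0.
  exact: powR_ge0.
rewrite ltr_pdivlMr// => H; apply: le_lt_trans H.
by rewrite mulrC ler_wpM2l ?powR_ge0//; have := ler_norm A; lra.
Qed.

Lemma holder_cont al A phi : 0 < al -> holder al A phi -> contC phi.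
Proof.
move=> al0 h x _ e e0; have [d d0 hd] := pow_modulus A al0 e0.
by exists d => // y _ xy; apply: le_lt_trans (h x y) (hd _ _ xy).
Qed.

(** Near a minimal set the Hölder constant for rho decays like q^k over k blocks. A close pair is
    absorbed with probability p and otherwise stretched by at most X, which gives the recursion of
    [main]. Distant pairs are charged to the sup norm. *)
Lemma lasota_yorke : exists al : R, 0 < al < 1 /\ exists N (K : R), (0 < N)%N /\ 0 <= K /\
  forall phi A B, 0 <= A -> holder al A phi -> (forall z, cabs (phi z) <= B) ->
    holder al (A / 2 + K * B) (iter N M phi).
Proof.
have [K [eta [del [p [n [n0 [K1 eta0 del0 /andP[p0 p1] [hK hcon habs]]]]]]]] := gap_constants.
have [La La1 hLa] := Gam_lip tauK.
have K0 : 0 < K by apply: lt_le_trans K1.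
set X := La ^+ n.
have X1 : 1 <= X by apply: exprn_ege1.
have X0 : 0 < X by apply: lt_le_trans X1.
have lnX : 0 <= ln X by apply: ln_ge0.
(* Then al ln X <= p / 2, and exp(-t) >= 1 - t gives X^al (1 - p / 2) <= 1, hence th = (1 - p) X^al
   < 1. *)
set al := p / 2 / (1 + ln X).
have l1 : 0 < 1 + ln X by lra.
have al0 : 0 < al by rewrite !divr_gt0.
have al1 : al < 1.
  rewrite /al ltr_pdivrMr//; lra.
have alX : al * ln X <= p / 2.
  rewrite /al mulrAC ler_pdivrMr//; nra.
set Xa := X `^ al.
have Xa1 : Xa * (1 - p / 2) <= 1.
  rewrite /Xa /powR gt_eqF//.
  have h1 : expR (al * ln X) * expR (- (al * ln X)) = 1 by rewrite -expRD subrr expR0.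
  have h2 := expR_ge1Dx (- (al * ln X)).
  have h3 : 1 - p / 2 <= expR (- (al * ln X)) by lra.
  by rewrite -[leRHS]h1 ler_pM2l ?expR_gt0.
have Xa0 : 0 < Xa by rewrite powR_gt0.
set th := (1 - p) * Xa.
have th0 : 0 <= th by rewrite mulr_ge0 ?subr_ge0// ltW.
have th1 : th < 1.
  by rewrite /th; nra.
set h := 2^-1 `^ al.
have h0 : 0 <= h by rewrite powR_ge0.
have h1 : h < 1.
  rewrite /h /powR gt_eqF ?invr_gt0// -[ltRHS]expR0 ltr_expR.
  rewrite pmulr_rlt0//; apply: ln_lt0; lra.
(* With probability p one block halves rho, which multiplies rho^al by h. *)
set q := 1 - p * (1 - h).
have q0 : 0 <= q by rewrite /q; nra.
have q1 : q < 1 by rewrite /q; nra.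
set ka := (1 + Num.max th q) / 2.
have [tk qk] : th < ka /\ q < ka.
  have [a1 a2] : th <= Num.max th q /\ q <= Num.max th q by rewrite !le_max !lexx orbT.
  have a3 : Num.max th q < 1 by rewrite gt_max th1.
  by rewrite /ka; move: (Num.max th q) a1 a2 a3 => m; move: (th) (q) => t t'; split; lra.
have ka1 : ka < 1.
  have a3 : Num.max th q < 1 by rewrite gt_max th1.
  by rewrite /ka; move: (Num.max th q) a3 => m; lra.
have ka0 : 0 <= ka by apply: le_trans (ltW tk).
set Ka := K `^ al.
have Ka0 : 0 < Ka by rewrite powR_gt0.
(* D closes the recursion th D + Ka Xa <= D ka; it is finite because ka lies strictly above th. *)
set D := Num.max 1 (Ka * Xa / (ka - th)).
have D1 : 1 <= D by rewrite le_max lexx.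
have kt0 : 0 < ka - th by rewrite subr_gt0.
have Dk : th * D + Ka * Xa <= D * ka.
  have : Ka * Xa / (ka - th) <= D by rewrite le_max lexx orbT.
  by rewrite ler_pdivrMr// mulrBr (mulrC D th); lra.
have mono a b : 0 <= a -> a <= b -> a `^ al <= b `^ al.
  by move=> a0 ab; rewrite ge0_ler_powR ?nnegrE// ?(ltW al0)//; apply: le_trans ab.
have inD phi A k : 0 <= A -> holder al A phi -> forall x y, near_min eta x y ->
    cabs (iter (k * n) M phi x - iter (k * n) M phi y) <= A * q ^+ k * rho x y `^ al.
  move=> A0 hphi; have ct := holder_cont al0 hphi.
  elim: k => [x y _|k IH x y Dxy].
    rewrite mul0n /= expr0 mulr1; apply: le_trans (hphi x y) _.
    by rewrite ler_wpM2l// mono ?sdist_ge0// sdist_le_rho.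
  rewrite mulSn iterD.
  have Aq : 0 <= A * q ^+ k by rewrite mulr_ge0 ?exprn_ge0.
  set A' := A * q ^+ k * rho x y `^ al.
  have A'0 : 0 <= A' by rewrite mulr_ge0 ?powR_ge0.
  have -> : A * q ^+ k.+1 * rho x y `^ al = A' - p * (A' - A' * h).
    by rewrite /A' exprS /q; ring.
  apply: (hcon x y Dxy).
  - exact: iterM_cont.
  - by rewrite mulr_ge0.
  - by rewrite ler_piMr// ltW.
  - move=> v /Gn_Gid Gv; apply: le_trans (IH _ _ (near_min_inv Gv Dxy)) _.
    by rewrite ler_wpM2l// mono ?rho_ge0// rho_inv.
  - move=> v /Gn_Gid Gv rv; apply: le_trans (IH _ _ (near_min_inv Gv Dxy)) _.
    rewrite /A' -[leRHS]mulrA ler_wpM2l// /h -powRM ?rho_ge0 ?invr_ge0//.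
    by rewrite mono ?rho_ge0.
have main k : exists2 dk : R, 0 < dk & forall phi A, 0 <= A -> holder al A phi -> forall x y,
    sdist x y < dk -> cabs (iter (k * n) M phi x - iter (k * n) M phi y) <= A * (D * ka ^+ k) * sdist x y `^ al.
  elim: k => [|k [dk dk0 IH]].
    exists 1 => // phi A A0 hphi x y _; rewrite mul0n /= expr0 mulr1; apply: le_trans (hphi x y) _.
    by rewrite ler_wpM2r ?powR_ge0// ler_peMr.
  (* One more block may stretch the pair by X, so the radius shrinks by X at each step. *)
  exists (Num.min del (dk / X)); first by rewrite lt_min del0 divr_gt0.
  move=> phi A A0 hphi x y; rewrite lt_min => /andP[xd xk].
  have ct := holder_cont al0 hphi.
  rewrite mulSn iterD.
  set da := sdist x y `^ al.
  have da0 : 0 <= da by rewrite powR_ge0.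
  set B' := A * q ^+ k * (Ka * Xa * da).
  have B'0 : 0 <= B' by rewrite !mulr_ge0 ?exprn_ge0 ?(ltW Ka0) ?(ltW Xa0).
  set A1 := A * (D * ka ^+ k) * (Xa * da).
  have A10 : 0 <= A1 by rewrite !mulr_ge0 ?exprn_ge0 ?(ltW Xa0)// (le_trans ler01).
  have gap : cabs (iter n M (iter (k * n) M phi) x - iter n M (iter (k * n) M phi) y) <= (A1 + B') - p * ((A1 + B') - B').
    have vd v : Gn tau n v -> sdist (v x) (v y) <= X * sdist x y by move=> hv; apply: (Gn_lip La1 hLa hv).
    have vda v : Gn tau n v -> sdist (v x) (v y) `^ al <= Xa * da.
      move=> hv; rewrite /Xa /da -powRM ?sdist_ge0 ?(ltW X0)//.
      by apply: mono; rewrite ?sdist_ge0 ?vd.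
    apply: (habs x y xd) => //.
    - exact: iterM_cont.
    - by rewrite lerDr.
    - move=> v hv; apply: (@le_trans _ _ A1); last by rewrite lerDl.
      apply: le_trans (IH phi A A0 hphi _ _ _) _.
        by apply: le_lt_trans (vd v hv) _; rewrite mulrC -ltr_pdivlMr.
      by rewrite /A1 ler_wpM2l ?vda// !mulr_ge0 ?exprn_ge0// (le_trans ler01).
    - move=> v hv Dv; apply: le_trans (inD phi A k A0 hphi _ _ Dv) _.
      rewrite /B' ler_wpM2l ?mulr_ge0 ?exprn_ge0//.
      apply: (@le_trans _ _ ((K * sdist (v x) (v y)) `^ al)).
        by rewrite mono ?rho_ge0 ?hK.
      by rewrite powRM ?sdist_ge0 ?(ltW K0)// -mulrA -/Ka ler_pM2l// vda.
  apply: le_trans gap _.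
  have -> : A1 + B' - p * (A1 + B' - B') = A * da * (th * (D * ka ^+ k) + Ka * Xa * q ^+ k).
    by rewrite /A1 /B' /th; ring.
  have -> : A * (D * ka ^+ k.+1) * da = A * da * (D * ka ^+ k.+1) by ring.
  rewrite ler_wpM2l ?mulr_ge0//.
  have qka : q ^+ k <= ka ^+ k by rewrite lerXn2r ?nnegrE// ltW.
  have : Ka * Xa * q ^+ k <= Ka * Xa * ka ^+ k by rewrite ler_pM2l ?mulr_gt0.
  have : (th * D + Ka * Xa) * ka ^+ k <= (D * ka) * ka ^+ k by rewrite ler_wpM2r ?exprn_ge0.
  rewrite exprS; set kk := ka ^+ k; set qq := q ^+ k.
  by move: (th) (D) (ka) (Ka) (Xa) (kk) (qq) => t1 t2 t3 t4 t5 t6 t7; lra.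
exists al; split; first by rewrite al0.
have [||k hk] := @pow_small R ka (2^-1 / D).
- by rewrite ka0.
- by rewrite divr_gt0 ?invr_gt0// (lt_le_trans ltr01).
have [dk dk0 hdk] := main k.+1.
(* For pairs at distance at least dk the difference is at most 2 B, which gives the constant 2 /
   dk^al. *)
exists (k.+1 * n)%N, (2 / dk `^ al); split; first by rewrite muln_gt0.
split; first by rewrite divr_ge0 ?powR_ge0.
move=> phi A B A0 hphi hB x y; have ct := holder_cont al0 hphi.
have B0 : 0 <= B by apply: le_trans (hB None); apply: cabs_ge0.
have dka0 : 0 < dk `^ al by rewrite powR_gt0.
have Kc0 : 0 <= 2 / dk `^ al * B by rewrite mulr_ge0// divr_ge0// ltW.
rewrite mulrDl.
have [xy|xy] := ltP (sdist x y) dk.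
  apply: le_trans (hdk phi A A0 hphi x y xy) _.
  apply: (@le_trans _ _ (A / 2 * sdist x y `^ al)); last by rewrite lerDl mulr_ge0 ?powR_ge0.
  rewrite ler_wpM2r ?powR_ge0// ler_wpM2l//.
  apply: (@le_trans _ _ (D * ka ^+ k)).
    by rewrite ler_pM2l ?(lt_le_trans ltr01)// exprS ler_piMl ?exprn_ge0// ltW.
  move: hk; rewrite ltr_pdivlMr ?(lt_le_trans ltr01)// mulrC => /ltW //.
apply: (@le_trans _ _ (2 / dk `^ al * B * sdist x y `^ al)); last first.
  by rewrite lerDr !mulr_ge0 ?powR_ge0 ?invr_ge0.
apply: (@le_trans _ _ (B + B)).
  apply: le_trans (cabsB _ _) _.
  by apply: lerD; exact: iterM_bound.
have -> : 2 / dk `^ al * B * sdist x y `^ al = (B + B) * (sdist x y `^ al / dk `^ al) by ring.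
rewrite ler_peMr ?addr_ge0// ler_pdivlMr// mul1r mono// ltW //.
Qed.

Lemma M_holder (al : R) : 0 < al -> exists2 La : R, 1 <= La &
  forall phi A, 0 <= A -> holder al A phi -> holder al (A * La) (M phi).
Proof.
move=> al0; have [La La1 hLa] := Gam_lip tauK.
have La0 : 0 <= La by apply: le_trans La1.
exists (La `^ al).
  have e1 : (1 : R) `^ al = 1 by rewrite powR1.
  by rewrite -[leLHS]e1 ge0_ler_powR ?nnegrE// ltW.
move=> phi A A0 h x y; apply: (M_diff_le tauK (holder_cont al0 h)) => g Gg.
apply: le_trans (h _ _) _; rewrite -mulrA ler_wpM2l// -powRM ?sdist_ge0//.
by rewrite ge0_ler_powR ?nnegrE ?(ltW al0) ?sdist_ge0 ?mulr_ge0 ?sdist_ge0// hLa.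
Qed.

End LasotaYorke.

(** * Unitary eigenfunctions *)

Section UnitaryEigenvalues.
Context {R : realType} (tau : probability (@RatSpace R) R).
Local Notation C := (@Cx R).
Local Notation S2 := (@Chat R).
Hypothesis tauK : compactly_supported_on_Rat tau.
Local Notation Gam := (Gamma tau).
Local Notation G := (Gtau tau).
Local Notation M := (Mtau tau).
Local Notation cI := (cint tau).
Local Notation contC := (cont_on setT).

Let Grat g : G g -> rational_like g. Proof. exact: Gtau_rational. Qed.
Let Gcomp f g : G f -> G g -> G (f \o g). Proof. exact: sg_comp. Qed.
Let Gex : exists g, G g. Proof. by have [g Gg] := Gam_ex tauK; exists g; exact: sg_gen. Qed.

Lemma max_attained (K : set S2) (u : S2 -> C) : K !=set0 -> sclosed K -> cont_on K u ->
  exists2 z, K z & forall y, K y -> cabs (u y) <= cabs (u z).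
Proof.
move=> [x0 Kx0] cK ct; have [B B0 hB] := cont_bounded cK ct.
pose V := [set cabs (u z) | z in K].
have hV : has_sup V.
  by split; [exists (cabs (u x0)); exists x0|exists B => _ [z Kz <-]; exact: hB].
have ex n : exists z, K z /\ sup V - n.+1%:R^-1 < cabs (u z).
  have [|_ [z Kz <-] h] := sup_adherent (_ : 0 < n.+1%:R^-1) hV; first by rewrite invr_gt0.
  by exists z.
have [zs hz] := choice ex.
have [U [UU hU]] := nat_ultra.
have [z hzl] := ulim_ex (U := U) zs.
have Kz : K z.
  by apply: (@sclosed_ulim _ _ U UU zs) => //; apply: filterS (filterT : U setT) => n _; have [] := hz n.
exists z => // y Ky; apply: (@le_trans _ _ (sup V)).
  by apply: ub_le_sup; [exact: hV.2|exists y].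
apply/ler_addgt0Pr => e e0; have e2 : 0 < e / 2 by rewrite divr_gt0.
have [d d0 hd] := ct z Kz _ e2; have [N hN] := inv_natS_small e2.
have [n [/= h1 h2]] := ultra_ex (filterI (hzl _ d0) (hU N)).
have [Kn h3] := hz n; have := hd _ Kn; rewrite sdistC => /(_ h1) h4.
have := cabs_lerB (u (zs n)) (u z); rewrite cabsC; have := hN n h2.
by move: h3; move: (n.+1%:R^-1) => t; lra.
Qed.

Definition max_set (K : set S2) (u : S2 -> C) : set S2 :=
  [set z | K z /\ forall y, K y -> cabs (u y) <= cabs (u z)].

Lemma max_set_closed K u : sclosed K -> cont_on K u -> sclosed (max_set K u).
Proof.
move=> cK ct x hx.
have Kx : K x by apply: cK => e /hx[y [Ky _] xy]; exists y.
split => // y Ky; apply/ler_addgt0Pr => e e0.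
have [d d0 hd] := ct x Kx _ e0; have [z [Kz hz] xz] := hx d d0.
have := hd z Kz xz; have := hz y Ky; have := cabs_lerB (u z) (u x); rewrite (cabsC (u z)); lra.
Qed.

(* At a maximum of |u| the average of u over Gamma has maximal modulus, so all values agree. *)
Lemma max_set_rigid K u a z g : sclosed K -> fwd_inv G K -> cont_on K u -> cabs a = 1 ->
  (forall z, K z -> M u z = a * u z) -> max_set K u z -> Gam g -> u (g z) = a * u z.
Proof.
move=> cK iK ct a1 eig [Kz hz] Gg.
have hK h : Gam h -> K (h z) by move=> Gh; apply: iK => //; exact: sg_gen.
set m := cabs (u z); set v := a * u z.
have vm : cabs v = m by rewrite /v cabsM a1 mul1r.
have af : admc tau (fun h => u (h z)) by exact: (admc_ev cK ct hK).
pose c : C := (v^*)%C.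
have IGe : IG tau (fun h => complex.Re (c * u (h z))) = m ^+ 2.
  rewrite -[LHS]/(complex.Re (cI (fun h => c * u (h z)))) cI_scale//.
  by rewrite -[cI _]/(M u z) eig// -/v /c conj_mul vm.
have adc : adm tau (fun h => complex.Re (c * u (h z))) by have [] := admc_scale c af.
(* Strict convexity of the disc of radius m: a value away from v loses a definite amount in the
   direction of v. *)
have sq (w : C) : cabs w <= m -> complex.Re (c * w) <= m ^+ 2 - cabs (w - v) ^+ 2 / 2.
  move=> wm; have : cabs w ^+ 2 <= m ^+ 2 by rewrite lerXn2r ?nnegrE ?cabs_ge0.
  have -> : m ^+ 2 = complex.Re v ^+ 2 + complex.Im v ^+ 2 by rewrite -vm cabs_sq.
  rewrite !cabs_sq /c; case: w {wm} => w1 w2; case: (v) => v1 v2 /=; lra.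
apply: contrapT => ne.
have d0 : 0 < cabs (u (g z) - v) by rewrite cabs_gt0 subr_eq0; apply/eqP.
set d := cabs _ in d0.
have d2 : 0 < d / 2 by rewrite divr_gt0.
have [e e0 he] := ct (g z) (hK g Gg) _ d2.
have gap := @IG_gap R tau tauK (fun h => complex.Re (c * u (h z))) g e (m ^+ 2) (m ^+ 2 - (d / 2) ^+ 2 / 2) adc Gg e0.
have p0 := pball_gt0 Gg e0.
have dd : 0 < (d / 2) ^+ 2 by rewrite exprn_gt0.
have : IG tau (fun h => complex.Re (c * u (h z))) <= m ^+ 2 - pball tau g e * (m ^+ 2 - (m ^+ 2 - (d / 2) ^+ 2 / 2)).
  apply: gap; first by move: ((d / 2) ^+ 2) dd => t; lra.
    move=> h Gh; apply: le_trans (sq _ (hz _ (hK h Gh))) _.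
    by rewrite gerBl divr_ge0 ?sqr_ge0.
  move=> h Gh kh; apply: le_trans (sq _ (hz _ (hK h Gh))) _.
  have h1 := he (h z) (hK h Gh) (le_lt_trans (kappa_ge g h z) kh).
  have h2 : d / 2 <= cabs (u (h z) - v).
    have := cabsBD (u (g z)) (u (h z)) v; rewrite -/d; lra.
  have : (d / 2) ^+ 2 <= cabs (u (h z) - v) ^+ 2 by rewrite lerXn2r ?nnegrE ?cabs_ge0// ltW.
  by move: ((d / 2) ^+ 2) (cabs (u (h z) - v) ^+ 2) => t1 t2; lra.
rewrite IGe; move: ((d / 2) ^+ 2) dd => t t0.
have : 0 < pball tau g e * t by rewrite mulr_gt0.
by lra.
Qed.

Lemma max_set_inv K u a : sclosed K -> fwd_inv G K -> cont_on K u -> cabs a = 1 ->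
  (forall z, K z -> M u z = a * u z) -> fwd_inv G (max_set K u).
Proof.
move=> cK iK ct a1 eig g; elim => [h Gh z hz|f h _ hf _ hh z hz]; last exact/hf/hh.
have [Kz mz] := hz; split; first by apply: iK => //; exact: sg_gen.
by move=> y Ky; rewrite (max_set_rigid cK iK ct a1 eig hz Gh) cabsM a1 mul1r; apply: mz.
Qed.

(** A pointwise relation for each generator, not an averaged one; this is what makes products of
    eigenfunctions eigenfunctions again. *)
Definition eigfun (L : set S2) (a : C) (u : S2 -> C) := [/\ cont_on L u, forall z, L z -> u z != 0 &
  forall g, Gam g -> forall z, L z -> u (g z) = a * u z].

Lemma eigfun_of_max K L u a : sclosed K -> fwd_inv G K -> cont_on K u -> cabs a = 1 ->
  (forall z, K z -> M u z = a * u z) -> (exists2 x, K x & u x != 0) -> L `<=` max_set K u ->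
  eigfun L a u.
Proof.
move=> cK iK ct a1 eig [x Kx ux] LE; split.
- move=> z /LE[Kz _] e e0; have [d d0 hd] := ct z Kz e e0; exists d => // y /LE[Ky _].
  exact: hd.
- move=> z /LE[_ hz]; rewrite -cabs_gt0; apply: lt_le_trans (hz x Kx).
  by rewrite cabs_gt0.
- by move=> g Gg z /LE hz; apply: (max_set_rigid cK iK ct a1 eig hz Gg).
Qed.

Lemma minimal_eq L E : minimal_set G L -> E !=set0 -> sclosed E -> fwd_inv G E -> E `<=` L -> L `<=` E.
Proof.
move=> [_ [_ [_ mL]]] E0 cE iE EL; rewrite (mL E) //.
exact: sclosed_dcompact.
Qed.

(** The points where |u| is maximal form a closed invariant set, so all of L, and there
    [max_set_rigid] applies. *)
Lemma Uft_eigfun L u : minimal_set G L -> Uft tau L u -> exists2 a, cabs a = 1 & eigfun L a u.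
Proof.
move=> mL [ct [nz [a [a1 eig]]]]; exists a => //.
have cL := minimal_closed mL; have [L0 [_ [iL _]]] := mL.
apply: (@eigfun_of_max L) => //; apply: (minimal_eq mL).
- by have [z Lz hz] := max_attained L0 cL ct; exists z.
- exact: max_set_closed.
- exact: (max_set_inv cL iL ct a1 eig).
- by move=> z [].
Qed.

Lemma eigfun_Uft L a u : minimal_set G L -> cabs a = 1 -> eigfun L a u -> Uft tau L u.
Proof.
move=> mL a1 [ct nz eig]; split => //; split.
  by have [[z Lz] _] := mL; exists z => //; exact: nz.
exists a; split => // z Lz; rewrite /Mtau (@cI_eq R tau tauK _ (fun=> a * u z)) ?cI_cst//.
by move=> g Gg; apply: eig.
Qed.

Lemma eigfun_prop L a u v : minimal_set G L -> eigfun L a u -> eigfun L a v ->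
  exists c, forall z, L z -> u z = c * v z.
Proof.
move=> mL [cu nu eu] [cv nv ev].
have [[z0 Lz0] [_ [iL _]]] := mL; have cL := minimal_closed mL.
exists (u z0 / v z0) => z Lz; set c := u z0 / v z0.
have : [set z | L z /\ u z = c * v z] z; last by case.
apply: (minimal_eq mL) Lz.
- by exists z0; split => //; rewrite /c divfK// nv.
- move=> x hx; have Lx : L x by apply: cL => e /hx[y [Ly _] xy]; exists y.
  split => //; apply/eqP; rewrite -subr_eq0 -cabs_eq0 eq_le cabs_ge0 andbT.
  apply/ler_addgt0Pr => e e0; rewrite add0r.
  have c1 : 0 < cabs c + 1 by rewrite ltr_wpDl ?cabs_ge0.
  have e2 : 0 < e / 2 by rewrite divr_gt0.
  have e3 : 0 < e / 2 / (cabs c + 1) by rewrite divr_gt0.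
  have [d1 d10 h1] := cu x Lx _ e2; have [d2 d20 h2] := cv x Lx _ e3.
  have [|y [Ly hy]] := hx (Num.min d1 d2); first by rewrite lt_min d10.
  rewrite lt_min => /andP[/(h1 y Ly) k1 /(h2 y Ly) k2].
  have -> : u x - c * v x = (u x - u y) + c * (v y - v x) by rewrite hy; ring.
  apply: le_trans (cabsD _ _) _; rewrite cabsM (cabsC (v y)).
  move: k2; rewrite ltr_pdivlMr// => k2.
  have := cabs_ge0 (v x - v y); lra.
- move=> g; elim => [h Gh x [Lx ux]|f h _ hf _ hh x hx]; last exact/hf/hh.
  split; first by apply: iL => //; exact: sg_gen.
  by rewrite eu// ev// ux; ring.
- by move=> x [].
Qed.

Lemma eigfun_mul L a b u v : minimal_set G L -> eigfun L a u -> eigfun L b v ->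
  eigfun L (a * b) (fun z => u z * v z).
Proof.
move=> mL [cu nu eu] [cv nv ev]; have cL := minimal_closed mL.
split.
- move=> x Lx e e0; have [B1 B10 hB1] := cont_bounded cL cu; have [B2 B20 hB2] := cont_bounded cL cv.
  have e1 : 0 < e / 2 / B2 by rewrite !divr_gt0.
  have e2 : 0 < e / 2 / B1 by rewrite !divr_gt0.
  have [d1 d10 h1] := cu x Lx _ e1; have [d2 d20 h2] := cv x Lx _ e2.
  exists (Num.min d1 d2); first by rewrite lt_min d10.
  move=> y Ly; rewrite lt_min => /andP[/(h1 y Ly) k1 /(h2 y Ly) k2].
  have -> : u x * v x - u y * v y = (u x - u y) * v x + u y * (v x - v y) by ring.
  apply: le_lt_trans (cabsD _ _) _; rewrite !cabsM [e]splitr.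
  move: k1 k2; rewrite (ltr_pdivlMr _ _ B20) (ltr_pdivlMr _ _ B10) => k1 k2; apply: ltrD.
    by apply: le_lt_trans k1; rewrite ler_wpM2l ?cabs_ge0// hB2.
  by rewrite mulrC; apply: le_lt_trans k2; rewrite ler_wpM2l ?cabs_ge0// hB1.
- by move=> z Lz; rewrite mulf_neq0 ?nu ?nv.
- by move=> g Gg z Lz; rewrite eu// ev//; ring.
Qed.

(* Evaluating along an orbit of one generator yields Vandermonde relations. *)
Lemma eigfun_indep L n (a : 'I_n -> C) (u : 'I_n -> S2 -> C) : minimal_set G L ->
  injective a -> (forall i, eigfun L (a i) (u i)) -> lin_indep_on L u.
Proof.
move=> mL inj eig c hc i.
have [[z Lz] [_ [iL _]]] := mL; have [g Gg] := Gam_ex tauK.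
have itL k : L (iter k g z) by elim: k => //= k IH; apply: iL => //; exact: sg_gen.
have itu j k : u j (iter k g z) = a j ^+ k * u j z.
  elim: k => [|k IH]; first by rewrite mul1r.
  by have [_ _ e] := eig j; rewrite /= e// IH exprS mulrA.
have poly_rel (q : {poly C}) : \sum_(j < n) c j * u j z * q.[a j] = 0.
  under eq_bigr do rewrite horner_coef mulr_sumr.
  rewrite exchange_big /= big1// => k _.
  transitivity (q`_k * \sum_(j < n) c j * u j (iter k g z)); last by rewrite hc ?mulr0.
  by rewrite mulr_sumr; apply: eq_bigr => j _; rewrite itu; ring.
(* A polynomial vanishing at every eigenvalue except a i isolates the coefficient c i. *)
pose q := \prod_(j < n | j != i) ('X - (a j)%:P).
have := poly_rel q; rewrite (bigD1 i)//= big1 ?addr0; last first.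
  move=> j ji; rewrite /q horner_prod (bigD1 j)//= hornerXsubC subrr mul0r mulr0 //.
move/eqP; rewrite !mulf_eq0 (_ : (q.[a i] == 0) = false) ?orbF; last first.
  rewrite /q horner_prod; apply/negbTE/prodf_neq0 => j ji.
  by rewrite hornerXsubC subr_eq0; apply: contra ji => /eqP/inj->.
have [_ nz _] := eig i; rewrite (negbTE (nz z Lz)) orbF => /eqP.
by [].
Qed.

(** Multiplication by a permutes the d unitary eigenvalues on L; comparing their product before and
    after gives a^d = 1. *)
Lemma eigfun_root L d a u : minimal_set G L -> dimLS tau L d -> cabs a = 1 -> eigfun L a u -> a ^+ d = 1.
Proof.
move=> mL [[w [wU wI]] wmax] a1 eu.
have ex i : exists b, cabs b = 1 /\ eigfun L b (w i).
  by have [b b1 eb] := Uft_eigfun mL (wU i); exists b.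
have [b hb] := choice ex.
have b_inj : injective b.
  move=> i j bij; apply: contrapT => /eqP ij.
  have [_ ei] := hb i; have [_ ej] := hb j; rewrite bij in ei.
  have [c hc] := eigfun_prop mL ei ej.
  have := wI (fun k => if k == i then 1 else if k == j then - c else 0) _ i.
  rewrite eqxx => H; have /eqP : (1 : C) = 0; last by rewrite oner_eq0.
  apply: H => x Lx; rewrite (bigD1 i)//= (bigD1 j) 1?eq_sym//= big1.
    by rewrite !eqxx eq_sym (negbTE ij) hc//; ring.
  by move=> k /andP[/negbTE ki /negbTE kj]; rewrite ki kj mul0r.
(* A further eigenvalue would give d + 1 independent eigenfunctions, against the maximality of d. *)
have all_b c v : cabs c = 1 -> eigfun L c v -> exists i, b i = c.
  move=> c1 ev; apply: contrapT => /forallNP nb.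
  pose w' (i : 'I_d.+1) := if unlift ord0 i is Some j then w j else v.
  pose b' (i : 'I_d.+1) := if unlift ord0 i is Some j then b j else c.
  have e' i : eigfun L (b' i) (w' i).
    by rewrite /b' /w'; case: (unliftP ord0 i) => [j _|_] //; have [] := hb j.
  apply: (wmax w').
    move=> i; apply: (eigfun_Uft mL) (e' i); rewrite /b'.
    by case: (unliftP ord0 i) => [j _|_] //; have [] := hb j.
  apply: (@eigfun_indep L _ b') => // i j; rewrite /b'.
  case: (unliftP ord0 i) => [i' ->|->]; case: (unliftP ord0 j) => [j' ->|->] //.
  - by move/b_inj ->.
  - by move=> h; case: (nb i').
  - by move=> h; case: (nb j').
have ex2 i : exists j, b j = a * b i.
  have [bi1 ei] := hb i; apply: (all_b _ (fun z => u z * w i z)).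
    by rewrite cabsM a1 bi1 mulr1.
  exact: eigfun_mul.
have [s hs] := choice ex2.
have a0 : a != 0 by rewrite -cabs_gt0 a1.
have s_inj : injective s.
  move=> i j sij; apply: b_inj; apply: (mulfI a0); by rewrite -!hs sij.
have b0 i : b i != 0 by rewrite -cabs_gt0; have [-> _] := hb i.
have p0 : \prod_(i < d) b i != 0 by apply/prodf_neq0 => i _.
apply: (mulIf p0); rewrite mul1r.
rewrite [in RHS](reindex_inj s_inj) /=.
under [RHS]eq_bigr do rewrite hs.
by rewrite big_split /= prodr_const card_ord.
Qed.

Lemma dimLS_gt0 L d : minimal_set G L -> dimLS tau L d -> (0 < d)%N.
Proof.
move=> mL [_ wmax]; rewrite lt0n; apply/eqP => d0; subst d.
have e1 : eigfun L 1 (fun=> 1).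
  split; [|by move=> *; exact: oner_neq0|by move=> *; rewrite mulr1].
  by move=> x Lx e e0; exists 1 => // y _ _; rewrite subrr cabs0.
apply: (wmax (fun=> (fun=> 1))).
  by move=> i; apply: (eigfun_Uft mL _ e1); exact: cabs1.
move=> c hc i; have [[x Lx] _] := mL; have := hc x Lx.
by rewrite (ord1 i) big_ord_recl big_ord0 mulr1 addr0.
Qed.

Lemma prod_dims_gt0 r : prod_dims tau r -> (0 < r)%N.
Proof.
move=> [m [Ls [ds [_ [hm [_ [hd ->]]]]]]].
by apply: prodn_gt0 => i; apply: (dimLS_gt0 (hm i)).
Qed.

(** |u| attains its maximum over the sphere on a whole minimal set. There u restricts to an
    eigenfunction with the same eigenvalue, whose order divides one factor of r. *)
Lemma Uft_period r u : prod_dims tau r -> Uft tau setT u -> 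
  exists a, [/\ cabs a = 1, a ^+ r = 1 & M u = (fun z => a * u z)].
Proof.
move=> [m [Ls [ds [_ [hm [hM [hd ->]]]]]]] [ct [nz [a [a1 eig]]]].
exists a; split => //; last by apply/funext => z; apply: eig.
have cT := @sclosedT R.
have iT : fwd_inv G setT by [].
have [L mL LE] : exists2 L, minimal_set G L & L `<=` max_set setT u.
  apply: closed_inv_minimal.
  - by have [|z Kz hz] := max_attained _ cT ct; [exists None|exists z].
  - exact: max_set_closed.
  - exact: (max_set_inv cT iT ct a1 eig).
have eL := eigfun_of_max cT iT ct a1 eig nz LE.
have [i ei] := hM L mL; subst L.
have := eigfun_root (hm i) (hd i) a1 eL => ad.
by rewrite (bigD1 i)//= exprM ad expr1n.
Qed.

Lemma M_scale (c : C) phi : contC phi -> M (fun z => c * phi z) = (fun z => c * M phi z).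
Proof.
move=> ct; apply/funext => z; rewrite /Mtau cI_scale//; exact: admc_evT.
Qed.

Lemma contC_scale (c : C) phi : contC phi -> contC (fun z => c * phi z).
Proof.
move=> ct; have := contC_lin c 0 ct ct.
by congr cont_on; apply/funext => z; rewrite mul0r addr0.
Qed.

Lemma iterM_eig n (a : C) u : contC u -> M u = (fun z => a * u z) -> iter n M u = (fun z => a ^+ n * u z).
Proof.
move=> ct e; elim: n => [|n IH]; first by apply/funext => z; rewrite mul1r.
rewrite /= IH M_scale// e; apply/funext => z; rewrite exprSr; ring.
Qed.

Lemma contC_sum n (c : 'I_n -> C) (u : 'I_n -> S2 -> C) : (forall i, contC (u i)) ->
  contC (fun z => \sum_(i < n) c i * u i z).
Proof.
elim: n c u => [|n IH] c u ct.
  by move=> x _ e e0; exists 1 => // y _ _; rewrite !big_ord0 subrr cabs0.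
have := contC_lin (c ord_max) 1 (ct ord_max) (IH (fun i => c (widen_ord (leqnSn n) i)) _ (fun i => ct (widen_ord (leqnSn n) i))).
by congr cont_on; apply/funext => z; rewrite big_ord_recr /= mul1r addrC.
Qed.

Lemma M_sum n (c : 'I_n -> C) (u : 'I_n -> S2 -> C) : (forall i, contC (u i)) ->
  M (fun z => \sum_(i < n) c i * u i z) = (fun z => \sum_(i < n) c i * M (u i) z).
Proof.
elim: n c u => [|n IH] c u ct.
  apply/funext => z; rewrite big_ord0 /Mtau (_ : (fun g : S2 -> S2 => _) = (fun=> 0)) ?cI_cst//.
  by apply/funext => g; rewrite big_ord0.
pose c' i := c (widen_ord (leqnSn n) i); pose u' i := u (widen_ord (leqnSn n) i).
have ct' i : contC (u' i) by exact: ct.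
have := M_lin tauK (c ord_max) 1 (ct ord_max) (contC_sum c' ct').
rewrite (IH c' u' ct') => H.
rewrite (_ : (fun z => _) = (fun z => c ord_max * u ord_max z + 1 * \sum_(i < n) c' i * u' i z)).
  by rewrite H; apply/funext => z; rewrite big_ord_recr /= mul1r addrC.
by apply/funext => z; rewrite big_ord_recr /= mul1r addrC.
Qed.

Lemma LSU_cont psi : LSU tau psi -> contC psi.
Proof.
by move=> [n [u [c [hu ->]]]]; apply: contC_sum => i; have [] := hu i.
Qed.

Lemma LSU_M psi : LSU tau psi -> LSU tau (M psi).
Proof.
move=> [n [u [c [hu ->]]]].
have ex i : exists a, forall z, M (u i) z = a * u i z.
  by have [_ [_ [a [_ e]]]] := hu i; exists a => z; exact: e.
have [a ha] := choice ex.
exists n, u, (fun i => c i * a i); split => //.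
rewrite M_sum; last by move=> i; have [] := hu i.
by apply/funext => z; apply: eq_bigr => i _; rewrite ha mulrA.
Qed.

Lemma LSU_period r psi : prod_dims tau r -> LSU tau psi -> iter r M psi = psi.
Proof.
move=> hr [n [u [c [hu ->]]]].
have ct i : contC (u i) by have [] := hu i.
have H k : iter k M (fun z => \sum_(i < n) c i * u i z) = (fun z => \sum_(i < n) c i * iter k M (u i) z).
  elim: k => //= k ->; rewrite M_sum// => i.
  exact: iterM_cont.
rewrite H; apply/funext => z; apply: eq_bigr => i _.
have [a [_ ar e]] := Uft_period hr (hu i).
by rewrite (iterM_eig r (ct i) e) ar mul1r.
Qed.

End UnitaryEigenvalues.

(** * Recurrent functions *)

Section Decomposition.
Context {R : realType} (tau : probability (@RatSpace R) R).
Local Notation C := (@Cx R).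
Local Notation S2 := (@Chat R).
Hypothesis tauK : compactly_supported_on_Rat tau.
Local Notation M := (Mtau tau).
Local Notation contC := (cont_on setT).
Variables (al La K : R) (N : nat).
Hypothesis al0 : 0 < al.
Hypothesis N0 : (0 < N)%N.
Hypothesis K0 : 0 <= K.
Hypothesis La1 : 1 <= La.
Hypothesis LY : forall phi A B, 0 <= A -> holder al A phi -> (forall z, cabs (phi z) <= B) ->
  holder al (A / 2 + K * B) (iter N M phi).
Hypothesis ML : forall phi A, 0 <= A -> holder al A phi -> holder al (A * La) (M phi).
Implicit Types (phi psi eta : S2 -> C).

Lemma holder_mono A A' phi : A <= A' -> holder al A phi -> holder al A' phi.
Proof. by move=> AA h x y; apply: le_trans (h x y) _; rewrite ler_wpM2r ?powR_ge0. Qed.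

Lemma bound_ge0 phi (B : R) : (forall z, cabs (phi z) <= B) -> 0 <= B.
Proof. by move=> h; apply: le_trans (h None); apply: cabs_ge0. Qed.

(** The term 2 (K B) is the fixed point of t -> t / 2 + K B, so it does not grow with k. *)
Lemma LY_iter k phi A B : 0 <= A -> holder al A phi -> (forall z, cabs (phi z) <= B) ->
  holder al (A / 2 ^+ k + 2 * (K * B)) (iter (k * N) M phi).
Proof.
move=> A0 h hB; have B0 := bound_ge0 hB; have KB : 0 <= K * B by rewrite mulr_ge0.
elim: k => [|k IH]; first by apply: holder_mono h; rewrite expr0 divr1 lerDl mulr_ge0.
rewrite mulSn iterD.
have A' : 0 <= A / 2 ^+ k + 2 * (K * B) by rewrite addr_ge0 ?divr_ge0 ?exprn_ge0 ?mulr_ge0.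
apply: holder_mono (LY A' IH (iterM_bound tauK _ (holder_cont al0 h) hB)).
have -> : A / 2 ^+ k.+1 = A / 2 ^+ k / 2 by rewrite exprS; field; rewrite expf_neq0.
by move: (K * B) KB => t; lra.
Qed.

Lemma ML_iter j phi A : 0 <= A -> holder al A phi -> holder al (A * La ^+ j) (iter j M phi).
Proof.
move=> A0 h; elim: j => [|j IH]; first by rewrite expr0 mulr1.
rewrite exprSr mulrA; apply: ML => //; rewrite mulr_ge0// exprn_ge0//.
exact: le_trans La1.
Qed.

Lemma holder_split n phi A B : 0 <= A -> holder al A phi -> (forall z, cabs (phi z) <= B) ->
  holder al (A * La ^+ N / 2 ^+ (n %/ N) + 2 * (K * B)) (iter n M phi).
Proof.
move=> A0 h hB; rewrite {2}(divn_eq n N) iterD.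
have ct := holder_cont al0 h.
have La0 : 0 <= La by apply: le_trans La1.
apply: LY_iter; first by rewrite mulr_ge0 ?exprn_ge0.
  apply: (@holder_mono (A * La ^+ (n %% N))); last exact: ML_iter.
  by rewrite ler_wpM2l// ler_weXn2l// ltnW// ltn_mod.
exact: iterM_bound.
Qed.

Definition C0 : R := La ^+ N + 2 * K.

Lemma C0_ge1 : 1 <= C0.
Proof. by rewrite /C0 -[leLHS]addr0 lerD ?exprn_ege1 ?mulr_ge0. Qed.

Lemma holder_iter n phi A B : 0 <= A -> holder al A phi -> (forall z, cabs (phi z) <= B) ->
  holder al (C0 * (A + B)) (iter n M phi).
Proof.
move=> A0 h hB; apply: holder_mono (holder_split n A0 h hB).
have B0 := bound_ge0 hB.
have L0 : 0 <= La ^+ N by rewrite exprn_ge0// (le_trans _ La1).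
have h1 : A * La ^+ N / 2 ^+ (n %/ N) <= A * La ^+ N.
  by rewrite ler_pdivrMr ?exprn_gt0// ler_peMr ?mulr_ge0// exprn_ege1// ler1n.
rewrite /C0.
have := mulr_ge0 L0 B0; have := mulr_ge0 K0 A0; have := mulr_ge0 K0 B0.
have -> : (La ^+ N + 2 * K) * (A + B) = A * La ^+ N + La ^+ N * B + 2 * (K * A) + 2 * (K * B) by ring.
by move: (La ^+ N * B) (K * A) (K * B) => a b c; lra.
Qed.

(** The Arzela-Ascoli theorem along an ultrafilter: the common Hölder constant passes to the
    pointwise limit and makes the convergence uniform. *)
Lemma func_cluster (U : set_system nat) (UU : UltraFilter U) (f : nat -> S2 -> C) (A B : R) :
  (forall n, holder al A (f n)) -> (forall n z, cabs (f n z) <= B) ->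
  exists psi, [/\ holder al A psi, forall z, cabs (psi z) <= B &
    forall e : R, 0 < e -> U [set n | forall z, cabs (f n z - psi z) < e]].
Proof.
move=> hA hB.
have ex z : exists l : C, forall e : R, 0 < e -> U [set n | cabs (f n z - l) < e].
  by apply: (@ultra_cx_lim R nat U UU (fun n => f n z) B).
have [psi hpsi] := choice ex.
have hh : holder al A psi.
  move=> x y; apply/ler_addgt0Pr => e e0; have e2 : 0 < e / 2 by rewrite divr_gt0.
  have [n [/= h1 h2]] := ultra_ex (filterI (hpsi x _ e2) (hpsi y _ e2)).
  have -> : psi x - psi y = (f n x - f n y) - ((f n x - psi x) - (f n y - psi y)) by ring.
  apply: le_trans (cabsB _ _) _; have := hA n x y.
  by have := cabsB (f n x - psi x) (f n y - psi y); lra.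
exists psi; split => //.
- move=> z; apply/ler_addgt0Pr => e e0; have [n /= hn] := ultra_ex (hpsi z e e0).
  by have := cabs_lerB (psi z) (f n z); rewrite cabsC; have := hB n z; lra.
move=> e e0.
have hu : forall z, [set: S2] z -> forall e : R, 0 < e -> exists2 del : R, 0 < del &
    forall y, [set: S2] y -> sdist z y < del -> forall i, [set: nat] i -> cabs (f i y - psi y) < cabs (f i z - psi z) + e.
  move=> z _ d d0; have [del del0 hd] := pow_modulus (2 * A) al0 d0.
  exists del => // y _ zy n _; have := hd z y zy; have := hA n z y; have := hh z y.
  have -> : f n y - psi y = (f n z - psi z) + ((psi z - psi y) - (f n z - f n y)) by ring.
  have := cabsD (f n z - psi z) ((psi z - psi y) - (f n z - f n y)).
  have := cabsB (psi z - psi y) (f n z - f n y).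
  have -> : 2 * A * sdist z y `^ al = A * sdist z y `^ al + A * sdist z y `^ al by ring.
  by move: (A * sdist z y `^ al) => t; lra.
have UT : U setT by exact: filterT.
have H := @ultra_uniform R nat U UU setT setT (fun n z => cabs (f n z - psi z)) (@sclosedT R)
  UT (fun z _ d d0 => hpsi z d d0) hu e e0.
by apply: filterS H => n hn z; exact: hn.
Qed.

(** M - a; [dMs] is then a monic polynomial in M, presented by its list of roots. *)
Definition dM (a : C) phi : S2 -> C := fun z => M phi z - a * phi z.
Definition dMs (s : seq C) phi : S2 -> C := foldr dM phi s.

Lemma dM_linE a phi : dM a phi = (fun z => 1 * M phi z + (- a) * phi z).
Proof. by apply/funext => z; rewrite /dM mul1r mulNr. Qed.

Lemma dM_cont a phi : contC phi -> contC (dM a phi).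
Proof. by move=> ct; rewrite dM_linE; apply: contC_lin => //; apply: M_cont. Qed.

Lemma dMs_cont s phi : contC phi -> contC (dMs s phi).
Proof. by move=> ct; elim: s => //= a s IH; apply: dM_cont. Qed.

Lemma dM_lin a (b c : C) phi psi : contC phi -> contC psi ->
  dM a (fun z => b * phi z + c * psi z) = (fun z => b * dM a phi z + c * dM a psi z).
Proof.
by move=> c1 c2; apply/funext => z; rewrite /dM M_lin//; ring.
Qed.

Lemma dMs_lin s (b c : C) phi psi : contC phi -> contC psi ->
  dMs s (fun z => b * phi z + c * psi z) = (fun z => b * dMs s phi z + c * dMs s psi z).
Proof.
by move=> c1 c2; elim: s => //= a s ->; rewrite dM_lin//; apply: dMs_cont.
Qed.

Lemma dM_M a phi : contC phi -> dM a (M phi) = M (dM a phi).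
Proof.
move=> ct; rewrite (dM_linE a phi) M_lin//; last exact: M_cont.
by apply/funext => z; rewrite /dM mul1r mulNr.
Qed.

Lemma dMs_iterM s n phi : contC phi -> dMs s (iter n M phi) = iter n M (dMs s phi).
Proof.
move=> ct; elim: n => //= n <-.
have ctn : contC (iter n M phi) by exact: iterM_cont.
elim: s => //= a s ->; rewrite dM_M//; exact: dMs_cont.
Qed.

Lemma dM_comm a b phi : contC phi -> dM a (dM b phi) = dM b (dM a phi).
Proof.
move=> ct; have cM := M_cont tauK ct.
rewrite (dM_linE a (dM b phi)) (dM_linE b (dM a phi)) (dM_linE a phi) (dM_linE b phi).
by rewrite !M_lin//; apply/funext => z; ring.
Qed.

Lemma dMs_rem a s phi : contC phi -> a \in s -> dMs s phi = dM a (dMs (rem a s) phi).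
Proof.
move=> ct; elim: s => // b s IH; rewrite inE /=; case: eqVneq => [->|ab] /=; first by rewrite ?eqxx.
by move=> /IH ->; rewrite ?(negbTE ab) /= dM_comm//; apply: dMs_cont.
Qed.

Lemma dM_bound a phi (B : R) : contC phi -> (forall z, cabs (phi z) <= B) ->
  forall z, cabs (dM a phi z) <= (1 + cabs a) * B.
Proof.
move=> ct hB z; rewrite /dM; apply: le_trans (cabsB _ _) _; rewrite mulrDl mul1r cabsM.
by rewrite lerD ?ler_wpM2l ?cabs_ge0//; apply: M_bound.
Qed.

Lemma dMs_bound s : exists2 D : R, 0 < D & forall phi (B : R), contC phi -> (forall z, cabs (phi z) <= B) ->
  forall z, cabs (dMs s phi z) <= D * B.
Proof.
elim: s => [|a s [D D0 IH]]; first by exists 1 => // phi B _ h z; rewrite mul1r.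
exists ((1 + cabs a) * D); first by rewrite mulr_gt0// ltr_wpDr ?cabs_ge0.
move=> phi B ct h z; rewrite -mulrA; apply: dM_bound; first exact: dMs_cont.
by move=> w; apply: IH.
Qed.

Lemma dMs_holder s phi A : 0 <= A -> holder al A phi -> exists2 A', 0 <= A' & holder al A' (dMs s phi).
Proof.
move=> A0 h; elim: s => [|a s [A' A'0 IH]]; first by exists A.
have La0 : 0 <= La by apply: le_trans La1.
exists (A' * La + cabs a * A'); first by rewrite addr_ge0 ?mulr_ge0 ?cabs_ge0.
move=> x y /=; rewrite /dM.
have -> : M (dMs s phi) x - a * dMs s phi x - (M (dMs s phi) y - a * dMs s phi y) =
  (M (dMs s phi) x - M (dMs s phi) y) - a * (dMs s phi x - dMs s phi y) by ring.
apply: le_trans (cabsB _ _) _; rewrite mulrDl lerD//; first exact: ML.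
by rewrite cabsM -mulrA ler_wpM2l ?cabs_ge0// IH.
Qed.

Lemma dMs_eig s a phi : contC phi -> M phi = (fun z => a * phi z) ->
  dMs s phi = (fun z => (\prod_(b <- s) (a - b)) * phi z).
Proof.
move=> ct e; elim: s => [|b s IH /=]; first by apply/funext => z; rewrite big_nil mul1r.
rewrite IH; apply/funext => z; rewrite /dM M_scale// e big_cons; ring.
Qed.

Definition recurrent psi := forall e : R, 0 < e -> forall n0, exists2 m, (n0 <= m)%N &
  forall z, cabs (iter m M psi z - psi z) <= e.

Lemma recurrent_dMs s psi : contC psi -> recurrent psi -> recurrent (dMs s psi).
Proof.
move=> ct rec e e0 n0; have [D D0 hD] := dMs_bound s.
have [|m nm hm] := rec (e / D) _ n0; first by rewrite divr_gt0.
exists m => // z; rewrite -dMs_iterM//.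
have ctm : contC (iter m M psi) by exact: iterM_cont.
have := dMs_lin s 1 (-1) ctm ct => E.
have -> : dMs s (iter m M psi) z - dMs s psi z = dMs s (fun z => 1 * iter m M psi z + -1 * psi z) z.
  by rewrite E; ring.
have -> : e = D * (e / D) by field; rewrite gt_eqF.
apply: hD; first exact: contC_lin.
by move=> w; rewrite mul1r mulN1r.
Qed.

(** |a| > 1 contradicts boundedness of the orbit, |a| < 1 contradicts the late returns. *)
Lemma recurrent_eig a eta : contC eta -> recurrent eta -> M eta = (fun z => a * eta z) ->
  (exists z, eta z != 0) -> cabs a = 1.
Proof.
move=> ct rec e [z nz]; have nz0 : 0 < cabs (eta z) by rewrite cabs_gt0.
have it n : iter n M eta z = a ^+ n * eta z by rewrite (iterM_eig tauK n ct e).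
have [B B0 hB] := cont_bounded (@sclosedT R) ct.
apply/eqP; rewrite eq_le; apply/andP; split; rewrite leNgt; apply/negP => ha.
- have a0 : 0 < cabs a by apply: lt_trans ha.
  have [||n hn] := @pow_small R (cabs a)^-1 (cabs (eta z) / B).
  + by rewrite invr_ge0 ltW//= invf_lt1.
  + by rewrite divr_gt0.
  have := iterM_bound tauK n ct (fun z => hB z I) z; rewrite it cabsM cabsX.
  apply/negP; rewrite -ltNge.
  move: hn; rewrite exprVn ltr_pdivlMr// mulrC ltr_pdivrMr ?exprn_gt0//.
  by rewrite mulrC.
- have [||n hn] := @pow_small R (cabs a) 2^-1.
  + by rewrite cabs_ge0.
  + by rewrite invr_gt0.
  have [|m nm hm] := rec (cabs (eta z) / 4) _ n; first by rewrite divr_gt0.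
  have := hm z; rewrite it.
  have am : cabs (a ^+ m) < 2^-1.
    rewrite cabsX; apply: le_lt_trans hn; apply: ler_wiXn2l => //; first exact: cabs_ge0.
    exact: ltW.
  have -> : a ^+ m * eta z - eta z = - ((1 - a ^+ m) * eta z) by ring.
  rewrite cabsN cabsM; have := cabs_lerB 1 (a ^+ m); rewrite cabs1 => h1.
  apply/negP; rewrite -ltNge.
  have : 2^-1 * cabs (eta z) < cabs (1 - a ^+ m) * cabs (eta z) by rewrite ltr_pM2r//; lra.
  lra.
Qed.

(** A Jordan block would make the iterates of eta' grow linearly, while M does not increase the sup
    norm. *)
Lemma no_jordan a eta eta' : contC eta' -> contC eta -> cabs a = 1 ->
  M eta = (fun z => a * eta z) -> M eta' = (fun z => a * eta' z + eta z) -> forall z, eta z = 0.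
Proof.
move=> ct' ct a1 e e' z.
have it n : iter n.+1 M eta' = (fun z => a ^+ n.+1 * eta' z + (n.+1%:R * a ^+ n) * eta z).
  elim: n => [|n IH]; first by rewrite /= e'; apply/funext => w; rewrite expr1 expr0 mulr1 mul1r.
  rewrite [LHS]/= -[M (iter n M eta')]/(iter n.+1 M eta') IH M_lin// e e'.
  apply/funext => w; rewrite !exprS -natr1; ring.
have [B B0 hB] := cont_bounded (@sclosedT R) ct'.
apply/eqP; rewrite -cabs_eq0 eq_le cabs_ge0 andbT leNgt; apply/negP => nz.
have [n hn] : exists n, 2 * B < n.+1%:R * cabs (eta z).
  exists (Num.bound (2 * B / cabs (eta z))).
  rewrite -ltr_pdivrMr//; apply: lt_trans (archi_boundP _) _; first by rewrite divr_ge0 ?mulr_ge0 ?ltW.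
  by rewrite ltr_nat.
have h1 := iterM_bound tauK n.+1 ct' (fun z => hB z I) z; rewrite it in h1.
have h2 : cabs ((n.+1%:R * a ^+ n) * eta z) = n.+1%:R * cabs (eta z).
  rewrite !cabsM cabsX a1 expr1n mulr1; congr (_ * _).
  by rewrite -[n.+1%:R](rmorph_nat (real_complex R)) cabs_real normr_nat.
have h3 : cabs (a ^+ n.+1 * eta' z) <= B by rewrite cabsM cabsX a1 expr1n mul1r hB.
have : cabs ((n.+1%:R * a ^+ n) * eta z) <= 2 * B.
  have -> : n.+1%:R * a ^+ n * eta z = (a ^+ n.+1 * eta' z + n.+1%:R * a ^+ n * eta z) - a ^+ n.+1 * eta' z by ring.
  by apply: le_trans (cabsB _ _) _; lra.
by rewrite h2 leNgt hn.
Qed.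

Lemma LSU_add psi1 psi2 : LSU tau psi1 -> LSU tau psi2 -> LSU tau (fun z => psi1 z + psi2 z).
Proof.
move=> [n1 [u1 [c1 [h1 ->]]]] [n2 [u2 [c2 [h2 ->]]]].
exists (n1 + n2)%N, (fun i => match fintype.split i with inl j => u1 j | inr k => u2 k end),
  (fun i => match fintype.split i with inl j => c1 j | inr k => c2 k end); split.
  by move=> i; case: (fintype.split i).
apply/funext => z; rewrite big_split_ord /=; congr (_ + _); apply: eq_bigr => i _.
  by rewrite -[lshift n2 i]/(unsplit (inl i)) unsplitK.
by rewrite -[rshift n1 i]/(unsplit (inr i)) unsplitK.
Qed.

Lemma LSU_eig (c a : C) eta : contC eta -> cabs a = 1 -> M eta = (fun z => a * eta z) ->
  LSU tau (fun z => c * eta z).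
Proof.
move=> ct a1 e; case: (pselect (exists z, eta z != 0)) => [[z nz]|nz].
  exists 1%N, (fun=> eta), (fun=> c); split; last by apply/funext => w; rewrite big_ord1.
  move=> _; split => //; split; first by exists z.
  by exists a; split => // w _; rewrite e.
exists 0%N, (fun=> eta), (fun=> c); split; first by case.
apply/funext => w; rewrite big_ord0; have [->|ne] := eqVneq (eta w) 0; first by rewrite mulr0.
by case: nz; exists w.
Qed.

Lemma LSU_of_dMs s psi : uniq s -> (forall a, a \in s -> cabs a = 1) -> contC psi ->
  (forall z, dMs s psi z = 0) -> LSU tau psi.
Proof.
elim: s psi => [|a s IH] psi /=.
  move=> _ _ _ h; exists 0%N, (fun=> psi), (fun=> 0); split; first by case.
  by apply/funext => z; rewrite big_ord0.
move=> /andP[nas us] h1 ct h0; set eta := dMs s psi.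
have cte : contC eta by exact: dMs_cont.
have e : M eta = (fun z => a * eta z).
  by apply/funext => z; apply/eqP; rewrite -subr_eq0; apply/eqP; exact: h0.
(* The remaining factors act on the eigenfunction eta as c; subtracting c^-1 eta from psi leaves a
   function annihilated by s alone. *)
set c := \prod_(b <- s) (a - b).
have c0 : c != 0.
  rewrite prodf_seq_neq0; apply/allP => b bs; rewrite /= subr_eq0.
  by apply: contraNneq nas => ->.
have a1 : cabs a = 1 by apply: h1; rewrite mem_head.
have -> : psi = (fun z => (1 * psi z + - c^-1 * eta z) + c^-1 * eta z).
  by apply/funext => z; ring.
apply: LSU_add; last exact: LSU_eig e.
apply: IH => //; first by move=> b bs; apply: h1; rewrite inE bs orbT.
  exact: contC_lin.
move=> z; rewrite dMs_lin// (dMs_eig s cte e) -/c -/eta mul1r mulNr mulrA mulVf// mul1r subrr //.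
Qed.

(** Linear algebra produces a polynomial in M by its coefficients, the spectral argument needs its
    roots; [evM_prod] links the two forms. *)
Definition evM (p : {poly C}) phi : S2 -> C := fun z => \sum_(i < size p) p`_i * iter i M phi z.

Lemma evM_wide n (p : {poly C}) phi z : (size p <= n)%N -> evM p phi z = \sum_(i < n) p`_i * iter i M phi z.
Proof.
move=> sn; rewrite /evM (big_ord_widen _ (fun i => p`_i * iter i M phi z) sn).
rewrite [RHS](bigID (fun i : 'I_n => (i < size p)%N)) /= [X in _ = _ + X]big1 ?addr0//.
by move=> i; rewrite -leqNgt => h; rewrite nth_default ?mul0r.
Qed.

Lemma evM_XsubC a (p : {poly C}) phi : contC phi -> evM (('X - a%:P) * p) phi = dM a (evM p phi).
Proof.
move=> ct; apply/funext => z.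
have sz : (size (('X - a%:P) * p)%R <= (size p).+1)%N.
  by apply: leq_trans (size_polyMleq _ _) _; rewrite size_XsubC.
rewrite (evM_wide _ _ sz) /dM {1}/evM (M_sum tauK); last by move=> i; exact: iterM_cont.
under eq_bigr => i _ do rewrite mulrBl coefB coefXM coefCM mulrBl.
rewrite sumrB; congr (_ - _).
  by rewrite big_ord_recl /= mul0r add0r; apply: eq_bigr => i _.
rewrite (evM_wide phi z (leqnSn (size p))) mulr_sumr.
by apply: eq_bigr => i _; rewrite mulrA.
Qed.

Lemma evM_prod s phi : contC phi -> evM (\prod_(a <- s) ('X - a%:P)) phi = dMs s phi.
Proof.
move=> ct; elim: s => [|a s IH].
  rewrite big_nil; apply/funext => z; rewrite /evM size_poly1 big_ord1 coefC eqxx mul1r //.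
by rewrite big_cons evM_XsubC// IH.
Qed.

Lemma evM_scale (c : C) (p : {poly C}) phi : evM (c *: p) phi = (fun z => c * evM p phi z).
Proof.
apply/funext => z; rewrite (evM_wide _ _ (size_scale_leq c p)) /evM mulr_sumr.
by apply: eq_bigr => i _; rewrite coefZ mulrA.
Qed.

(** At late return times the A-term of [holder_split] has decayed, so the Hölder constant is linear
    in the sup norm. *)
Lemma recurrent_holder eta A B : 0 <= A -> holder al A eta -> (forall z, cabs (eta z) <= B) ->
  recurrent eta -> holder al (2 * (K * B)) eta.
Proof.
move=> A0 h hB rec x y; apply/ler_addgt0Pr => e e0.
have e4 : 0 < e / 4 by rewrite divr_gt0.
set D := A * La ^+ N * sdist x y `^ al.
have D0 : 0 <= D by rewrite !mulr_ge0 ?powR_ge0// exprn_ge0// (le_trans _ La1).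
have [||k hk] := @pow_small R 2^-1 (e / 4 / (D + 1)); first by lra.
  by rewrite divr_gt0// ltr_wpDl.
have [m mk hm] := rec _ e4 (k * N)%N.
have h1 := holder_split m A0 h hB x y.
have h2 := hm x; have h3 := hm y.
have -> : eta x - eta y = (iter m M eta x - iter m M eta y) - ((iter m M eta x - eta x) - (iter m M eta y - eta y)) by ring.
apply: le_trans (cabsB _ _) _.
have := cabsB (iter m M eta x - eta x) (iter m M eta y - eta y).
rewrite mulrDl in h1.
have : A * La ^+ N / 2 ^+ (m %/ N) * sdist x y `^ al <= e / 4.
  have -> : A * La ^+ N / 2 ^+ (m %/ N) * sdist x y `^ al = D * 2^-1 ^+ (m %/ N).
    by rewrite /D exprVn; ring.
  apply: (@le_trans _ _ (D * 2^-1 ^+ k)).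
    rewrite ler_wpM2l//; apply: ler_wiXn2l; [by rewrite invr_ge0|by rewrite invf_le1// ler1n|].
    by rewrite leq_divRL.
  move: hk; rewrite ltr_pdivlMr ?ltr_wpDl// => hk; apply: ltW; apply: le_lt_trans hk.
  by rewrite mulrC ler_wpM2l ?lerDl// exprn_ge0// invr_ge0.
by move: h1 h2 h3; move: (2 * (K * B) * _) => t; lra.
Qed.

Lemma finite_net (d : R) : 0 < d -> exists s : seq S2, forall x, exists2 z, z \in s & sdist z x < d.
Proof.
move=> d0.
have [F fF [_ hF]] := dcompact_net (@sdist_triangle R) (@sdistxx R) d0 (sclosed_dcompact (@sclosedT R)).
have /finite_seqP[s es] := fF.
exists s => x; have [z Fz zx] := hF x I; exists z => //.
by move: Fz; rewrite es.
Qed.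

(* Recurrent Hoelder functions are controlled by their values on a finite net,
   hence the orbit of psi satisfies a linear recurrence. *)
Lemma annihilating_seq psi A : 0 <= A -> holder al A psi -> recurrent psi ->
  exists s : seq C, forall z, dMs s psi z = 0.
Proof.
move=> A0 h rec; have ct := holder_cont al0 h.
have h2 : 0 < 2^-1 :> R by rewrite invr_gt0.
have [d d0 hd] := pow_modulus (2 * K) al0 h2.
have [zs hzs] := finite_net d0.
set m := size zs.
(* m + 1 iterates evaluated at m net points are linearly dependent. *)
pose E : 'M[C]_(m.+1, m) := \matrix_(i, j) iter i M psi (nth None zs j).
have : kermx E != 0.
  by rewrite -mxrank_eq0 mxrank_ker subn_eq0 -ltnNge ltnS rank_leq_col.
move=> /rowV0Pn[v /sub_kermxP vE v0].
pose p : {poly C} := \poly_(i < m.+1) v 0 (inord i).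
have p0 : p != 0.
  apply: contra v0 => /eqP p0; apply/eqP/rowP => i; rewrite !mxE.
  by have := coef_poly m.+1 (fun i => v 0 (inord i)) i; rewrite -/p p0 coef0 ltn_ord inord_val.
have pz z : z \in zs -> evM p psi z = 0.
  move=> zzs; rewrite (evM_wide _ _ (size_poly m.+1 _)).
  have zm : (index z zs < m)%N by rewrite index_mem.
  have /rowP/(_ (Ordinal zm)) := vE; rewrite !mxE => vz; apply: etrans vz.
  apply: eq_bigr => i _; rewrite mxE /= nth_index// coef_poly ltn_ord inord_val //.
have [rs ep] := closed_field_poly_normal p.
have l0 : lead_coef p != 0 by rewrite lead_coef_eq0.
exists rs; set eta := dMs rs psi.
have etaz z : z \in zs -> eta z = 0.
  move=> /pz; rewrite ep evM_scale evM_prod// -/eta => /eqP.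
  by rewrite mulf_eq0 (negbTE l0) => /eqP.
have [A' A'0 hA'] := dMs_holder rs A0 h.
have rece := recurrent_dMs rs ct rec.
have [B B0 hB] := cont_bounded (@sclosedT R) (holder_cont al0 hA').
have halve (b : R) : (forall z, cabs (eta z) <= b) -> forall z, cabs (eta z) <= b / 2.
  move=> hb x; have [z zzs zx] := hzs x; have b0 := bound_ge0 hb.
  have := recurrent_holder A'0 hA' hb rece z x; rewrite -/eta etaz// sub0r cabsN => H.
  apply: le_trans H _; have := hd z x zx.
  have -> : 2 * (K * b) * sdist z x `^ al = b * (2 * K * sdist z x `^ al) by ring.
  by move=> /ltW H; rewrite ler_wpM2l.
have small n : forall z, cabs (eta z) <= B * 2^-1 ^+ n.
  elim: n => [z|n IH]; first by rewrite expr0 mulr1 hB.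
  by rewrite exprSr mulrA; apply: halve.
move=> z; apply/eqP; rewrite -cabs_eq0 eq_le cabs_ge0 andbT; apply/ler_addgt0Pr => e e0; rewrite add0r.
have [||n hn] := @pow_small R 2^-1 (e / B); first by lra.
  by rewrite divr_gt0.
by apply: le_trans (small n z) _; move: hn; rewrite ltr_pdivlMr// mulrC => /ltW.
Qed.

(** With an annihilating list of minimal length, each root has a nonzero eigenfunction and so
    modulus 1, and a repeated root would be a Jordan block. *)
Lemma recurrent_LSU psi A : 0 <= A -> holder al A psi -> recurrent psi -> LSU tau psi.
Proof.
move=> A0 h rec; have ct := holder_cont al0 h.
have [s0 hs0] := annihilating_seq A0 h rec.
have exn : exists n, `[< exists2 s : seq C, size s = n & forall z, dMs s psi z = 0 >].
  by exists (size s0); apply/asboolP; exists s0.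
have [n /asboolP[s sn hs] minn] := ex_minnP exn.
have min s' : (forall z, dMs s' psi z = 0) -> (size s <= size s')%N.
  by move=> h'; rewrite sn; apply: minn; apply/asboolP; exists s'.
have key a : a \in s -> [/\ contC (dMs (rem a s) psi),
    M (dMs (rem a s) psi) = (fun z => a * dMs (rem a s) psi z) & exists z, dMs (rem a s) psi z != 0].
  move=> as_; split; first exact: dMs_cont.
    apply/funext => z; apply/eqP; rewrite -subr_eq0; apply/eqP.
    by have := hs z; rewrite (dMs_rem ct as_).
  apply: contrapT => /forallNP nz.
  have : (size s <= size (rem a s))%N.
    by apply: min => z; apply/eqP; apply: contrapT => /negP; apply: nz.
  by rewrite size_rem// leqNgt prednK ?leqnn//; case: (s) as_.
have unit a : a \in s -> cabs a = 1.
  move=> /key[c1 e1 z1]; apply: (recurrent_eig c1 _ e1 z1).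
  exact: recurrent_dMs.
apply: (@LSU_of_dMs s) => //.
rewrite -[uniq s]negbK; apply/negP => /negP nu.
have [a as_ ars] : exists2 a, a \in s & a \in rem a s.
  apply: contrapT => nex; suff us : uniq s by rewrite us in nu.
  elim: (s) nex => // b t IH nex /=.
  apply/andP; split.
    apply/negP => bt; apply: nex; exists b; first by rewrite mem_head.
    by rewrite /= eqxx.
  apply: IH => -[a at_ art]; apply: nex; exists a; first by rewrite inE at_ orbT.
  by rewrite /=; case: eqVneq => // _; rewrite inE art orbT.
have [c1 e1 [z nz]] := key a as_.
have erem : dMs (rem a s) psi = dM a (dMs (rem a (rem a s)) psi) by exact: dMs_rem.
have c2 : contC (dMs (rem a (rem a s)) psi) by exact: dMs_cont.
have := no_jordan c2 c1 (unit a as_) e1.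
have -> : M (dMs (rem a (rem a s)) psi) = (fun z => a * dMs (rem a (rem a s)) psi z + dMs (rem a s) psi z).
  by rewrite erem; apply/funext => w; rewrite /dM; ring.
by move=> /(_ erefl z) e; rewrite e eqxx in nz.
Qed.

Variable r : nat.
Hypothesis hr : prod_dims tau r.

(** The limit psi of the orbit along an ultrafilter is recurrent, but it is the recurrent part of
    phi only up to a phase, which the residue of the time modulo r corrects. *)
Lemma decomposition phi A B : 0 <= A -> holder al A phi -> (forall z, cabs (phi z) <= B) ->
  exists psi, LSU tau psi /\ B0 tau (fun z => phi z - psi z).
Proof.
move=> A0 h hB; have ct := holder_cont al0 h.
have r0 := prod_dims_gt0 tauK hr.
have [U [UU hU]] := nat_ultra.
pose f n := iter n M phi.
have C0A : 0 <= C0 * (A + B).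
  have C00 : 0 <= C0 by apply: le_trans C0_ge1.
  by apply: mulr_ge0 => //; apply: addr_ge0 => //; exact: bound_ge0 hB.
have [|psi [h1 h2 hpsi]] := @func_cluster U UU f (C0 * (A + B)) B (fun n => holder_iter n A0 h hB).
  by move=> n z; apply: iterM_bound.
have ctp := holder_cont al0 h1.
have ctf n : contC (f n) by exact: iterM_cont.
have contr n phi1 phi2 (e : R) : contC phi1 -> contC phi2 -> (forall z, cabs (phi1 z - phi2 z) <= e) ->
    forall z, cabs (iter n M phi1 z - iter n M phi2 z) <= e.
  move=> k1 k2 he z; have := iterM_lin tauK n 1 (-1) k1 k2 => E.
  have -> : iter n M phi1 z - iter n M phi2 z = iter n M (fun z => 1 * phi1 z + -1 * phi2 z) z.
    by rewrite E; ring.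
  by apply: iterM_bound => //; [exact: contC_lin|move=> w; rewrite mul1r mulN1r].
have rec : recurrent psi.
  move=> e e0 n0; have e2 : 0 < e / 2 by rewrite divr_gt0.
  have [n1 /= hn1] := ultra_ex (hpsi _ e2).
  have [n2 [/= hn2 n12]] := ultra_ex (filterI (hpsi _ e2) (hU (n1 + n0)%N)).
  exists (n2 - n1)%N; first by rewrite leq_subRL ?(leq_trans _ n12)// leq_addr.
  move=> z; have n1n2 : (n1 <= n2)%N by apply: leq_trans n12; apply: leq_addr.
  have ef : iter (n2 - n1) M (f n1) = f n2 by rewrite /f -iterD subnK.
  have hc := contr (n2 - n1)%N psi (f n1) (e / 2) ctp (ctf n1) _ z.
  have {}hc : cabs (iter (n2 - n1) M psi z - f n2 z) <= e / 2.
    by rewrite -ef; apply: hc => w; rewrite cabsC ltW.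
  by apply: le_trans (cabsBD _ (f n2 z) _) _; rewrite [e]splitr lerD// ltW.
have Lpsi := recurrent_LSU C0A h1 rec.
have [s [sr Us]] : exists s, (s < r)%N /\ U [set n | (n %% r)%N = s].
  have H k : U [set n | (n %% r < k)%N] -> exists s, (s < k)%N /\ U [set n | (n %% r)%N = s].
    elim: k => [H0|k IH H1].
      by have [n] := ultra_ex H0; rewrite /= ltn0.
    case: (in_ultra_setVsetC [set n | (n %% r)%N = k] UU) => [h'|h']; first by exists k.
    have [|s [sk hs]] := IH; last by exists s; split => //; apply: leqW.
    apply: filterS (filterI H1 h') => n [/= a1 a2]; move: a1; rewrite ltnS leq_eqVlt => /orP[/eqP|//].
    by move=> /a2.
  by apply: H; apply: filterS (filterT : U setT) => n _ /=; rewrite ltn_mod.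
(* At times n0 congruent to s, n0 more iterations of this function give back psi, to which the orbit
   of phi is close. *)
exists (iter (r - s) M psi); split.
  by elim: (r - s)%N => //= n IH; apply: LSU_M.
have ctr : contC (iter (r - s) M psi) by exact: iterM_cont.
have per k : iter (k * r) M psi = psi.
  by elim: k => // k IH; rewrite mulSn iterD IH (LSU_period tauK hr Lpsi).
split.
  have := contC_lin 1 (-1) ct ctr; congr cont_on; apply/funext => z; ring.
move=> e e0; have [n0 [/= hn0 ns]] := ultra_ex (filterI (hpsi e e0) Us).
exists n0 => n nn z.
have := iterM_lin tauK n 1 (-1) ct ctr => E.
have -> : iter n M (fun z => phi z - iter (r - s) M psi z) z = iter n M phi z - iter n M (iter (r - s) M psi) z.
  have -> : (fun z => phi z - iter (r - s) M psi z) = (fun z => 1 * phi z + -1 * iter (r - s) M psi z).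
    by apply/funext => w; ring.
  by rewrite E; ring.
have -> : iter n M phi = iter (n - n0) M (f n0) by rewrite /f -iterD subnK.
have -> : iter n M (iter (r - s) M psi) = iter (n - n0) M psi.
  rewrite -{1}(subnK nn) iterD; congr iter; rewrite -iterD.
  have -> : (n0 + (r - s) = (n0 %/ r).+1 * r)%N.
    by rewrite {1}(divn_eq n0 r) ns -addnA subnKC ?(ltnW sr)// mulSn addnC.
  exact: per.
by apply: contr => // w; apply/ltW/hn0.
Qed.

End Decomposition.

(** * Exponential decay *)

Section HolderNorm.
Context {R : realType}.
Local Notation C := (@Cx R).
Local Notation S2 := (@Chat R).
Implicit Types (phi : S2 -> C).

Lemma sdist_gt0 (x y : S2) : x <> y -> 0 < sdist x y :> R.
Proof.
by move=> xy; rewrite lt_neqAle sdist_ge0 andbT eq_sym; apply/eqP => /sdist_eq0.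
Qed.

Lemma holder_norm_le (al A B : R) phi : holder al A phi -> (forall z, cabs (phi z) <= B) ->
  (holder_norm al phi <= (A + B)%:E)%E.
Proof.
move=> h hB; rewrite /holder_norm addrC EFinD; apply: leeD; apply: ge_ereal_sup => u.
  move=> [[x y] /= xy <-]; rewrite lee_fin ler_pdivrMr; first exact: h.
  by rewrite powR_gt0// sdist_gt0.
by move=> [x _ <-]; rewrite lee_fin.
Qed.

Lemma holder_norm_fin (al : R) phi : (holder_norm al phi < +oo)%E -> exists A B : R,
  [/\ 0 <= A, 0 <= B, holder al A phi, forall z, cabs (phi z) <= B & holder_norm al phi = (A + B)%:E].
Proof.
rewrite /holder_norm; set s1 := ereal_sup _; set s2 := ereal_sup _ => fin.
have le1 x : ((cabs (phi x))%:E <= s1)%E by apply: ereal_sup_ubound; exists x.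
have le2 x y : x <> y -> ((cabs (phi x - phi y) / sdist x y `^ al)%:E <= s2)%E.
  by move=> xy; apply: ereal_sup_ubound; exists (x, y).
have s10 : (0 <= s1)%E by apply: le_trans (le1 None); rewrite lee_fin cabs_ge0.
have s20 : (0 <= s2)%E.
  apply: le_trans (le2 None (Some 0) _) => //.
  by rewrite lee_fin divr_ge0 ?cabs_ge0 ?powR_ge0.
have f1 : s1 \is a fin_num.
  by rewrite ge0_fin_numE//; apply: le_lt_trans fin; rewrite leeDl.
have f2 : s2 \is a fin_num.
  by rewrite ge0_fin_numE//; apply: le_lt_trans fin; rewrite leeDr.
exists (fine s2), (fine s1); split.
- exact: fine_ge0.
- exact: fine_ge0.
- move=> x y; case: (pselect (x = y)) => [->|xy].
    by rewrite subrr cabs0 mulr_ge0 ?fine_ge0 ?powR_ge0.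
  rewrite -ler_pdivrMr ?powR_gt0 ?sdist_gt0//.
  by rewrite -lee_fin fineK// le2.
- by move=> z; rewrite -lee_fin fineK.
- by rewrite EFinD !fineK// addeC.
Qed.

End HolderNorm.

(** * Uniform and exponential decay on the complement *)

Section SpectralGap.
Context {R : realType} (tau : probability (@RatSpace R) R).
Local Notation C := (@Cx R).
Local Notation S2 := (@Chat R).
Hypothesis tauK : compactly_supported_on_Rat tau.
Local Notation M := (Mtau tau).
Local Notation contC := (cont_on setT).
Variables (al La K : R) (N : nat).
Hypothesis al0 : 0 < al.
Hypothesis N0 : (0 < N)%N.
Hypothesis K0 : 0 <= K.
Hypothesis La1 : 1 <= La.
Hypothesis LY : forall phi A B, 0 <= A -> holder al A phi -> (forall z, cabs (phi z) <= B) ->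
  holder al (A / 2 + K * B) (iter N M phi).
Hypothesis ML : forall phi A, 0 <= A -> holder al A phi -> holder al (A * La) (M phi).
Implicit Types (phi psi eta : S2 -> C).
Local Notation C0 := (C0 La K N).

Let C00 : 0 <= C0. Proof. by apply: le_trans (C0_ge1 N K0 La1). Qed.

Lemma iterM_sub n phi psi : contC phi -> contC psi ->
  iter n M (fun z => phi z - psi z) = (fun z => iter n M phi z - iter n M psi z).
Proof.
move=> c1 c2; have := iterM_lin tauK n 1 (-1) c1 c2.
have -> : (fun z => 1 * phi z + -1 * psi z) = (fun z => phi z - psi z) by apply/funext => z; ring.
by move=> ->; apply/funext => z; ring.
Qed.

Lemma contC_sub phi psi : contC phi -> contC psi -> contC (fun z => phi z - psi z).
Proof.
move=> c1 c2; have := contC_lin 1 (-1) c1 c2.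
by congr cont_on; apply/funext => z; ring.
Qed.

Lemma iterM_dist n phi psi (e : R) : contC phi -> contC psi -> (forall z, cabs (phi z - psi z) <= e) ->
  forall z, cabs (iter n M phi z - iter n M psi z) <= e.
Proof.
move=> c1 c2 h z; have := iterM_sub n c1 c2 => /(congr1 (@^~ z)) <-.
by apply: iterM_bound => //; exact: contC_sub.
Qed.

(** Counterexamples cluster uniformly at some psi. One member close to psi decays, and since M does
    not increase the sup norm it drags the later members near psi along. *)
Lemma uniform_decay (e : R) : 0 < e -> exists n0, forall eta, holder al 1 eta ->
  (forall z, cabs (eta z) <= 1) -> B0 tau eta -> forall n, (n0 <= n)%N -> forall z, cabs (iter n M eta z) <= e.
Proof.
move=> e0; apply: contrapT => /forallNP nex.
have ex k : exists eta, [/\ holder al 1 eta, forall z, cabs (eta z) <= 1, B0 tau eta &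
    ~ forall z, cabs (iter k M eta z) <= e].
  have /existsNP[eta /not_implyP[h1 /not_implyP[h2 /not_implyP[h3 /existsNP[n /not_implyP[kn h4]]]]]] := nex k.
  exists eta; split => // h5; apply: h4 => z.
  rewrite -(subnK kn) iterD; apply: iterM_bound => //.
  by apply: iterM_cont => //; exact: holder_cont h1.
have [eta heta] := choice ex.
have [U [UU hU]] := nat_ultra.
have hol k : holder al 1 (eta k) by have [] := heta k.
have bd k z : cabs (eta k z) <= 1 by have [_ h _ _] := heta k.
have [psi [h1 h2 hpsi]] := func_cluster al0 UU hol bd.
have ctp := holder_cont al0 h1; have cte k := holder_cont al0 (hol k).
have e4 : 0 < e / 4 by rewrite divr_gt0.
have [k0 hk0] := ultra_ex (hpsi _ e4).
have [_ _ [_ Bk0] _] := heta k0; have [n1 hn1] := Bk0 _ e4.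
have [k [/= hk kn]] := ultra_ex (filterI (hpsi _ e4) (hU n1)).
have [_ _ _ nk] := heta k; apply: nk => z.
have a1 := iterM_dist k (cte k) ctp (fun z => ltW (hk z)) z.
have a2 := iterM_dist k (cte k0) ctp (fun z => ltW (hk0 z)) z.
have a3 := hn1 k kn z.
have -> : iter k M (eta k) z = (iter k M (eta k) z - iter k M psi z) -
   ((iter k M (eta k0) z - iter k M psi z) - iter k M (eta k0) z) by ring.
apply: le_trans (cabsB _ _) _.
have := cabsB (iter k M (eta k0) z - iter k M psi z) (iter k M (eta k0) z); lra.
Qed.

Lemma B0_scale (c : C) eta : B0 tau eta -> B0 tau (fun z => c * eta z).
Proof.
move=> [ct h]; split; first exact: contC_scale.
have it n : iter n M (fun z => c * eta z) = (fun z => c * iter n M eta z).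
  by elim: n => //= n ->; rewrite M_scale//; exact: iterM_cont.
move=> e e0; have c1 : 0 < cabs c + 1 by rewrite ltr_wpDl ?cabs_ge0.
have [|n0 hn0] := h (e / (cabs c + 1)); first by rewrite divr_gt0.
exists n0 => n nn z; rewrite it cabsM.
have := hn0 n nn z; rewrite ler_pdivlMr// => h1; apply: le_trans h1.
by rewrite mulrC ler_wpM2l ?cabs_ge0// lerDl.
Qed.

Lemma B0_iter n eta : B0 tau eta -> B0 tau (iter n M eta).
Proof.
move=> [ct h]; split; first exact: iterM_cont.
move=> e /h[n0 hn0]; exists n0 => m mn z; rewrite -iterD.
by apply: hn0; apply: leq_trans mn (leq_addr _ _).
Qed.

Lemma contraction_B0 : exists n1, (0 < n1)%N /\ forall eta s, 0 <= s -> holder al s eta ->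
  (forall z, cabs (eta z) <= s) -> B0 tau eta ->
  holder al (s / 4) (iter n1 M eta) /\ forall z, cabs (iter n1 M eta z) <= s / 4.
Proof.
have K1 : 0 < 16 * K + 1 by have := K0; lra.
(* The first n0 + 1 steps bring the sup norm below e, so that 2 K e <= 1 / 8; then k Lasota-Yorke
   steps reduce the Hölder constant 2 C0 to 1 / 8. *)
have [||k hk] := @pow_small R 2^-1 (1 / (16 * C0 + 1)); first by lra.
  by rewrite divr_gt0//; have := C00; lra.
set e := Num.min (4^-1) (1 / (16 * K + 1)).
have e0 : 0 < e by rewrite lt_min invr_gt0 ltr0n divr_gt0.
have [e1 e2] : e <= 4^-1 /\ e <= 1 / (16 * K + 1) by rewrite /e !ge_min !lexx orbT.
have [n0 hn0] := uniform_decay e0.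
have unit eta : holder al 1 eta -> (forall z, cabs (eta z) <= 1) -> B0 tau eta ->
    holder al 4^-1 (iter (k * N + n0.+1) M eta) /\ forall z, cabs (iter (k * N + n0.+1) M eta z) <= 4^-1.
  move=> h1 h2 h3; have dec := hn0 eta h1 h2 h3.
  split; last first.
    move=> z; apply: le_trans (dec _ _ z) e1.
    by rewrite addnS ltnW// ltnS leq_addl.
  have a1 := holder_iter tauK al0 N0 K0 La1 LY ML n0.+1 ler01 h1 h2.
  have C2 : 0 <= C0 * (1 + 1) by apply: mulr_ge0.
  rewrite iterD; apply: holder_mono (LY_iter tauK al0 K0 LY k C2 a1 (dec n0.+1 (leqnSn n0))).
  have t1 : C0 * (1 + 1) / 2 ^+ k <= 8^-1.
    move: hk; rewrite exprVn ltr_pdivlMr; last by have := C00; lra.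
    have p0 : 0 < 2 ^+ k :> R by rewrite exprn_gt0.
    rewrite mulrC ltr_pdivrMr// mul1r => hk.
    by rewrite ler_pdivrMr//; have := C00; lra.
  have t2 : 2 * (K * e) <= 8^-1.
    by move: e2; rewrite ler_pdivlMr// => e2; have := e0; move: e2 e1; rewrite mulrDr mulr1; move: (e) => t; lra.
  by lra.
exists (k * N + n0.+1)%N; split; first by rewrite addnS.
(* The case s = 0 is separate because the general one rescales by s^-1. *)
move=> eta s; rewrite le_eqVlt => /predU1P[<-|s0] h1 h2 h3.
  have ct := holder_cont al0 h1.
  have bd := iterM_bound tauK (k * N + n0.+1) ct h2.
  rewrite mul0r; split => // x y; rewrite mul0r; apply: le_trans (cabsB _ _) _.
  by rewrite -[leRHS]addr0 lerD.
have ct := holder_cont al0 h1.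
have sn : (s%:C%C : C) != 0 by rewrite -cabs_gt0 cabs_real normr_gt0 gt_eqF.
have cs : cabs ((s%:C%C)^-1 : C) = s^-1 by rewrite cabsV cabs_real ger0_norm// ltW.
have [||| u1 u2] := unit (fun z => (s%:C%C)^-1 * eta z).
- move=> x y; rewrite -mulrBr cabsM cs mul1r mulrC ler_pdivrMr// mulrC; exact: h1.
- by move=> z; rewrite cabsM cs mulrC ler_pdivrMr// mul1r.
- exact: B0_scale.
set n1 := (k * N + n0.+1)%N in u1 u2 *.
have it : iter n1 M eta = (fun z => s%:C%C * iter n1 M (fun z => (s%:C%C)^-1 * eta z) z).
  have it' n : iter n M (fun z => (s%:C%C)^-1 * eta z) = (fun z => (s%:C%C)^-1 * iter n M eta z).
    by elim: n => //= n ->; rewrite M_scale//; exact: iterM_cont.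
  by apply/funext => z; rewrite it' mulrA mulfV// mul1r.
rewrite it; split.
  move=> x y; rewrite -mulrBr cabsM cabs_real gtr0_norm// -mulrA ler_pM2l// u1.
by move=> z; rewrite cabsM cabs_real gtr0_norm// ler_pM2l.
Qed.

Lemma bernoulli (x : R) n : 0 <= x <= 1 -> 1 - n%:R * x <= (1 - x) ^+ n.
Proof.
move=> /andP[x0 x1]; elim: n => [|n IH]; first by rewrite mul0r subr0 expr0.
rewrite exprS -natr1; apply: (@le_trans _ _ ((1 - x) * (1 - n%:R * x))).
  have : 0 <= n%:R * x * x by rewrite !mulr_ge0.
  by move: (n%:R) => t; lra.
by rewrite ler_wpM2l// subr_ge0.
Qed.

Lemma exponential_decay : exists lam D : R, [/\ 0 < lam < 1, 0 < D & forall eta s, 0 <= s ->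
  holder al s eta -> (forall z, cabs (eta z) <= s) -> B0 tau eta -> forall n,
  (holder_norm al (iter n M eta) <= (D * lam ^+ n * s)%:E)%E].
Proof.
have [n1 [n10 h1]] := contraction_B0.
have nR : 0 < n1%:R :> R by rewrite ltr0n.
(* By Bernoulli's inequality (1 - x)^n1 >= 1 / 4, so lam = 1 - x is slow enough for the factor 1 / 4
   per n1 steps, without extracting a root. The factor 4 in D pays for the incomplete last block. *)
set x : R := 3 / 4 / n1%:R.
have x0 : 0 < x by rewrite !divr_gt0.
have x1 : x <= 3 / 4.
  by rewrite /x ler_pdivrMr// ler_peMr// ?divr_ge0// ler1n.
set lam := 1 - x.
have lam0 : 0 < lam by rewrite /lam; move: (x) x1 => t; lra.
have lam1 : lam < 1 by rewrite /lam; move: (x) x0 => t; lra.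
have lamn : 4^-1 <= lam ^+ n1.
  apply: le_trans (bernoulli n1 _); last by rewrite (ltW x0) (le_trans x1)//; lra.
  by rewrite /x mulrC divfK ?gt_eqF//; lra.
exists lam, (4 * (2 * C0 + 1)); split; first by rewrite lam0.
  by have := C00; lra.
move=> eta s s0 hs bs Bs n.
have it j : holder al (s * (4^-1) ^+ j) (iter (j * n1) M eta) /\
    forall z, cabs (iter (j * n1) M eta z) <= s * (4^-1) ^+ j.
  elim: j => [|j [IH1 IH2]]; first by rewrite expr0 mulr1.
  have sj : 0 <= s * 4^-1 ^+ j by rewrite mulr_ge0// exprn_ge0// invr_ge0.
  have := h1 _ _ sj IH1 IH2 (B0_iter _ Bs).
  by rewrite -iterD -mulSn exprSr mulrA.
set j := (n %/ n1)%N; set i := (n %% n1)%N.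
have en : n = (i + j * n1)%N by rewrite addnC -divn_eq.
have [a1 a2] := it j.
have sj : 0 <= s * 4^-1 ^+ j by rewrite mulr_ge0// exprn_ge0// invr_ge0.
have b1 := holder_iter tauK al0 N0 K0 La1 LY ML i sj a1 a2.
have b2 := iterM_bound tauK i (holder_cont al0 a1) a2.
rewrite -!iterD -en in b1 b2.
apply: le_trans (holder_norm_le b1 b2) _; rewrite lee_fin.
have -> : C0 * (s * 4^-1 ^+ j + s * 4^-1 ^+ j) + s * 4^-1 ^+ j = (2 * C0 + 1) * s * 4^-1 ^+ j by ring.
have -> : 4 * (2 * C0 + 1) * lam ^+ n * s = (2 * C0 + 1) * s * (4 * lam ^+ n) by ring.
apply: ler_wpM2l; first by apply: mulr_ge0 => //; have := C00; lra.
have li : 4^-1 <= lam ^+ i.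
  apply: le_trans lamn _; apply: ler_wiXn2l; [exact: ltW|exact: ltW|].
  by apply: ltnW; rewrite ltn_mod.
have lj : 4^-1 ^+ j <= lam ^+ (j * n1).
  by rewrite mulnC exprM lerXn2r// nnegrE ?exprn_ge0 ?invr_ge0// ltW.
rewrite {1}en exprD mulrA; apply: (@le_trans _ _ (1 * 4^-1 ^+ j)); first by rewrite mul1r.
apply: ler_pM => //.
by move: li; move: (lam ^+ i) => t; lra.
Qed.

Variable r : nat.
Hypothesis hr : prod_dims tau r.

Lemma pi_tauP phi A B : 0 <= A -> holder al A phi -> (forall z, cabs (phi z) <= B) ->
  LSU tau (pi_tau tau phi) /\ B0 tau (fun z => phi z - pi_tau tau phi z).
Proof.
move=> A0 h hB.
have [psi hpsi] := decomposition tauK al0 N0 K0 La1 LY ML hr A0 h hB.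
by apply: (@ClassicalEpsilon.epsilon_spec _ (inhabits (fun _ => 0))
  (fun psi => LSU tau psi /\ B0 tau (fun z => phi z - psi z))); exists psi.
Qed.

(** psi is fixed by M^r, so it is the uniform limit of M^(n r) phi and inherits the bounds common to
    the orbit. *)
Lemma LSU_part_bound phi psi A B : 0 <= A -> holder al A phi -> (forall z, cabs (phi z) <= B) ->
  LSU tau psi -> B0 tau (fun z => phi z - psi z) ->
  holder al (C0 * (A + B)) psi /\ forall z, cabs (psi z) <= B.
Proof.
move=> A0 h hB Lpsi [_ dec]; have ct := holder_cont al0 h; have ctp := LSU_cont Lpsi.
have r0 := prod_dims_gt0 tauK hr.
have per k : iter (k * r) M psi = psi.
  by elim: k => // k IH; rewrite mulSn iterD IH (LSU_period tauK hr Lpsi).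
have approx (e : R) : 0 < e -> exists n, forall z, cabs (iter n M phi z - psi z) <= e.
  move=> /dec[n0 hn0]; exists (n0 * r)%N => z.
  have := hn0 (n0 * r)%N; rewrite leq_pmulr// => /(_ isT z).
  by rewrite iterM_sub// per.
split.
  move=> x y; apply/ler_addgt0Pr => e e0; have e2 : 0 < e / 2 by rewrite divr_gt0.
  have [n hn] := approx _ e2.
  have -> : psi x - psi y = (iter n M phi x - iter n M phi y) - ((iter n M phi x - psi x) - (iter n M phi y - psi y)) by ring.
  apply: le_trans (cabsB _ _) _.
  have := holder_iter tauK al0 N0 K0 La1 LY ML n A0 h hB x y.
  have := cabsB (iter n M phi x - psi x) (iter n M phi y - psi y).
  have := hn x; have := hn y; lra.
move=> z; apply/ler_addgt0Pr => e e0; have [n hn] := approx _ e0.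
have := cabs_lerB (psi z) (iter n M phi z); rewrite cabsC.
by have := hn z; have := iterM_bound tauK n ct hB z; lra.
Qed.

End SpectralGap.

Theorem mainTheorem12 (R : realType) (tau : probability (@RatSpace R) R) :
  compactly_supported_on_Rat tau ->
  Jker (Gtau tau) = set0 ->
  Julia (Gtau tau) !=set0 ->
  (forall L, minimal_set (Gtau tau) L -> L `<=` Fatou (Gtau tau)) ->
  forall r : nat, prod_dims tau r ->
  exists alpha lam C : R,
    [/\ 0 < alpha < 1, 0 < lam < 1 & 0 < C] /\
    forall phi : @Chat R -> @Cx R, (holder_norm alpha phi < +oo)%E ->
    forall n : nat,
      [/\ (holder_norm alpha (fun z => (iter (n * r) (Mtau tau) phi z - pi_tau tau phi z)%R)
            <= (C * lam ^+ n)%R%:E * holder_norm alpha (fun z => (phi z - pi_tau tau phi z)%R))%E,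
          (holder_norm alpha (iter n (Mtau tau) (fun z => (phi z - pi_tau tau phi z)%R))
            <= (C * lam ^+ n)%R%:E * holder_norm alpha (fun z => (phi z - pi_tau tau phi z)%R))%E,
          (holder_norm alpha (iter n (Mtau tau) (fun z => (phi z - pi_tau tau phi z)%R))
            <= (C * lam ^+ n)%R%:E * holder_norm alpha phi)%E
        & (holder_norm alpha (pi_tau tau phi) <= C%:E * holder_norm alpha phi)%E].
Proof.
move=> tauK Jk Jne minF r hr.
have [al [/andP[al0 al1] [N [K [N0 [K0 LY]]]]]] := lasota_yorke tauK Jk Jne minF hr.
have [La La1 ML] := M_holder tauK al0.
have [lam [D [/andP[lam0 lam1] D0 hD]]] := exponential_decay tauK al0 N0 K0 La1 LY ML.
set c0 := C0 La K N.
have c01 : 1 <= c0 := C0_ge1 N K0 La1.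
have r0 := prod_dims_gt0 tauK hr.
(* D measures the decay of phi - pi phi, and c0 + 2 bounds the norms of pi phi and phi - pi phi by
   that of phi. *)
exists al, lam, ((D + 1) * (c0 + 2)); split; first by split; rewrite ?al0 ?lam0// mulr_gt0//; lra.
have lamn n : 0 < lam ^+ n by rewrite exprn_gt0.
have DC : D <= (D + 1) * (c0 + 2) by nra.
move=> phi fin n.
have [A [B [A0 B_0 hA hB hnorm]]] := holder_norm_fin fin.
have [Lpi Bpi] := pi_tauP tauK al0 N0 K0 La1 LY ML hr A0 hA hB.
have [p1 p2] := LSU_part_bound tauK al0 N0 K0 La1 LY ML hr A0 hA hB Lpi Bpi.
rewrite -/c0 in p1.
set psi := pi_tau tau phi in Lpi Bpi p1 p2 *.
have ct := holder_cont al0 hA; have ctp := LSU_cont Lpi.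
have per k : iter (k * r) (Mtau tau) psi = psi.
  by elim: k => // k IH; rewrite mulSn iterD IH (LSU_period tauK hr Lpi).
pose eta z := phi z - psi z.
have he1 : holder al (A + c0 * (A + B)) eta.
  move=> x y; rewrite /eta.
  have -> : phi x - psi x - (phi y - psi y) = (phi x - phi y) - (psi x - psi y) by ring.
  by apply: le_trans (cabsB _ _) _; rewrite mulrDl lerD.
have he2 z : cabs (eta z) <= B + B by apply: le_trans (cabsB _ _) _; rewrite lerD.
have etan : (holder_norm al eta <= ((c0 + 2) * (A + B))%:E)%E.
  apply: le_trans (holder_norm_le he1 he2) _; rewrite lee_fin.
  by have := mulr_ge0 (le_trans ler01 c01) A0; lra.
have [Ae [Be [Ae0 Be0 hAe hBe enorm]]] := holder_norm_fin (le_lt_trans etan (ltry _)).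
have dec m : (holder_norm al (iter m (Mtau tau) eta) <= (D * lam ^+ m)%:E * holder_norm al eta)%E.
  rewrite enorm -EFinM; apply: hD => //; first by rewrite addr_ge0.
  - by apply: holder_mono hAe; rewrite lerDl.
  - by move=> z; apply: le_trans (hBe z) _; rewrite lerDr.
have eta0 : (0 <= holder_norm al eta)%E by rewrite enorm lee_fin addr_ge0.
have weak (m m' : nat) (X : R) : (m <= m')%N -> D <= X ->
    (holder_norm al (iter m' (Mtau tau) eta) <= (X * lam ^+ m)%:E * holder_norm al eta)%E.
  move=> mm DX; apply: le_trans (dec m') _; apply: lee_wpmul2r => //; rewrite lee_fin.
  apply: ler_pM => //; [exact: ltW|by apply: ltW|].
  by apply: ler_wiXn2l => //; exact: ltW.
split.
(* M^r fixes psi, so this is the decay of eta at time n r, which is at least n because r is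
   positive. *)
- have -> : (fun z => iter (n * r) (Mtau tau) phi z - psi z) = iter (n * r) (Mtau tau) eta.
    by rewrite /eta iterM_sub// per.
  by apply: weak => //; rewrite leq_pmulr.
- exact: weak.
- apply: le_trans (dec n) _; rewrite hnorm.
  apply: le_trans (lee_wpmul2l _ etan) _; first by rewrite lee_fin mulr_ge0// ltW.
  rewrite -!EFinM lee_fin.
  have -> : (D + 1) * (c0 + 2) * lam ^+ n * (A + B) = (D + 1) * (lam ^+ n * ((c0 + 2) * (A + B))) by ring.
  have c2 : 0 <= c0 + 2 by move: c01; move: (c0) => t; lra.
  have q0 : 0 <= lam ^+ n * ((c0 + 2) * (A + B)).
    by apply: mulr_ge0; [exact: ltW|apply: mulr_ge0 => //; exact: addr_ge0].
  by rewrite -mulrA ler_wpM2r// lerDl.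
- apply: le_trans (holder_norm_le p1 p2) _; rewrite hnorm -EFinM lee_fin.
  have AB : 0 <= A + B by rewrite addr_ge0.
  have h1 : (c0 + 2) * (A + B) <= (D + 1) * (c0 + 2) * (A + B).
    by rewrite -mulrA ler_peMl ?mulr_ge0//; [lra|lra].
  by apply: le_trans h1; lra.
Qed.
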